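(* Let $f:(\mathbb{C}^2,0)\to(\mathbb{C},0)$ be a strongly inner non-degenerate (SIND) mixed polynomial. Then $f$ satisfies the strong Milnor condition, i.e., there is $\rho_0>0$ such that for every $0<\rho\le\rho_0$ the map $$\frac{f}{|f|}:S^3_\rho\setminus V_f\to S^1$$ is a locally trivial fibration.
   Context: A mixed polynomial is a (not identically zero) finite sum $f(z,\bar z)=\sum_{\nu,\mu}c_{\nu,\mu}z^\nu\bar z^\mu$ with $z=(u,v)\in\mathbb{C}^2$, $\bar z=(\bar u,\bar v)$, $z^\nu=u^{\nu_1}v^{\nu_2}$, $\bar z^\mu=\bar u^{\mu_1}\bar v^{\mu_2}$. Its support is $\mathrm{supp}(f)=\{\nu+\mu: c_{\nu,\mu}\neq 0\}\subset\mathbb{N}^2$. $f_u,f_{\bar u},f_v,f_{\bar v}$ denote the (Wirtinger) partial derivatives. $V_f=f^{-1}(0)$, and $S^3_\rho\subset\mathbb{C}^2$ is the sphere of radius $\rho$ centred at the origin. Put $s_{1,f}=f_u\overline{f_{\bar v}}-\overline{f_{\bar u}}f_v$, $s_{2,f}=|f_u|^2-|f_{\bar u}|^2$, $s_{3,f}=|f_v|^2-|f_{\bar v}|^2$. The set of critical points of $f$ is $\Sigma_f=\{s_{1,f}=s_{2,f}=s_{3,f}=0\}$; it is the set of points where the real Jacobian matrix of $f$ does not have maximal rank. A positive weight vector is $P=(p_1,p_2)$ with $p_1,p_2$ positive integers. The radial degree of a monomial $c_{\nu,\mu}z^\nu\bar z^\mu$ is $p_1(\nu_1+\mu_1)+p_2(\nu_2+\mu_2)$;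 $d(P;f)$ is the minimal radial degree among the monomials of $f$, and the face function $f_P$ is the sum of the monomials of $f$ of radial degree $d(P;f)$. The Newton boundary $\Gamma_f$ is the union of the compact faces (vertices and 1-dimensional faces, ''1-faces'') of the convex hull of $\bigcup_{\nu+\mu\in\mathrm{supp}(f)}\left(\nu+\mu+\mathbb{R}_{\ge0}^2\right)$. For a compact face $\Delta$, $f_\Delta=\sum_{\nu+\mu\in\Delta}c_{\nu,\mu}z^\nu\bar z^\mu$, and $f_\Gamma=\sum_{\nu+\mu\in\Gamma_f}c_{\nu,\mu}z^\nu\bar z^\mu$. Let $P_1,\dots,P_N$ be the weight vectors (one for each 1-face) such that $f_{P_i}$ is the face function of a compact 1-face, with $P_i=(p_{i,1},p_{i,2})$ and $k_i=p_{i,1}/p_{i,2}$, ordered so that $k_1>k_2>\dots>k_N$. A vertex of $\Gamma_f$ is called extreme if it bounds a unique 1-face, and non-extreme if it bounds two. SIND: (i) $f_{P_1}$ has no critical points in $\mathbb{C}^2\setminus\{v=0\}$ and $f_{P_N}$ has no critical points in $\mathbb{C}^2\setminus\{u=0\}$; (ii) for each 1-face and each non-extreme vertex $\Delta$, $f_\Delta$ has no critical points in $(\mathbb{C}^* )^2$. If $\Gamma_f$ is a single vertex, $f$ is called SIND if $f_\Gamma$ has no critical points in $\mathbb{C}^2\setminus\{(0,0)\}$. *)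

(* Defs.v *)
From HB Require Import structures.
From mathcomp Require Import all_boot all_order all_algebra.
From mathcomp Require Import all_classical all_reals all_analysis.
From mathcomp Require Import complex.
(* The notations of mpoly clash with those of the analysis library. *)
From mathcomp Require Import -(notations) mpoly.

Set Implicit Arguments.
Unset Strict Implicit.
Unset Printing Implicit Defensive.

Import Order.TTheory GRing.Theory Num.Theory.
Import numFieldNormedType.Exports.

Local Open Scope classical_set_scope.
Local Open Scope ring_scope.

(* The field R[i] carries no topology by itself; R[i]^o has the one given by
   the modulus. *)
Notation CC R := (complex R)^o.

Section MixedPolynomials.
Variable R : realType.

(* A polynomial in the four variables u, v, \bar u, \bar v (in this order),
   that is, a finitely supported family of coefficients c_{nu,mu}. *)
Definition mixed_poly := mpoly 4 (complex R).

Definition idx_u  : 'I_4 := @Ordinal 4 0 isT.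
Definition idx_v  : 'I_4 := @Ordinal 4 1 isT.
Definition idx_ub : 'I_4 := @Ordinal 4 2 isT.
Definition idx_vb : 'I_4 := @Ordinal 4 3 isT.

Definition mixed_eval (f : mixed_poly) (z : CC R * CC R) : CC R :=
  meval
    (tnth [tuple (z.1 : complex R); (z.2 : complex R);
                 Num.conj (z.1 : complex R); Num.conj (z.2 : complex R)]) f.

Definition zero_locus (f : mixed_poly) : set (CC R * CC R) :=
  [set z | mixed_eval f z = 0].

(* The Wirtinger derivatives of a mixed polynomial: formal differentiation with
   u, v, \bar u, \bar v treated as independent variables. *)
Definition d_u  (f : mixed_poly) : mixed_poly := mderiv idx_u f.
Definition d_v  (f : mixed_poly) : mixed_poly := mderiv idx_v f.
Definition d_ub (f : mixed_poly) : mixed_poly := mderiv idx_ub f.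
Definition d_vb (f : mixed_poly) : mixed_poly := mderiv idx_vb f.

Definition s1 (f : mixed_poly) (z : CC R * CC R) : CC R :=
  mixed_eval (d_u f) z * Num.conj (mixed_eval (d_vb f) z)
  - Num.conj (mixed_eval (d_ub f) z) * mixed_eval (d_v f) z.

Definition s2 (f : mixed_poly) (z : CC R * CC R) : CC R :=
  `|mixed_eval (d_u f) z| ^+ 2 - `|mixed_eval (d_ub f) z| ^+ 2.

Definition s3 (f : mixed_poly) (z : CC R * CC R) : CC R :=
  `|mixed_eval (d_v f) z| ^+ 2 - `|mixed_eval (d_vb f) z| ^+ 2.

Definition critical_set (f : mixed_poly) : set (CC R * CC R) :=
  [set z | [/\ s1 f z = 0, s2 f z = 0 & s3 f z = 0]].

Definition no_critical_points_in (f : mixed_poly) (A : set (CC R * CC R)) :=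
  critical_set f `&` A = set0.

(* nu + mu *)
Definition total_exp (m : multinom 4) : nat * nat :=
  ((m idx_u + m idx_ub)%N, (m idx_v + m idx_vb)%N).

Definition exp_point (m : multinom 4) : R * R :=
  ((total_exp m).1%:R, (total_exp m).2%:R).

Definition positive_weight (P : nat * nat) : bool :=
  (0 < P.1)%N && (0 < P.2)%N.

Definition radial_degree (P : nat * nat) (m : multinom 4) : nat :=
  (P.1 * (total_exp m).1 + P.2 * (total_exp m).2)%N.

(* d(P;f); the default value, used to start the minimum, is the radial degree
   of a monomial of f when f is nonzero. *)
Definition min_radial_degree (P : nat * nat) (f : mixed_poly) : nat :=
  \big[minn/radial_degree P (mlead f)]_(m <- msupp f)
    radial_degree P m.

Definition monomial_of (f : mixed_poly) (m : multinom 4) : mixed_poly :=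
  mcoeff m f *: mpolyX (complex R) m.

Definition face_function (P : nat * nat) (f : mixed_poly) : mixed_poly :=
  \sum_(m <- msupp f | radial_degree P m == min_radial_degree P f)
    monomial_of f m.

(* f_Delta; with Delta the Newton boundary this is f_Gamma. *)
Definition restrict_to (f : mixed_poly) (D : set (R * R)) : mixed_poly :=
  \sum_(m <- msupp f | `[< D (exp_point m) >]) monomial_of f m.

Definition newton_polyhedron (f : mixed_poly) : set (R * R) :=
  smallest (fun A : set (R * R) => convex_set A)
    (\bigcup_(m in [set` msupp f])
       [set exp_point m + y | y in [set y : R * R | 0 <= y.1 /\ 0 <= y.2]]).

(* A nonempty face of K: the points of K where some linear functional attains
   its minimum over K. *)
Definition is_face (K F : set (R * R)) : Prop :=
  F !=set0 /\
  exists a b : R,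
    F = [set x | K x /\
                 forall y, K y -> a * x.1 + b * x.2 <= a * y.1 + b * y.2].

Definition compact_face (f : mixed_poly) (F : set (R * R)) : Prop :=
  is_face (newton_polyhedron f) F /\ compact F.

Definition vertex (f : mixed_poly) (x : R * R) : Prop :=
  compact_face f [set x].

Definition one_face (f : mixed_poly) (F : set (R * R)) : Prop :=
  compact_face f F /\ exists x y, [/\ F x, F y & x <> y].

Definition newton_boundary (f : mixed_poly) : set (R * R) :=
  \bigcup_(F in compact_face f) F.

Definition non_extreme_vertex (f : mixed_poly) (x : R * R) : Prop :=
  vertex f x /\
  exists F G, [/\ one_face f F, one_face f G, F <> G, F x & G x].

Definition slope (P : nat * nat) : rat := P.1%:R / P.2%:R.

(* Ps is the list P_1, ..., P_N. *)
Definition newton_weights (f : mixed_poly) (Ps : seq (nat * nat)) : Prop :=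
  [/\ all positive_weight Ps,
      forall P, P \in Ps ->
        exists D, one_face f D /\ face_function P f = restrict_to f D,
      forall D, one_face f D ->
        exists2 P, P \in Ps & face_function P f = restrict_to f D
    & sorted (fun P Q => slope Q < slope P) Ps].

Definition sind (f : mixed_poly) : Prop :=
  (exists x, newton_boundary f = [set x] /\
     no_critical_points_in (restrict_to f (newton_boundary f))
       [set z | z <> (0, 0)])
  \/
  (exists P1 Ps,
    [/\ newton_weights f (P1 :: Ps),
        no_critical_points_in (face_function P1 f) [set z | z.2 <> 0],
        no_critical_points_in (face_function (last P1 Ps) f)
          [set z | z.1 <> 0],
        forall D, one_face f D ->
          no_critical_points_in (restrict_to f D)
            [set z | z.1 <> 0 /\ z.2 <> 0]
      & forall x, non_extreme_vertex f x ->
          no_critical_points_in (restrict_to f [set x])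
            [set z | z.1 <> 0 /\ z.2 <> 0]]).

Definition sphere3 (rho : R) : set (CC R * CC R) :=
  [set z | `|z.1| ^+ 2 + `|z.2| ^+ 2 = (real_complex R rho) ^+ 2 :> CC R].

Definition circle : set (CC R) := [set w | `|w| = 1].

Lemma milnor_map_subproof (f : mixed_poly) (rho : R)
    (z : sphere3 rho `\` zero_locus f) :
  mixed_eval f (set_val z) / `|mixed_eval f (set_val z)| \in circle.
Proof.
case: z => z /= zE; have [_ /eqP fz] := set_mem zE.
rewrite set_valE /=; apply/mem_set; rewrite /circle /=.
by rewrite normrM normfV normr_id divff // normr_eq0.
Qed.

Definition milnor_map (f : mixed_poly) (rho : R)
    (z : sphere3 rho `\` zero_locus f) : circle :=
  exist (fun w => w \in circle) _ (milnor_map_subproof z).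

End MixedPolynomials.

Definition homeomorphism (X Y : topologicalType) (h : X -> Y) : Prop :=
  continuous h /\
  exists g : Y -> X, [/\ continuous g, cancel h g & cancel g h].

(* Topological local triviality over the whole base. Subsets are coerced to the
   subtypes they define, which carry the subspace topology. Surjectivity is
   required, so that empty fibres are excluded. *)
Definition locally_trivial_fibration (E B : topologicalType) (p : E -> B) :
    Prop :=
  [/\ continuous p,
      forall b, exists x, p x = b
    & forall b, exists U : set B, open_nbhs b U /\
        exists (F : topologicalType) (h : p @^-1` U -> (set_type U * F)%type),
          homeomorphism h /\ forall x, set_val (h x).1 = p (set_val x)].

Definition strong_milnor_condition (R : realType) (f : mixed_poly R) : Prop :=
  exists rho0 : R, 0 < rho0 /\
    forall rho : R, 0 < rho -> rho <= rho0 ->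
      locally_trivial_fibration (@milnor_map R f rho).

(* Main.v *)
Require Import Defs.
From mathcomp Require Import all_boot all_order all_algebra.
From mathcomp Require Import all_classical all_reals all_analysis.
From mathcomp Require Import complex.
From mathcomp Require Import -(notations) mpoly.
From mathcomp Require Import ring lra zify.

Set Implicit Arguments.
Unset Strict Implicit.
Unset Printing Implicit Defensive.

Import Order.TTheory GRing.Theory Num.Theory.
Import numFieldNormedType.Exports.
(* Re and Im are the projections of R[i], not those of a closed field. *)
Import complex.

Local Open Scope classical_set_scope.
Local Open Scope ring_scope.

(** The argument of f restricted to a small sphere has no critical point
    provided that, for every unit complex number om, the hypersurface
    Im (conj om * f) = 0 is nowhere singular off the origin and nowhere tangent to
    the sphere. Equivalently the gradient of Im (conj om * f) is, on this
    hypersurface, never a real multiple lam * z of the position vector. This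
    statement about a neighbourhood of the origin is sind_no_tangency; that it
    yields a fibration is milnor_fibration.

    Suppose that there are points of tangency z tending to 0, and rescale them
    by z = (t^p1 al_u, t^p2 al_v) with a positive weight (p1, p2). After division by
    suitable powers of t the tangency equations converge to equations about the
    face function f_P at the limit al0 of the points al, in which lam is replaced
    by multipliers nu_u and nu_v, one for each coordinate. Two facts make them
    disappear. The function conj om * f is real at the points of tangency, and the
    vector field p1 u d/du + p2 v d/dv together with its conjugate multiplies f_P by
    its degree; pairing the equations with this field gives
    p1 nu_u |al_u|^2 + p2 nu_v |al_v|^2 -> 0. Moreover nu_u and nu_v have the sign
    of lam, so that both terms tend to 0 (radial_tends0). Hence at al0 the gradient
    of Im (conj om * f_P) vanishes, which makes al0 a critical point of f_P
    (rank_defect_critical).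

    This contradicts non-degeneracy once the weight is chosen well
    (cuspidal_region, middle_region). Close to an axis, in a region
    |u|^p2 <= |v|^p1 for the weight of the first 1-face or its analogue for the
    last one, that weight is used; the limit can then lie on an axis, where a
    coordinate of al0 vanishes and the argument is completed by
    defect_axis_divisible and defect_axis_free. Between these regions one compares
    the monomials: either a second monomial stays comparable to the largest one,
    and the two span a 1-face whose weight is used, or a single monomial dominates,
    and it is a non-extreme vertex. All limits are taken along an ultrafilter, so
    that bounded quantities converge. The passage from the definition of strong
    inner non-degeneracy to these weights is plane convex geometry: the faces
    selected by positive weights (segment_face) and the next 1-face beyond an end
    point of a face (side_face).

    For the fibration, take on the sphere the tangential part zeta of |f|^2 times
    the gradient of the argument of f. By compactness and transversality |zeta| is at
    least a multiple of |f|, so the field proportional to |f|^2 zeta / |zeta|^2, along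
    which the argument grows at unit speed, is Lipschitz on the whole sphere,
    vanishing with f (cone_lipschitz). Its flow exists for a uniform time and turns
    the values of f by the angle t, up to positive factors (rotation_flow). Moving
    points along the flow until their argument is that of b identifies the part of the
    sphere above a short arc around b with a product (rotation_action_trivial). *)

(** * Local flows of Lipschitz vector fields *)

Section RealFunctions.
Variable R : realType.
Implicit Types (g : R -> R) (a t K : R).

(** The fundamental theorem of calculus is applied on [a, t + 1], so that t is
    an interior point. *)
Lemma antiderivative_right g a : continuous g ->
  exists G : R -> R, forall t, a < t -> is_derive t (1 : R) G (g t).
Proof.
move=> cg.
exists (fun y => (\int[lebesgue_measure]_(t in `[a, y]) g t)%R) => t at_.
have tu : t < t + 1 by rewrite ltrDl.
have intg : lebesgue_measure.-integrable `[a, t + 1] (EFin \o g).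
  apply: continuous_compact_integrable; first exact: segment_compact.
  exact: continuous_subspaceT.
have [dG <-] := continuous_FTC1_closed tu intg at_ (cg t).
by rewrite derive1E; exact: derivableP.
Qed.

Lemma derivable_lipschitz g (dg : R -> R) a b K :
    (forall t, a <= t <= b -> is_derive t (1 : R) g (dg t)) ->
    (forall t, a <= t <= b -> `|dg t| <= K) ->
  forall s t, a <= s <= b -> a <= t <= b -> `|g t - g s| <= K * `|t - s|.
Proof.
move=> gd dgK.
have mono s t : a <= s -> s < t -> t <= b -> `|g t - g s| <= K * `|t - s|.
  move=> as_ st tb.
  have [||c] := @MVT R g dg s t st.
  - move=> x; rewrite in_itv/= => /andP[sx xt]; apply: gd.
    by rewrite (le_trans as_ (ltW sx)) (le_trans (ltW xt) tb).
  - apply: continuous_in_subspaceT => x; rewrite inE/= in_itv/= => /andP[sx xt].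
    apply/differentiable_continuous/derivable1_diffP.
    have := gd x; rewrite (le_trans as_ sx) (le_trans xt tb) => /(_ isT) ?.
    exact: ex_derive.
  - rewrite in_itv/= => /andP[sc ct] ->; rewrite normrM ler_wpM2r//.
    by apply: dgK; rewrite (le_trans as_ (ltW sc)) (le_trans (ltW ct) tb).
move=> s t /andP[as_ sb] /andP[at_ tb].
have [st|ts|->] := ltgtP s t; first exact: mono.
  by rewrite distrC (distrC t); exact: mono.
by rewrite !subrr normr0 mulr0.
Qed.

(** The sequence u n - 2 K / 2^n increases, u n + 2 K / 2^n decreases, and the
    limit is the supremum of the former. *)
Lemma geometric_limit (u : nat -> R) K :
    (forall n, `|u n.+1 - u n| <= K / 2 ^+ n) ->
  exists l, forall n, `|l - u n| <= 2 * K / 2 ^+ n.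
Proof.
move=> uK.
pose w n := u n - 2 * K / 2 ^+ n; pose v n := u n + 2 * K / 2 ^+ n.
have halve n : 2 * K / 2 ^+ n.+1 = K / 2 ^+ n.
  by rewrite exprS; field; rewrite expf_neq0.
have two n : 2 * K / 2 ^+ n = K / 2 ^+ n + K / 2 ^+ n by ring.
have w_nd : {homo w : m n / (m <= n)%N >-> m <= n}.
  apply: homo_leq => [x|y x z|n] //; first exact: le_trans.
  by have := uK n; rewrite ler_norml /w halve two; lra.
have v_ni : {homo v : m n / (m <= n)%N >-> n <= m}.
  apply: homo_leq => [x|y x z xy yz|n] //; first exact: le_trans yz xy.
  by have := uK n; rewrite ler_norml /v halve two; lra.
have K0 n : 0 <= K / 2 ^+ n by apply: le_trans (uK n).
have wv m n : w m <= v n.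
  apply: (@le_trans _ _ (w (maxn m n))); first by rewrite w_nd// leq_maxl.
  apply: (@le_trans _ _ (v (maxn m n))); last by rewrite v_ni// leq_maxr.
  by rewrite /w /v two; have := K0 (maxn m n); lra.
have supw : has_sup (range w).
  by split; [exists (w 0%N), 0%N|exists (v 0%N) => _ [m _ <-]].
exists (sup (range w)) => n.
have : w n <= sup (range w) by apply: ub_le_sup; [case: supw|exists n].
have : sup (range w) <= v n by apply: ge_sup; [case: supw|move=> _ [m _ <-]].
by rewrite ler_norml /w /v; lra.
Qed.

End RealFunctions.

Section RowVectors.
Variables (R : realType) (n : nat).
Implicit Types (x y : 'rV[R]_n) (K L : R).

Lemma coord_le_norm x i : `|x 0 i| <= `|x|.
Proof.
rewrite [leRHS]/Num.norm/= mx_normrE.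
exact: (le_bigmax _ (fun ij : 'I_1 * 'I_n => `|x ij.1 ij.2|) (0, i)).
Qed.

Lemma norm_le_coord x K : 0 <= K -> (forall i, `|x 0 i| <= K) -> `|x| <= K.
Proof.
move=> K0 xK; rewrite [leLHS]/Num.norm/= mx_normrE.
by apply/bigmax_leP; split => //= -[i j] _ /=; rewrite ord1.
Qed.

Lemma cvg_rV (I : Type) (F : set_system I) {FF : Filter F} (h : I -> 'rV[R]_n)
    (l : 'rV[R]_n) : (forall j, (fun i => h i 0 j) @ F --> l 0 j) -> h @ F --> l.
Proof.
move=> H; apply/cvgrPdist_le => e e0.
have : \forall i \near F, forall j, `|l 0 j - h i 0 j| <= e.
  apply: filter_forall => j.
  exact: (iffLR (@cvgrPdist_le _ _ _ _ FF _ _) (H j)).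
apply: filterS => i ij; apply: norm_le_coord => [|j]; first exact: ltW.
by rewrite !mxE.
Qed.

Lemma cvg_coord (I : Type) (F : set_system I) {FF : Filter F} (h : I -> 'rV[R]_n)
    (l : 'rV[R]_n) j : h @ F --> l -> (fun i => h i 0 j) @ F --> l 0 j.
Proof.
move=> /cvgrPdist_le hl; apply/cvgrPdist_le => e /hl; apply: filterS => i.
by apply: le_trans; have := coord_le_norm (l - h i) j; rewrite !mxE.
Qed.

Lemma lipschitz_continuous_rV (X : 'rV[R]_n -> 'rV[R]_n) L : 0 <= L ->
  (forall x y, `|X x - X y| <= L * `|x - y|) -> continuous X.
Proof.
move=> L0 XL x.
apply: (iffRL (@cvgrPdist_le _ _ _ _ (nbhs_filter x) X (X x))) => e e0.
have L1 : 0 < L + 1 by rewrite ltr_wpDl.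
apply/nbhs_ballP; exists (e / (L + 1)) => [|y]; first exact: divr_gt0.
rewrite -ball_normE/= => /ltW xy; apply: (le_trans (XL _ _)).
move: xy; rewrite ler_pdivlMr// mulrC; apply: le_trans.
by rewrite ler_wpM2r// lerDl.
Qed.

End RowVectors.

Section LocalFlow.
Variables (R : realType) (n : nat) (X : 'rV[R]_n -> 'rV[R]_n) (L T : R).
Hypotheses (L0 : 0 <= L) (T0 : 0 < T).
Hypothesis XL : forall x y, `|X x - X y| <= L * `|x - y|.
Hypothesis LT : L * T <= 2^-1.

Definition solves (g : R -> 'rV[R]_n) := forall t i, `|t| < T ->
  is_derive t (1 : R) (fun s => g s 0 i) (X (g t) 0 i).

Lemma solves_continuous g t : solves g -> `|t| < T -> {for t, continuous g}.
Proof.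
move=> sg tT; apply: cvg_rV => i.
apply/differentiable_continuous/derivable1_diffP.
by have ? := sg t i tT; exact: ex_derive.
Qed.

(** At a time where |g - h| is maximal, the mean value inequality bounds it by
    its initial value plus half of itself, as L T <= 1/2; hence the factor 2. *)
Lemma solves_dist g h t : solves g -> solves h -> `|t| < T ->
  `|g t - h t| <= 2 * `|g 0 - h 0|.
Proof.
move=> sg sh tT.
have tt : - `|t| <= `|t| by have := normr_ge0 t; lra.
have inT s : - `|t| <= s <= `|t| -> `|s| < T.
  by rewrite -ler_norml => /le_lt_trans; apply.
have [|c] := @EVT_max R (fun s => `|g s - h s|) _ _ tt.
  apply: continuous_in_subspaceT => s; rewrite inE/= in_itv/= => /inT sT.
  apply: cvg_norm; apply: cvgB; exact: solves_continuous.
rewrite in_itv/= => /[dup] /inT cT ctt cmax.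
have gt : `|g t - h t| <= `|g c - h c|.
  by apply: cmax; rewrite in_itv/= -ler_norml.
have bound : `|g c - h c| <= `|g 0 - h 0| + 2^-1 * `|g c - h c|.
  apply: norm_le_coord => [|i]; first by rewrite addr_ge0// mulr_ge0.
  rewrite -[_ 0 i](subrK ((g 0 - h 0) 0 i)).
  apply: (le_trans (ler_normD _ _)); rewrite addrC lerD ?coord_le_norm//.
  have := @derivable_lipschitz R (fun s => g s 0 i - h s 0 i)
    (fun s => X (g s) 0 i - X (h s) 0 i) (- `|t|) `|t| (L * `|g c - h c|).
  move=> /(_ _ _ 0 c) H.
  have {H} : `|g c 0 i - h c 0 i - (g 0 0 i - h 0 0 i)|
      <= L * `|g c - h c| * `|c - 0|.
    apply: H => //.
    - by move=> s /inT sT; apply: is_deriveB; [exact: sg|exact: sh].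
    - move=> s st; have := coord_le_norm (X (g s) - X (h s)) i.
      rewrite !mxE => /le_trans; apply; apply: (le_trans (XL _ _)).
      by rewrite ler_wpM2l// cmax// in_itv.
    - by rewrite oppr_le0 normr_ge0.
  rewrite !mxE => /le_trans; apply.
  rewrite subr0 mulrAC; apply: ler_wpM2r => //.
  by apply: le_trans LT; rewrite ler_wpM2l// ltW.
have half : 2^-1 * `|g c - h c| + 2^-1 * `|g c - h c| = `|g c - h c| by field.
by rewrite (le_trans gt)//; lra.
Qed.

Let clamp (t : R) := Num.max (- T) (Num.min t T).

Let clampE t : `|t| <= T -> clamp t = t.
Proof.
by rewrite ler_norml /clamp => /andP[t1 t2]; rewrite min_l// max_r.
Qed.

Let clamp_le t : - T <= clamp t <= T.
Proof.
rewrite /clamp le_max lexx/= ge_max ge_min lexx orbT andbT.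
by move: T0; lra.
Qed.

Let clamp_continuous : continuous clamp.
Proof.
move=> t; apply: (@continuous_max _ _ (fun=> - T) (fun t => Num.min t T)).
  exact: cst_continuous.
apply: (@continuous_min _ _ id (fun=> T)); [exact: cvg_id|exact: cst_continuous].
Qed.

(** Picard iteration. Clamping the time to [-T, T] lets the iteration act on
    functions continuous on the whole line; L T <= 1/2 makes it halve uniform
    distances. *)
Lemma local_solution x : exists g : R -> 'rV[R]_n, g 0 = x /\ solves g.
Proof.
(* An antiderivative chosen as a function of the integrand. *)
have /choice[prim primP] : forall u : R -> R, exists G : R -> R,
    continuous u -> forall t, - T - 1 < t -> is_derive t (1 : R) G (u t).
  move=> u; have [cu|ncu] := pselect (continuous u).
    by have [G GP] := antiderivative_right (- T - 1) cu; exists G.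
  by exists (fun=> 0).
have inT t : - T <= t <= T -> - T - 1 < t by move=> /andP[]; lra.
have zT : - T <= 0 <= T by move: T0 => ?; apply/andP; split; lra.
have Xc : continuous X by exact: lipschitz_continuous_rV XL.
pose P (g : R -> 'rV[R]_n) (t : R) : 'rV[R]_n := \row_i
  (x 0 i + (prim (fun s => X (g s) 0 i) (clamp t) - prim (fun s => X (g s) 0 i) 0)).
have cX (g : R -> 'rV[R]_n) i : continuous g -> continuous (fun s => X (g s) 0 i).
  move=> cg t; apply: (cvg_comp (fun s => X (g s)) (fun v : 'rV[R]_n => v 0 i)).
    by apply: (cvg_comp g X); [exact: cg|exact: Xc].
  exact: coord_continuous.
have Pc (g : R -> 'rV[R]_n) : continuous g -> continuous (P g).
  move=> cg t; apply: cvg_rV => i.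
  pose v s := prim (fun s => X (g s) 0 i) s.
  have -> : (fun s => P g s 0 i) = (fun s => x 0 i + (v (clamp s) - v 0)).
    by apply/funext => s; rewrite mxE.
  have -> : P g t 0 i = x 0 i + (v (clamp t) - v 0) by rewrite mxE.
  apply: cvgD; first exact: cvg_cst.
  apply: cvgB; last exact: cvg_cst.
  apply: (cvg_comp clamp v); first exact: clamp_continuous.
  apply/differentiable_continuous/derivable1_diffP.
  have ? := primP _ (cX _ i cg) _ (inT _ (clamp_le t)).
  exact: ex_derive.
have PL (g h : R -> 'rV[R]_n) K : continuous g -> continuous h ->
    (forall s, `|g s - h s| <= K) -> forall t, `|P g t - P h t| <= 2^-1 * K.
  move=> cg ch ghK t.
  have K0 : 0 <= K by apply: le_trans (ghK 0).
  apply: norm_le_coord => [|i]; first by rewrite mulr_ge0.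
  have := @derivable_lipschitz R (fun s => prim (fun s => X (g s) 0 i) s -
     prim (fun s => X (h s) 0 i) s) (fun s => X (g s) 0 i - X (h s) 0 i)
     (- T) T (L * K).
  move=> /(_ _ _ 0 (clamp t)) H.
  rewrite !mxE opprD addrACA subrr add0r.
  rewrite opprD addrACA -opprD.
  apply: le_trans (H _ _ _ _) _ => //.
  - by move=> s /inT sT; apply: is_deriveB; apply: primP => //; exact: cX.
  - move=> s _; have := coord_le_norm (X (g s) - X (h s)) i.
    rewrite !mxE => /le_trans; apply; apply: (le_trans (XL _ _)).
    by rewrite ler_wpM2l.
  - rewrite subr0 mulrAC ler_wpM2r//; apply: le_trans LT.
    by rewrite ler_wpM2l// ler_norml.
pose u m := iter m P (fun=> x).
have uc m : continuous (u m).
  elim: m => [|m IH] /=; first by move=> ?; exact: cvg_cst.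
  exact: Pc.
have [K0 K0P] : exists K0, forall t, `|u 1%N t - u 0%N t| <= K0.
  exists (`|X x| * T) => t; apply: norm_le_coord => [|i].
    by rewrite mulr_ge0// ltW.
  rewrite /u /= !mxE addrAC subrr add0r.
  have := @derivable_lipschitz R (prim (fun s => X x 0 i))
     (fun s => X x 0 i) (- T) T `|X x|.
  move=> /(_ _ _ 0 (clamp t)) H; apply: le_trans (H _ _ _ _) _ => //.
  - move=> s /inT sT; apply: primP => // ?; exact: cvg_cst.
  - by move=> s _; exact: coord_le_norm.
  - by rewrite subr0 ler_wpM2l// ler_norml.
have uK m t : `|u m.+1 t - u m t| <= K0 / 2 ^+ m.
  elim: m t => [|m IH] t; first by rewrite expr0 divr1.
  rewrite /u [iter m.+2 P _]/= [iter m.+1 P _]/=.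
  apply: le_trans (PL _ _ _ (uc m.+1) (uc m) IH t) _.
  by rewrite exprS invfM mulrCA.
have /choice[g0 g0P] : forall t, exists l : 'rV[R]_n,
    forall m, `|l - u m t| <= 2 * K0 / 2 ^+ m.
  move=> t; have /choice[l lP] : forall i, exists l, forall m,
      `|l - u m t 0 i| <= 2 * K0 / 2 ^+ m.
    move=> i; apply: geometric_limit => m.
    by have := coord_le_norm (u m.+1 t - u m t) i; rewrite !mxE => /le_trans; apply.
  exists (\row_i l i) => m; apply: norm_le_coord => [|i]; last by rewrite !mxE.
  by rewrite -mulrA mulr_ge0// (le_trans _ (uK m t)).
have K00 : 0 <= K0 by apply: le_trans (K0P 0).
have small e : 0 < e -> exists m, 2 * K0 / 2 ^+ m <= e.
  move=> e0; have := @cvg_geometric R (2 * K0) 2^-1.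
  rewrite ger0_norm// invf_lt1// ltr1n => /(_ isT) /cvgrPdist_le/(_ _ e0)[m _ H].
  exists m; have := H m (leqnn m); rewrite /= sub0r normrN ger0_norm.
    by rewrite exprVn.
  by rewrite mulr_ge0// mulr_ge0.
have g0c : continuous g0.
  move=> t; apply/cvgrPdist_le => e e0.
  have [|m mP] := small (e / 3); first by rewrite divr_gt0.
  have /cvgrPdist_le/(_ (e / 3)) := uc m t.
  rewrite divr_gt0// => /(_ isT); apply: filterS => s us.
  have -> : g0 t - g0 s = (g0 t - u m t) + (u m t - u m s) + (u m s - g0 s).
    by rewrite !subrKA.
  apply: le_trans (ler_normD _ _) _.
  apply: le_trans (lerD (ler_normD _ _) (lexx _)) _.
  rewrite (distrC (u m s)).
  have := g0P t m; have := g0P s m; have := mP.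
  move: us; have : e / 3 + e / 3 + e / 3 = e by field.
  lra.
have g0E t : g0 t = P g0 t.
  apply/eqP; rewrite -subr_eq0 -normr_eq0 eq_le normr_ge0 andbT.
  apply/ler_addgt0Pl => e e0; rewrite addr0.
  have [|m mP] := small (e / 2); first by rewrite divr_gt0.
  have -> : g0 t - P g0 t = (g0 t - u m.+1 t) + (u m.+1 t - P g0 t).
    by rewrite addrA subrK.
  apply: le_trans (ler_normD _ _) _.
  have H1 := g0P t m.+1.
  have H2 : `|u m.+1 t - P g0 t| <= 2^-1 * (2 * K0 / 2 ^+ m).
    by apply: PL => // s; rewrite distrC.
  have H3 : 2 * K0 / 2 ^+ m.+1 = 2^-1 * (2 * K0 / 2 ^+ m).
    by rewrite exprS invfM mulrCA.
  have : e / 2 + e / 2 = e by field.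
  have : 2^-1 * (2 * K0 / 2 ^+ m) + 2^-1 * (2 * K0 / 2 ^+ m) = 2 * K0 / 2 ^+ m
    by field; rewrite expf_neq0.
  lra.
exists g0; split.
  rewrite g0E; apply/rowP => i; rewrite !mxE clampE ?subrr ?addr0//.
  by rewrite normr0 ltW.
move=> t i tT.
have tTT : - T <= t <= T by rewrite -ler_norml ltW.
pose v s := prim (fun s => X (g0 s) 0 i) s.
have dv : is_derive t (1 : R) v (X (g0 t) 0 i).
  by apply: primP; [exact: cX|exact: inT].
have : is_derive t (1 : R) (fun s => x 0 i + (v s - v 0)) (X (g0 t) 0 i).
  have := is_deriveD (is_derive_cst (x 0 i) t (1 : R))
    (is_deriveB dv (is_derive_cst (v 0) t (1 : R))).
  by rewrite subr0 add0r.
apply: near_eq_is_derive; rewrite ?oner_eq0//.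
near=> s; rewrite g0E mxE clampE//.
apply/ltW; near: s.
exact: (@cvgr_norm_lt _ _ _ _ (nbhs_filter t) id t cvg_id _ tT).
Unshelve. all: by end_near. Qed.

End LocalFlow.

(** * Locally Lipschitz functions and the Euclidean norm *)

Section LocallyLipschitz.
Variables (R : realType) (n : nat).
Implicit Types (x y : 'rV[R]_n) (K L M : R) (g h : 'rV[R]_n -> R).

Definition loc_lipschitz g := forall M, exists2 C, 0 <= C &
  forall x y, `|x| <= M -> `|y| <= M -> `|g x - g y| <= C * `|x - y|.

Lemma loc_lipschitz_bounded g M : loc_lipschitz g ->
  exists2 K, 0 <= K & forall x, `|x| <= M -> `|g x| <= K.
Proof.
move=> /(_ M)[C C0 gC]; exists (`|g 0| + C * `|M|) => [|x xM].
  by rewrite addr_ge0// mulr_ge0.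
have M0 : 0 <= M by apply: le_trans xM.
rewrite -[g x](subrK (g 0)) addrC (le_trans (ler_normD _ _))// lerD2l.
apply: (le_trans (gC _ _ xM _)); first by rewrite normr0.
by rewrite subr0 ler_wpM2l// (le_trans xM)// ler_norm.
Qed.

Lemma loc_lipschitz_continuous g : loc_lipschitz g -> continuous g.
Proof.
move=> gl x; have [C C0 gC] := gl (`|x| + 1).
apply: (iffRL (@cvgrPdist_le _ _ _ _ (nbhs_filter x) g (g x))) => e e0.
have C1 : 0 < C + 1 by rewrite ltr_wpDl.
apply/nbhs_ballP; exists (Num.min 1 (e / (C + 1))).
  by rewrite /= lt_min ltr01 divr_gt0.
move=> y; rewrite -ball_normE/= lt_min => /andP[/ltW xy1 /ltW xy].
apply: le_trans (gC _ _ _ _) _; first by rewrite lerDl.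
  rewrite -[y](subrK x) addrC (le_trans (ler_normD _ _))// lerD2l.
  by rewrite distrC.
move: xy; rewrite ler_pdivlMr// mulrC; apply: le_trans.
by rewrite ler_wpM2r// lerDl.
Qed.

Lemma loc_lipschitz_cst K : loc_lipschitz (fun=> K).
Proof. by move=> M; exists 0 => // x y _ _; rewrite subrr normr0 mul0r. Qed.

Lemma loc_lipschitz_coord i : loc_lipschitz (fun x => x 0 i).
Proof.
move=> M; exists 1 => // x y _ _; rewrite mul1r.
by have := coord_le_norm (x - y) i; rewrite !mxE.
Qed.

Lemma loc_lipschitzD g h : loc_lipschitz g -> loc_lipschitz h ->
  loc_lipschitz (fun x => g x + h x).
Proof.
move=> gl hl M; have [C C0 gC] := gl M; have [D D0 hD] := hl M.
exists (C + D) => [|x y xM yM]; first exact: addr_ge0.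
rewrite opprD addrACA (le_trans (ler_normD _ _))// mulrDl.
by rewrite lerD ?gC ?hD.
Qed.

Lemma loc_lipschitzM g h : loc_lipschitz g -> loc_lipschitz h ->
  loc_lipschitz (fun x => g x * h x).
Proof.
move=> gl hl M; have [C C0 gC] := gl M; have [D D0 hD] := hl M.
have [K K0 gK] := loc_lipschitz_bounded M gl.
have [L L0 hL] := loc_lipschitz_bounded M hl.
exists (K * D + C * L) => [|x y xM yM].
  by rewrite addr_ge0// mulr_ge0.
have -> : g x * h x - g y * h y = g x * (h x - h y) + (g x - g y) * h y by ring.
rewrite (le_trans (ler_normD _ _))// !normrM mulrDl lerD//.
  by rewrite -mulrA ler_pM ?gK ?hD.
by rewrite mulrAC ler_pM ?gC ?hL.
Qed.

Lemma loc_lipschitzN g : loc_lipschitz g -> loc_lipschitz (fun x => - g x).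
Proof.
move=> gl; have := loc_lipschitzM (loc_lipschitz_cst (-1)) gl.
by congr loc_lipschitz; apply/funext => x; rewrite mulN1r.
Qed.

Lemma loc_lipschitzB g h : loc_lipschitz g -> loc_lipschitz h ->
  loc_lipschitz (fun x => g x - h x).
Proof. by move=> gl hl; apply: loc_lipschitzD => //; exact: loc_lipschitzN. Qed.

Lemma loc_lipschitz_sum (I : Type) (s : seq I) (P : pred I)
    (g : I -> 'rV[R]_n -> R) : (forall i, loc_lipschitz (g i)) ->
  loc_lipschitz (fun x => \sum_(i <- s | P i) g i x).
Proof.
move=> gl; elim: s => [|i s IH].
  by under eq_fun do rewrite big_nil; exact: loc_lipschitz_cst.
under eq_fun do rewrite big_cons.
by case: (P i) => //; exact: loc_lipschitzD.
Qed.

(** Multiplying by the sum of the two roots covers the origin, where the root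
    is not differentiable. *)
Lemma dist_sqrt_sum_sqr (I : finType) (x y : I -> R) :
  `|Num.sqrt (\sum_i x i ^+ 2) - Num.sqrt (\sum_i y i ^+ 2)|
  <= \sum_i `|x i - y i|.
Proof.
set s := Num.sqrt _; set t := Num.sqrt _.
have sq0 (z : I -> R) : 0 <= \sum_i z i ^+ 2 by apply: sumr_ge0 => i _; exact: sqr_ge0.
have ss : s ^+ 2 = \sum_i x i ^+ 2 by rewrite sqr_sqrtr.
have tt : t ^+ 2 = \sum_i y i ^+ 2 by rewrite sqr_sqrtr.
have le_s (z : I -> R) i : `|z i| <= Num.sqrt (\sum_i z i ^+ 2).
  rewrite -sqrtr_sqr ler_wsqrtr// (bigD1 i)//= lerDl.
  by apply: sumr_ge0 => j _; exact: sqr_ge0.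
have s0 : 0 <= s by exact: sqrtr_ge0.
have t0 : 0 <= t by exact: sqrtr_ge0.
have [st0|st0] := eqVneq (s + t) 0.
  have -> : s = 0 by apply/eqP; rewrite eq_le s0 -st0 lerDl t0.
  have -> : t = 0 by apply/eqP; rewrite eq_le t0 -st0 lerDr s0.
  by rewrite subrr normr0; apply: sumr_ge0.
have st : 0 < s + t by rewrite lt_def st0 addr_ge0.
rewrite -(ler_pM2r st) -[X in _ * X <= _](ger0_norm (ltW st)) -normrM -subr_sqr.
rewrite ss tt -sumrB mulr_suml (le_trans (ler_norm_sum _ _ _))//.
apply: ler_sum => i _; rewrite subr_sqr normrM ler_wpM2l//.
by rewrite (le_trans (ler_normD _ _))// lerD// le_s.
Qed.

Lemma loc_lipschitz_hypot g h : loc_lipschitz g -> loc_lipschitz h ->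
  loc_lipschitz (fun x => Num.sqrt (g x ^+ 2 + h x ^+ 2)).
Proof.
move=> gl hl M; have [C C0 gC] := gl M; have [D D0 hD] := hl M.
exists (C + D) => [|x y xM yM]; first exact: addr_ge0.
have := @dist_sqrt_sum_sqr bool (fun c => if c then g x else h x)
  (fun c => if c then g y else h y).
rewrite !big_bool => /le_trans; apply.
by rewrite mulrDl lerD ?gC ?hD.
Qed.

Definition dot x y := \sum_i x 0 i * y 0 i.

Lemma dotC x y : dot x y = dot y x.
Proof. by apply: eq_bigr => i _; rewrite mulrC. Qed.

Lemma dotDl x y z : dot (x + y) z = dot x z + dot y z.
Proof. by rewrite -big_split/=; apply: eq_bigr => i _; rewrite mxE mulrDl. Qed.

Lemma dotZl K x y : dot (K *: x) y = K * dot x y.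
Proof. by rewrite mulr_sumr; apply: eq_bigr => i _; rewrite mxE mulrA. Qed.

Lemma dotZr K x y : dot x (K *: y) = K * dot x y.
Proof. by rewrite dotC dotZl dotC. Qed.

Lemma dotDr x y z : dot z (x + y) = dot z x + dot z y.
Proof. by rewrite dotC dotDl !(dotC z). Qed.

Lemma dotBl x y z : dot (x - y) z = dot x z - dot y z.
Proof. by rewrite -scaleN1r dotDl dotZl mulN1r. Qed.

Lemma dotBr x y z : dot z (x - y) = dot z x - dot z y.
Proof. by rewrite dotC dotBl !(dotC z). Qed.

Lemma dot0l x : dot 0 x = 0.
Proof. by apply: big1 => i _; rewrite mxE mul0r. Qed.

Lemma dot_ge0 x : 0 <= dot x x.
Proof. by apply: sumr_ge0 => i _; rewrite -expr2 sqr_ge0. Qed.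

Lemma dot_eq0 x : dot x x = 0 -> x = 0.
Proof.
move=> /eqP; rewrite psumr_eq0 => [/allP x0|i _]; last by rewrite -expr2 sqr_ge0.
apply/rowP => i; rewrite mxE; have /= := x0 i (mem_index_enum i).
by rewrite mulf_eq0 orbb => /eqP.
Qed.

Definition enorm x := Num.sqrt (dot x x).

Lemma enorm_ge0 x : 0 <= enorm x. Proof. exact: sqrtr_ge0. Qed.

Lemma enorm0 : enorm 0 = 0. Proof. by rewrite /enorm dot0l sqrtr0. Qed.

Lemma enorm_sqr x : enorm x ^+ 2 = dot x x.
Proof. by rewrite sqr_sqrtr// dot_ge0. Qed.

Lemma enorm_eq0 x : enorm x = 0 -> x = 0.
Proof. by move=> x0; apply: dot_eq0; rewrite -enorm_sqr x0 expr0n. Qed.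

Lemma enormZ K x : enorm (K *: x) = `|K| * enorm x.
Proof.
by rewrite /enorm dotZl dotZr mulrA -expr2 sqrtrM ?sqr_ge0// sqrtr_sqr.
Qed.

Lemma norm_le_enorm x : `|x| <= enorm x.
Proof.
apply: norm_le_coord => [|i]; first exact: enorm_ge0.
rewrite -sqrtr_sqr ler_wsqrtr// /dot (bigD1 i)//= -expr2 lerDl.
by apply: sumr_ge0 => j _; rewrite -expr2 sqr_ge0.
Qed.

Lemma dist_enorm x y : `|enorm x - enorm y| <= n%:R * `|x - y|.
Proof.
have := dist_sqrt_sum_sqr (fun i => x 0 i) (fun i => y 0 i).
have dE z : dot z z = \sum_i z 0 i ^+ 2.
  by apply: eq_bigr => i _; rewrite expr2.
rewrite /enorm !dE.
move=> /le_trans; apply.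
have -> : n%:R = \sum_(i < n) 1 :> R by rewrite sumr_const card_ord.
rewrite mulr_suml.
by apply: ler_sum => i _; rewrite mul1r; have := coord_le_norm (x - y) i; rewrite !mxE.
Qed.

Lemma loc_lipschitz_dot (u v : 'rV[R]_n -> 'rV[R]_n) :
    (forall i, loc_lipschitz (fun x => u x 0 i)) ->
    (forall i, loc_lipschitz (fun x => v x 0 i)) ->
  loc_lipschitz (fun x => dot (u x) (v x)).
Proof. by move=> ul vl; apply: loc_lipschitz_sum => i; exact: loc_lipschitzM. Qed.

(** The extension is positively homogeneous of degree one: this keeps a field
    tangent to one sphere tangent to all of them. *)
Lemma homogeneous_extension (rho : R) (X : 'rV[R]_n -> 'rV[R]_n) L :
    0 < rho -> 0 <= L ->
    (forall x y, enorm x = rho -> enorm y = rho -> `|X x - X y| <= L * `|x - y|) ->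
    (forall x, enorm x = rho -> dot (X x) x = 0) ->
  exists (Y : 'rV[R]_n -> 'rV[R]_n) (K : R), [/\ 0 <= K,
    forall x y, `|Y x - Y y| <= K * `|x - y|,
    forall x, enorm x = rho -> Y x = X x &
    forall x, dot (Y x) x = 0].
Proof.
move=> rho0 L0 XL Xt; have rho0' := ltW rho0.
pose pr x := (rho / enorm x) *: x.
have prS x : x != 0 -> enorm (pr x) = rho.
  move=> x0; have e0 : enorm x != 0 by apply: contra_neq x0; exact: enorm_eq0.
  by rewrite enormZ ger0_norm ?divr_ge0 ?enorm_ge0 ?ltW// divfK.
have [B B0 XB] : exists2 B, 0 <= B & forall x, enorm x = rho -> `|X x| <= B.
  have [[x0 x0S]|noS] := pselect (exists x, enorm x = rho); last first.
    by exists 0 => // x xS; case: noS; exists x.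
  exists (`|X x0| + L * (2 * rho)) => [|x xS].
    by rewrite addr_ge0// !mulr_ge0// ltW.
  rewrite -[X x](subrK (X x0)) addrC (le_trans (ler_normD _ _))// lerD2l.
  rewrite (le_trans (XL _ _ xS x0S))// ler_wpM2l// (le_trans (ler_normB _ _))//.
  have := norm_le_enorm x; have := norm_le_enorm x0; rewrite xS x0S; lra.
pose Y x := (enorm x / rho) *: X (pr x).
have Y0 : Y 0 = 0 by rewrite /Y enorm0 mul0r scale0r.
have YB x : `|Y x| <= B / rho * n%:R * `|x|.
  have [->|x0] := eqVneq x 0; first by rewrite Y0 !normr0 mulr0.
  rewrite /Y normrZ ger0_norm ?divr_ge0 ?enorm_ge0//.
  have := dist_enorm x 0; rewrite subr0.
  rewrite enorm0 subr0 ger0_norm ?enorm_ge0// => xn.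
  have -> : B / rho * n%:R * `|x| = (n%:R * `|x|) / rho * B by ring.
  by rewrite ler_pM ?divr_ge0 ?enorm_ge0 ?ler_wpM2r ?invr_ge0 ?XB ?prS.
exists Y, ((L + B / rho) * (1 + n%:R) ); split.
- by rewrite mulr_ge0 ?addr_ge0 ?divr_ge0// ltW.
- have Kge x : B / rho * n%:R * `|x| <= (L + B / rho) * (1 + n%:R) * `|x|.
    by rewrite ler_wpM2r// ler_pM ?lerDr ?divr_ge0.
  move=> x y.
  have [->|x0] := eqVneq x 0.
    by rewrite Y0 !sub0r !normrN (le_trans (YB _)).
  have [->|y0] := eqVneq y 0.
    by rewrite Y0 !subr0 (le_trans (YB _)).
  have ex : enorm x != 0 by apply: contra_neq x0; exact: enorm_eq0.
  have ey : enorm y != 0 by apply: contra_neq y0; exact: enorm_eq0.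
  have -> : Y x - Y y = (enorm x / rho) *: (X (pr x) - X (pr y)) +
      ((enorm x - enorm y) / rho) *: X (pr y).
    by apply/rowP => i; rewrite !mxE; field; rewrite gt_eqF.
  rewrite (le_trans (ler_normD _ _))//.
  rewrite (normrZ (enorm x / rho)) (normrZ ((enorm x - enorm y) / rho)).
  rewrite (ger0_norm (_ : 0 <= enorm x / rho)) ?divr_ge0 ?enorm_ge0//.
  have H1 : enorm x / rho * `|X (pr x) - X (pr y)| <= L * ((1 + n%:R) * `|x - y|).
    apply: (@le_trans _ _ (enorm x / rho * (L * `|pr x - pr y|))).
      by rewrite ler_wpM2l ?divr_ge0 ?enorm_ge0 ?XL ?prS.
    rewrite mulrCA ler_wpM2l//.
    rewrite -[enorm x / rho]ger0_norm ?divr_ge0 ?enorm_ge0// -normrZ.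
    have -> : (enorm x / rho) *: (pr x - pr y) =
        (x - y) + ((enorm y - enorm x) / enorm y) *: y.
      by apply/rowP => i; rewrite !mxE; field; rewrite ex ey gt_eqF.
    rewrite (le_trans (ler_normD _ _))// [leRHS]mulrDl mul1r lerD2l normrZ normrM normfV.
    rewrite (ger0_norm (enorm_ge0 y)) -mulrA distrC.
    rewrite (le_trans _ (dist_enorm x y))// -[leRHS]mulr1 ler_wpM2l//.
    by rewrite mulrC ler_pdivrMr ?mul1r ?norm_le_enorm// lt_def ey enorm_ge0.
  have H2 : `|(enorm x - enorm y) / rho| * `|X (pr y)| <=
      B / rho * ((1 + n%:R) * `|x - y|).
    rewrite normrM normfV (gtr0_norm rho0).
    rewrite mulrAC ler_pdivrMr// mulrAC divfK ?gt_eqF// mulrC ler_pM ?XB ?prS//.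
    by rewrite (le_trans (dist_enorm x y))// ler_wpM2r// lerDr.
  by rewrite -[leRHS]mulrA [leRHS]mulrDl lerD.
- move=> x xS; rewrite /Y /pr xS divff ?gt_eqF// !scale1r//.
- move=> x; have [->|x0] := eqVneq x 0.
    by rewrite Y0 dot0l.
  have ex : enorm x != 0 by apply: contra_neq x0; exact: enorm_eq0.
  have -> : x = (enorm x / rho) *: pr x.
    by rewrite scalerA mulrA divfK ?gt_eqF// divff// scale1r.
  rewrite {1}scalerA mulrA divfK ?gt_eqF// divff// scale1r.
  by rewrite /Y dotZl dotZr Xt ?prS ?mulr0.
Qed.

End LocallyLipschitz.

(** * A flow on the sphere that rotates the values of a map to the plane *)

Section SmallGronwall.
Variable R : realType.

(** Evaluate the mean value inequality at a point where |g| is maximal on the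
    segment between [t0] and [t]: there |g| is at most half of itself. *)
Lemma eq0_of_small_derivative (g dg : R -> R) (C T t0 : R) :
    (forall t, `|t| < T -> is_derive t (1 : R) g (dg t)) ->
    (forall t, `|t| < T -> `|dg t| <= C * `|g t|) -> 0 <= C ->
    C * (2 * T) <= 2^-1 -> `|t0| < T -> g t0 = 0 ->
  forall t, `|t| < T -> g t = 0.
Proof.
move=> gd dgC C0 CT t0T g0 t tT.
pose l := Num.min t t0; pose u := Num.max t t0.
have lu : l <= u by rewrite /l /u ge_min !le_max lexx.
have inT s : l <= s <= u -> `|s| < T.
  rewrite !ltr_norml /l /u in t0T tT *; move: t0T tT => /andP[? ?] /andP[? ?].
  by rewrite ge_min le_max => /andP[/orP[]? /orP[]?]; apply/andP; split; lra.
have l0 : l <= t0 <= u by rewrite /l /u ge_min le_max lexx !orbT.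
have lt : l <= t <= u by rewrite /l /u ge_min le_max lexx.
have [|c] := @EVT_max R (fun s => `|g s|) _ _ lu.
  apply: continuous_in_subspaceT => s; rewrite inE/= in_itv/= => /inT sT.
  apply: cvg_norm; apply/differentiable_continuous/derivable1_diffP.
  by have ? := gd s sT; exact: ex_derive.
rewrite in_itv/= => clu cmax.
have gc : `|g c| <= 2^-1 * `|g c|.
  rewrite -[X in `|X| <= _]subr0 -g0.
  have := @derivable_lipschitz R g dg l u (C * `|g c|).
  move=> /(_ _ _ t0 c) H; apply: le_trans (H _ _ _ _) _ => //.
  - by move=> s /inT; exact: gd.
  - move=> s slu; rewrite (le_trans (dgC _ (inT _ slu)))// ler_wpM2l//.
    by apply: cmax; rewrite in_itv.
  - rewrite mulrAC ler_wpM2r//; apply: le_trans CT; rewrite ler_wpM2l//.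
    rewrite (le_trans (ler_normB _ _))// mulr_natl mulr2n lerD// ltW//.
    exact: inT.
apply/eqP; rewrite -normr_le0.
by have := cmax t; rewrite in_itv/= => /(_ lt); lra.
Qed.

(** A change of sign would produce a zero, and then the function would vanish
    identically. *)
Lemma gt0_of_small_derivative (g dg : R -> R) (C T : R) :
    (forall t, `|t| < T -> is_derive t (1 : R) g (dg t)) ->
    (forall t, `|t| < T -> `|dg t| <= C * `|g t|) -> 0 <= C ->
    C * (2 * T) <= 2^-1 -> 0 < g 0 ->
  forall t, `|t| < T -> 0 < g t.
Proof.
move=> gd dgC C0 CT g0 t tT; rewrite ltNge; apply/negP => gt0.
have T0 : 0 < T by apply: le_lt_trans tT.
pose l := Num.min t 0; pose u := Num.max t 0.
have lu : l <= u by rewrite /l /u ge_min !le_max lexx.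
have inT s : l <= s <= u -> `|s| < T.
  move: tT; rewrite !ltr_norml /l /u => /andP[? ?].
  by rewrite ge_min le_max => /andP[/orP[]? /orP[]?]; apply/andP; split; lra.
have [||c] := @IVT R g l u 0 lu.
- apply: continuous_in_subspaceT => s; rewrite inE/= in_itv/= => /inT sT.
  apply/differentiable_continuous/derivable1_diffP.
  by have ? := gd s sT; exact: ex_derive.
- rewrite /l /u; case: (leP t 0) => _; rewrite ge_min le_max gt0 (ltW g0) ?orbT//.
rewrite in_itv/= => /inT cT gc.
have := eq0_of_small_derivative gd dgC C0 CT cT gc.
by move=> /(_ 0); rewrite normr0 => /(_ T0) g00; rewrite g00 ltxx in g0.
Qed.

End SmallGronwall.

Section Inversion.
Variables (R : realType) (n : nat).
Implicit Types x y u v : 'rV[R]_n.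

Lemma enorm_le_norm x : enorm x <= n%:R * `|x|.
Proof. by have := dist_enorm x 0; rewrite enorm0 !subr0 ger0_norm ?enorm_ge0. Qed.

Lemma norm_dot_le x y : `|dot x y| <= n%:R * (`|x| * `|y|).
Proof.
rewrite (le_trans (ler_norm_sum _ _ _))//.
have -> : n%:R = \sum_(i < n) 1 :> R by rewrite sumr_const card_ord.
rewrite mulr_suml; apply: ler_sum => i _.
by rewrite mul1r normrM ler_pM ?coord_le_norm.
Qed.

Lemma enorm_inversion u v : u != 0 -> v != 0 ->
  enorm ((dot u u)^-1 *: u - (dot v v)^-1 *: v) = enorm (u - v) / (enorm u * enorm v).
Proof.
have nz w : w != 0 -> dot w w != 0 by apply: contra_neq => /dot_eq0.
move=> /nz u0 /nz v0.
have eu : enorm u != 0 by rewrite -sqrf_eq0 enorm_sqr.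
have ev : enorm v != 0 by rewrite -sqrf_eq0 enorm_sqr.
apply/eqP; rewrite -(@eqrXn2 _ 2)// ?divr_ge0 ?mulr_ge0 ?enorm_ge0//.
rewrite exprMn exprVn exprMn !enorm_sqr !(dotBl, dotBr, dotZl, dotZr) (dotC v u).
by apply/eqP; field; rewrite u0 v0.
Qed.

(** The map (s, u) |-> s^2 u / |u|^2 is homogeneous of degree one, hence
    Lipschitz on the cone where |u| dominates s, although it is singular at the
    apex. *)
Lemma cone_lipschitz_aux (k s r : R) u v : 0 < k -> 0 <= s <= r ->
    k * s <= enorm u -> k * r <= enorm v ->
  `|(s ^+ 2 / dot u u) *: u - (r ^+ 2 / dot v v) *: v| <=
    n%:R / k ^+ 2 * `|u - v| + 2 / k * `|s - r|.
Proof.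
move=> k0 /andP[s0 sr] ku kv; have r0 := le_trans s0 sr.
have rhs0 : 0 <= n%:R / k ^+ 2 * `|u - v| + 2 / k * `|s - r|.
  by rewrite addr_ge0// mulr_ge0// divr_ge0// ?ltW// exprn_gt0.
have [r00|rN0] := eqVneq r 0.
  have s00 : s = 0 by apply/eqP; rewrite eq_le s0 -r00 sr.
  rewrite [X in `|X|](_ : _ = 0) ?normr0//.
  by rewrite s00 r00 expr0n/= !mul0r !scale0r subrr.
have rgt : 0 < r by rewrite lt_def rN0.
have ev : 0 < enorm v by apply: lt_le_trans kv; rewrite mulr_gt0.
have v0 : v != 0 by apply: contraTneq ev => ->; rewrite enorm0 ltxx.
have -> : (s ^+ 2 / dot u u) *: u - (r ^+ 2 / dot v v) *: v =
   s ^+ 2 *: ((dot u u)^-1 *: u - (dot v v)^-1 *: v)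
   + (s ^+ 2 - r ^+ 2) *: ((dot v v)^-1 *: v).
  by apply/rowP => i; rewrite !mxE; ring.
rewrite (le_trans (ler_normD _ _))// lerD//.
  have [->|sN0] := eqVneq s 0.
    by rewrite expr0n scale0r normr0 mulr_ge0// divr_ge0// exprn_ge0// ltW.
  have sgt : 0 < s by rewrite lt_def sN0.
  have eu : 0 < enorm u by apply: lt_le_trans ku; rewrite mulr_gt0.
  have u0 : u != 0 by apply: contraTneq eu => ->; rewrite enorm0 ltxx.
  rewrite normrZ ger0_norm ?sqr_ge0//.
  apply: (@le_trans _ _ (s ^+ 2 * (enorm (u - v) / (enorm u * enorm v)))).
    by rewrite ler_wpM2l ?sqr_ge0// -enorm_inversion// norm_le_enorm.
  have -> : n%:R / k ^+ 2 * `|u - v| = (n%:R * `|u - v|) / k ^+ 2 by ring.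
  rewrite mulrCA; apply: ler_pM.
  - exact: enorm_ge0.
  - by rewrite mulr_ge0 ?sqr_ge0// invr_ge0 mulr_ge0// ltW.
  - exact: enorm_le_norm.
  rewrite ler_pdivrMr ?mulr_gt0// mulrC ler_pdivlMr ?exprn_gt0//.
  rewrite -exprMn expr2 mulrC (mulrC s) ler_pM ?mulr_ge0 ?(ltW k0)//.
  by rewrite (le_trans _ kv)// ler_wpM2l// ltW.
have vE : dot v v = enorm v ^+ 2 by rewrite enorm_sqr.
rewrite normrZ (le_trans (ler_wpM2l _ (norm_le_enorm _)))//.
rewrite enormZ vE (ger0_norm (_ : 0 <= (enorm v ^+ 2)^-1)) ?invr_ge0 ?sqr_ge0//.
have -> : (enorm v ^+ 2)^-1 * enorm v = (enorm v)^-1 by field; rewrite gt_eqF.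
rewrite subr_sqr normrM mulrAC -mulrA [leRHS]mulrC; apply: ler_wpM2l => //.
rewrite (ger0_norm (addr_ge0 s0 r0)) -/(_ / _).
rewrite mulrC ler_pdivrMr// mulrAC ler_pdivlMr//.
rewrite (le_trans _ (ler_wpM2l _ kv))//.
rewrite mulrC [leRHS]mulrCA ler_pM2l//; move: sr; lra.
Qed.

Lemma cone_lipschitz (k s r : R) u v : 0 < k -> 0 <= s -> 0 <= r ->
    k * s <= enorm u -> k * r <= enorm v ->
  `|(s ^+ 2 / dot u u) *: u - (r ^+ 2 / dot v v) *: v| <=
    n%:R / k ^+ 2 * `|u - v| + 2 / k * `|s - r|.
Proof.
move=> k0 s0 r0 ku kv; have [sr|rs] := leP s r.
  by apply: cone_lipschitz_aux; rewrite ?s0.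
rewrite distrC (distrC u) (distrC s); apply: cone_lipschitz_aux => //.
by rewrite r0 ltW.
Qed.

End Inversion.

Section RotationFlow.
Variables (R : realType) (n : nat) (a b : 'rV[R]_n -> R).
Variables (da db : 'rV[R]_n -> 'rV[R]_n) (rho : R).
Hypotheses (rho0 : 0 < rho) (al : loc_lipschitz a) (bl : loc_lipschitz b).
Hypothesis dal : forall i, loc_lipschitz (fun x => da x 0 i).
Hypothesis dbl : forall i, loc_lipschitz (fun x => db x 0 i).

(** The chain rule along curves is all that the flow uses of a gradient. *)
Definition gradient_along (g : 'rV[R]_n -> R) (dg : 'rV[R]_n -> 'rV[R]_n) :=
  forall (c : R -> 'rV[R]_n) (t : R) (v : 'rV[R]_n),
    (forall i, is_derive t (1 : R) (fun s => c s 0 i) (v 0 i)) ->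
    is_derive t (1 : R) (fun s => g (c s)) (dot (dg (c t)) v).

Hypothesis ada : gradient_along a da.
Hypothesis bdb : gradient_along b db.
(* With f = a + ib, the gradient of Im (conj (p + iq) * f) is not radial at the
   points of the sphere where this function vanishes. *)
Hypothesis transverse : forall x p q lam, enorm x = rho ->
  p ^+ 2 + q ^+ 2 = 1 -> p * b x = q * a x -> p *: db x - q *: da x <> lam *: x.

(* On the sphere, twist is |f|^2 times the gradient of the argument of f, and
   zeta is rho^2 times the component of twist tangent to the sphere. The field
   is the multiple of zeta along which the argument of f grows at unit speed; it
   vanishes together with f. *)
Let radius x := Num.sqrt (a x ^+ 2 + b x ^+ 2).
Let twist x := a x *: db x - b x *: da x.
Let zeta x := rho ^+ 2 *: twist x - dot (twist x) x *: x.
Let field x := rho ^+ 2 *: ((radius x ^+ 2 / dot (zeta x) (zeta x)) *: zeta x).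

Let radius_sqr x : radius x ^+ 2 = a x ^+ 2 + b x ^+ 2.
Proof. by rewrite sqr_sqrtr// addr_ge0 ?sqr_ge0. Qed.

Let zeta_lipschitz i : loc_lipschitz (fun x => zeta x 0 i).
Proof.
have tl j : loc_lipschitz (fun x => twist x 0 j).
  have -> : (fun x => twist x 0 j) = (fun x => a x * db x 0 j - b x * da x 0 j).
    by apply/funext => x; rewrite !mxE.
  by apply: loc_lipschitzB; exact: loc_lipschitzM.
have -> : (fun x => zeta x 0 i) =
    (fun x => rho ^+ 2 * twist x 0 i - dot (twist x) x * x 0 i).
  by apply/funext => x; rewrite !mxE.
apply: loc_lipschitzB; apply: loc_lipschitzM => //.
- exact: loc_lipschitz_cst.
- by apply: loc_lipschitz_dot => // j; exact: loc_lipschitz_coord.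
- exact: loc_lipschitz_coord.
Qed.

Lemma loc_lipschitz_lsubmx (m : nat) (g : 'rV[R]_n -> R) : loc_lipschitz g ->
  loc_lipschitz (fun z : 'rV[R]_(n + m) => g (lsubmx z)).
Proof.
move=> gl M; have [C C0 gC] := gl M; exists C => // x y xM yM.
have lsub_le (z : 'rV[R]_(n + m)) : `|lsubmx z| <= `|z|.
  by apply: norm_le_coord => // i; rewrite mxE coord_le_norm.
rewrite (le_trans (gC _ _ _ _)) ?(le_trans (lsub_le _))//.
have -> : lsubmx x - lsubmx y = lsubmx (x - y).
  by apply/rowP => i; rewrite !mxE.
by rewrite ler_wpM2l.
Qed.

(** By homogeneity the values of f matter through their direction (p, q) on the
    unit circle. On the compact product of the sphere and the circle the
    tangential part of p db - q da vanishes nowhere above the zeros of p b - q a,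
    by transversality; so the sum g of the squares of the two has a positive
    minimum. *)
Let zeta_large : exists2 k, 0 < k &
  forall x, enorm x = rho -> k * radius x <= enorm (zeta x).
Proof.
have [[x0 x0S]|noS] := pselect (exists x : 'rV[R]_n, enorm x = rho); last first.
  by exists 1 => // x xS; case: noS; exists x.
pose l (z : 'rV[R]_(n + 2)) := lsubmx z.
pose p (z : 'rV[R]_(n + 2)) := z 0 (rshift n (0 : 'I_2)).
pose q (z : 'rV[R]_(n + 2)) := z 0 (rshift n (1 : 'I_2)).
pose W z := p z *: db (l z) - q z *: da (l z).
pose V z := rho ^+ 2 *: W z - dot (W z) (l z) *: l z.
pose g z := dot (V z) (V z) + (p z * b (l z) - q z * a (l z)) ^+ 2.
have pl : loc_lipschitz p by exact: loc_lipschitz_coord.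
have ql : loc_lipschitz q by exact: loc_lipschitz_coord.
have ll i : loc_lipschitz (fun z => l z 0 i).
  exact: (@loc_lipschitz_lsubmx 2 (fun x => x 0 i) (loc_lipschitz_coord i)).
have dott m (u v : 'rV[R]_m -> 'rV[R]_n) :
    (forall i, loc_lipschitz (fun x => u x 0 i)) ->
    (forall i, loc_lipschitz (fun x => v x 0 i)) ->
    loc_lipschitz (fun x => dot (u x) (v x)).
  by move=> ul vl; apply: loc_lipschitz_sum => i; exact: loc_lipschitzM.
have Wl i : loc_lipschitz (fun z => W z 0 i).
  have -> : (fun z => W z 0 i) = (fun z => p z * db (l z) 0 i - q z * da (l z) 0 i).
    by apply/funext => z; rewrite !mxE.
  apply: loc_lipschitzB; apply: loc_lipschitzM => //.
    exact: (@loc_lipschitz_lsubmx 2 (fun x => db x 0 i) (dbl i)).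
  exact: (@loc_lipschitz_lsubmx 2 (fun x => da x 0 i) (dal i)).
have Vl i : loc_lipschitz (fun z => V z 0 i).
  have -> : (fun z => V z 0 i) = (fun z => rho ^+ 2 * W z 0 i - dot (W z) (l z) * l z 0 i).
    by apply/funext => z; rewrite !mxE.
  apply: loc_lipschitzB; apply: loc_lipschitzM => //; last exact: dott.
  exact: loc_lipschitz_cst.
have gl : loc_lipschitz g.
  apply: loc_lipschitzD; first exact: dott.
  under eq_fun do rewrite expr2.
  by apply: loc_lipschitzM; apply: loc_lipschitzB; apply: loc_lipschitzM => //;
    exact: loc_lipschitz_lsubmx.
pose K := [set z | dot (l z) (l z) = rho ^+ 2 /\ p z * p z + q z * q z = 1].
have Kc : compact K.
  apply: bounded_closed_compact.
    exists (rho + 1); split; first exact: num_real.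
    move=> M M1 z [lz pq]; apply: norm_le_coord => [|i].
      by rewrite (le_trans _ (ltW M1))// addr_ge0// ltW.
    apply: (le_trans _ (ltW M1)).
    have pq2 : p z ^+ 2 <= 1 /\ q z ^+ 2 <= 1.
      by rewrite -!expr2 in pq; rewrite -pq lerDl lerDr !sqr_ge0.
    rewrite -(splitK i); case: (fintype.split i) => j /=.
      have -> : z 0 (lshift 2 j) = l z 0 j by rewrite mxE.
      rewrite (le_trans (coord_le_norm _ _))// (le_trans (norm_le_enorm _))//.
      by rewrite /enorm lz sqrtr_sqr (ger0_norm (ltW rho0)) lerDl.
    have sq1 (c : R) : c ^+ 2 <= 1 -> `|c| <= rho + 1.
      move=> c1; rewrite -sqrtr_sqr (le_trans (ler_wsqrtr c1))// sqrtr1.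
      by rewrite lerDr ltW.
    case: (unliftP 0 j) => [j'|] ->; last exact: sq1 pq2.1.
    by rewrite ord1; apply: sq1; apply: le_trans pq2.2; rewrite /q (_ : lift _ _ = 1)//; apply/val_inj.
  have -> : K = (fun z => dot (l z) (l z)) @^-1` [set rho ^+ 2] `&`
      (fun z => p z * p z + q z * q z) @^-1` [set 1] by [].
  apply: closedI; (apply: closed_comp; last exact: closed_eq) => z _.
    by apply: (loc_lipschitz_continuous (g := fun z => dot (l z) (l z))); exact: dott.
  apply: (loc_lipschitz_continuous (g := fun z => p z * p z + q z * q z)).
  by apply: loc_lipschitzD; exact: loc_lipschitzM.
have K0 : K !=set0.
  exists (row_mx x0 (\row_j (if j == 0 then 1 else 0))); split.
    by rewrite /l row_mxKl -enorm_sqr x0S.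
  by rewrite /p /q !row_mxEr !mxE/= mulr1 mulr0 addr0.
have gc : {within K, continuous g}.
  by apply: continuous_subspaceT; exact: loc_lipschitz_continuous.
have [z0 /set_mem[z01 z02] gmin] := EVT_min_rV K0 Kc gc.
have g0 : 0 < g z0.
  rewrite lt_def addr_ge0 ?dot_ge0 ?sqr_ge0// andbT paddr_eq0 ?dot_ge0 ?sqr_ge0//.
  apply/negP => /andP[/eqP/dot_eq0 V0]; rewrite sqrf_eq0 subr_eq0 => /eqP pq.
  have lS : enorm (l z0) = rho by rewrite /enorm z01 sqrtr_sqr ger0_norm// ltW.
  apply: (transverse (lam := dot (W z0) (l z0) / rho ^+ 2) lS _ pq).
    by rewrite !expr2.
  rewrite -/(W z0); apply: (scalerI (a := rho ^+ 2)); first by rewrite expf_neq0// gt_eqF.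
  rewrite scalerA mulrCA divff ?mulr1 ?expf_neq0 ?gt_eqF//.
  by apply/eqP; rewrite -subr_eq0; apply/eqP.
exists (Num.sqrt (g z0)); first by rewrite sqrtr_gt0.
move=> x xS; have [->|r0] := eqVneq (radius x) 0.
  by rewrite mulr0 enorm_ge0.
pose z := row_mx x (\row_j (if j == 0 then a x / radius x else b x / radius x)) : 'rV[R]_(n + 2).
have lz : l z = x by rewrite /l row_mxKl.
have pz : p z = a x / radius x by rewrite /p row_mxEr mxE.
have qz : q z = b x / radius x by rewrite /q row_mxEr mxE.
have rr : radius x ^+ 2 != 0 by rewrite sqrf_eq0.
have zK : z \in K.
  apply/mem_set; split; first by rewrite lz -enorm_sqr xS.
  by rewrite pz qz -!expr2 !expr_div_n -mulrDl -radius_sqr divff.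
have rge0 : 0 <= radius x by exact: sqrtr_ge0.
have zE : zeta x = radius x *: V z.
  rewrite /zeta /V /W lz pz qz.
  have -> : twist x = radius x *: ((a x / radius x) *: db x - (b x / radius x) *: da x).
    by rewrite /twist; apply/rowP => i; rewrite !mxE; field.
  by rewrite dotZl; apply/rowP => i; rewrite !mxE; ring.
rewrite zE enormZ (ger0_norm rge0) mulrC ler_wpM2l// /enorm ler_wsqrtr//.
apply: le_trans (gmin _ zK) _; rewrite /g lz pz qz.
by rewrite [X in _ + X](_ : _ = 0) ?addr0//; field.
Qed.

Let twist_zeta x : enorm x = rho ->
  dot (twist x) (zeta x) * rho ^+ 2 = dot (zeta x) (zeta x) /\ dot (zeta x) x = 0.
Proof.
move=> xS; have xx : dot x x = rho ^+ 2 by rewrite -enorm_sqr xS.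
rewrite /zeta; move: (twist x) => u.
by rewrite !(dotBl, dotBr, dotZl, dotZr) xx ?(dotC x u); split; ring.
Qed.

(** By zeta_large the pair (radius, zeta) satisfies the cone condition of
    cone_lipschitz, so the field is Lipschitz up to the zeros of f. *)
Let field_lipschitz : exists2 L, 0 <= L & forall x y, enorm x = rho ->
  enorm y = rho -> `|field x - field y| <= L * `|x - y|.
Proof.
have [k k0 kP] := zeta_large.
have [Cr Cr0 CrP] := loc_lipschitz_hypot al bl rho.
have /choice[Cz CzP] : forall i, exists C, 0 <= C /\ forall x y, `|x| <= rho ->
    `|y| <= rho -> `|zeta x 0 i - zeta y 0 i| <= C * `|x - y|.
  by move=> i; have [C C0 CP] := zeta_lipschitz i rho; exists C.
have Cz0 i : 0 <= Cz i by have [] := CzP i.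
exists (rho ^+ 2 * (n%:R / k ^+ 2 * (\sum_i Cz i) + 2 / k * Cr)).
  by rewrite mulr_ge0 ?sqr_ge0// addr_ge0// mulr_ge0// ?divr_ge0// ?sqr_ge0 ?sumr_ge0// ltW.
move=> x y xS yS; rewrite -scalerBr normrZ ger0_norm ?sqr_ge0// -[leRHS]mulrA.
have xr : `|x| <= rho by rewrite -xS norm_le_enorm.
have yr : `|y| <= rho by rewrite -yS norm_le_enorm.
rewrite ler_wpM2l ?sqr_ge0//.
rewrite (le_trans (cone_lipschitz k0 _ _ (kP x xS) (kP y yS))) ?sqrtr_ge0//.
rewrite [leRHS]mulrDl -!mulrA !(mulrA _ k^-1) !(mulrA _ (k ^+ 2)^-1).
rewrite lerD// ler_wpM2l ?divr_ge0 ?sqr_ge0 ?(ltW k0) ?CrP//.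
apply: norm_le_coord => [|i]; first by rewrite mulr_ge0 ?sumr_ge0.
have -> : (zeta x - zeta y) 0 i = zeta x 0 i - zeta y 0 i.
  by move: (zeta x) (zeta y) => u v; rewrite !mxE.
rewrite (le_trans ((CzP i).2 _ _ xr yr))// ler_wpM2r//.
by rewrite (bigD1 i)//= lerDl sumr_ge0.
Qed.

Let twist_field x : enorm x = rho -> dot (twist x) (field x) = radius x ^+ 2.
Proof.
move=> xS; have [k k0 kP] := zeta_large.
have [tz _] := twist_zeta xS; rewrite /field !dotZr.
have [zz|zz] := eqVneq (dot (zeta x) (zeta x)) 0.
  have r0 : radius x = 0.
    apply/eqP; rewrite eq_le sqrtr_ge0 andbT -(pmulr_rle0 _ k0).
    by rewrite (le_trans (kP x xS))// /enorm zz sqrtr0.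
  by rewrite zz r0 expr0n/= !mul0r mulr0.
by rewrite -tz in zz *; field; move: zz; rewrite mulf_eq0 sqrf_eq0 negb_or => /andP[-> ->].
Qed.

(** Along the field, d log |f| stays bounded. *)
Let field_log_bounded : exists2 C, 0 <= C & forall x, enorm x = rho ->
  `|a x * dot (da x) (field x) + b x * dot (db x) (field x)| <= C * radius x ^+ 2.
Proof.
have [k k0 kP] := zeta_large.
have bnd (u : 'rV[R]_n -> 'rV[R]_n) : (forall i, loc_lipschitz (fun x => u x 0 i)) ->
    exists2 C, 0 <= C & forall x, enorm x = rho -> `|u x| <= C.
  move=> ul; have /choice[C CP] : forall i, exists C, 0 <= C /\
      forall x, `|x| <= rho -> `|u x 0 i| <= C.
    by move=> i; have [C C0 CP] := loc_lipschitz_bounded rho (ul i); exists C.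
  have C0 i : 0 <= C i by have [] := CP i.
  exists (\sum_i C i); first by rewrite sumr_ge0.
  move=> x xS; apply: norm_le_coord => [|i]; first by rewrite sumr_ge0.
  rewrite (le_trans ((CP i).2 x _)) -?xS ?norm_le_enorm//.
  by rewrite (bigD1 i)//= lerDl sumr_ge0.
have [Ca Ca0 CaP] := bnd _ dal; have [Cb Cb0 CbP] := bnd _ dbl.
exists (n%:R * (Ca + Cb) * (rho ^+ 2 / k)).
  have rk0 : 0 <= rho ^+ 2 / k by rewrite divr_ge0 ?sqr_ge0// ltW.
  by rewrite mulr_ge0// mulr_ge0// addr_ge0.
move=> x xS; have r0 : 0 <= radius x by exact: sqrtr_ge0.
have ar : `|a x| <= radius x.
  by rewrite -sqrtr_sqr ler_wsqrtr// lerDl sqr_ge0.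
have br : `|b x| <= radius x.
  by rewrite -sqrtr_sqr ler_wsqrtr// lerDr sqr_ge0.
have fr : `|field x| <= rho ^+ 2 / k * radius x.
  rewrite normrZ ger0_norm ?sqr_ge0// -mulrA ler_wpM2l ?sqr_ge0//.
  rewrite (le_trans (norm_le_enorm _))// enormZ ger0_norm ?divr_ge0 ?sqr_ge0 ?dot_ge0//.
  rewrite -enorm_sqr; have := kP x xS.
  have [->|z0] := eqVneq (enorm (zeta x)) 0.
    by move=> _; rewrite mulr0 mulr_ge0// invr_ge0 ltW.
  have zp : 0 < enorm (zeta x) by rewrite lt_def z0 enorm_ge0.
  move=> kr; have -> : radius x ^+ 2 / enorm (zeta x) ^+ 2 * enorm (zeta x)
    = radius x * radius x / enorm (zeta x) by field.
  rewrite ler_pdivrMr// mulrAC ler_wpM2r// mulrC ler_pdivlMr// mulrC//.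
have part (g : R) (u : 'rV[R]_n) (C : R) : 0 <= C -> `|g| <= radius x -> `|u| <= C ->
    `|g * dot u (field x)| <= n%:R * C * (rho ^+ 2 / k) * radius x ^+ 2.
  move=> C0 gr uC; rewrite normrM.
  have -> : n%:R * C * (rho ^+ 2 / k) * radius x ^+ 2 =
     radius x * (n%:R * (C * (rho ^+ 2 / k * radius x))) by ring.
  rewrite ler_pM// (le_trans (norm_dot_le _ _))// ler_wpM2l// ler_pM//.
rewrite (le_trans (ler_normD _ _))// mulrDr !mulrDl lerD// part ?CaP ?CbP//.
Qed.

(** Rotating the value of f along a solution by -t leaves a multiple of the
    initial value: both rotated coordinates solve the same linear scalar
    equation. *)
Let rotation_along (Y : 'rV[R]_n -> 'rV[R]_n) C T c :
    0 <= C -> C * (2 * T) <= 2^-1 ->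
    (forall x, enorm x = rho ->
      `|a x * dot (da x) (field x) + b x * dot (db x) (field x)| <= C * radius x ^+ 2) ->
    (forall x, enorm x = rho -> Y x = field x) ->
    solves Y T c -> (forall t, `|t| < T -> enorm (c t) = rho) ->
    a (c 0) ^+ 2 + b (c 0) ^+ 2 != 0 ->
  forall t, `|t| < T -> exists2 k, 0 < k &
    a (c t) = k * (cos t * a (c 0) - sin t * b (c 0)) /\
    b (c t) = k * (sin t * a (c 0) + cos t * b (c 0)).
Proof.
move=> C0 CT bndC Yf sc cS nz t tT.
have T0 : 0 < T by apply: le_lt_trans tT.
have z0T : `|0 : R| < T by rewrite normr0.
pose al' s := dot (da (c s)) (field (c s)).
pose be' s := dot (db (c s)) (field (c s)).
pose r s := (a (c s) * al' s + b (c s) * be' s) / radius (c s) ^+ 2.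
have dac s : `|s| < T -> is_derive s (1 : R) (fun s => a (c s)) (al' s).
  by move=> sT; apply: ada => i; rewrite -Yf ?cS//; exact: sc.
have dbc s : `|s| < T -> is_derive s (1 : R) (fun s => b (c s)) (be' s).
  by move=> sT; apply: bdb => i; rewrite -Yf ?cS//; exact: sc.
have rel s : `|s| < T -> al' s = r s * a (c s) - b (c s) /\
    be' s = r s * b (c s) + a (c s).
  move=> sT; have := twist_field (cS s sT).
  have -> : dot (twist (c s)) (field (c s)) = a (c s) * be' s - b (c s) * al' s.
    by rewrite /twist dotBl !dotZl.
  rewrite /r; have [r0|r0] := eqVneq (radius (c s)) 0.
    have := radius_sqr (c s); rewrite r0 expr0n/= => /esym/eqP.
    rewrite paddr_eq0 ?sqr_ge0// !sqrf_eq0 => /andP[/eqP a0 /eqP b0] _.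
    rewrite a0 b0 !mulr0 oppr0 addr0.
    have f0 : field (c s) = 0 by rewrite /field r0 expr0n/= mul0r scale0r scaler0.
    by rewrite /al' /be' f0 !(dotC _ 0) !dot0l.
  have q0 : radius (c s) ^+ 2 != 0 by rewrite sqrf_eq0.
  move=> tf; move: q0; rewrite -{}tf; set D := (X in X != 0) => D0.
  have DE : D = a (c s) ^+ 2 + b (c s) ^+ 2.
    by rewrite -radius_sqr -twist_field ?cS// /twist dotBl !dotZl.
  split; apply: (mulIf D0); rewrite mulrDl mulrAC ?mulNr divfK//.
    by rewrite {1}DE /D; ring.
  by rewrite {1}DE /D; ring.
have rC s : `|s| < T -> `|r s| <= C.
  move=> sT; have := bndC _ (cS s sT); rewrite /r.
  have [->|r0] := eqVneq (radius (c s)) 0.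
    by rewrite expr0n/= invr0 !mulr0 normr0.
  have rp : 0 < radius (c s) ^+ 2 by rewrite exprn_gt0// lt_def r0 sqrtr_ge0.
  by move=> H; rewrite normrM normfV (gtr0_norm rp) ler_pdivrMr.
pose A s := a (c s) * cos s + b (c s) * sin s.
pose B s := b (c s) * cos s - a (c s) * sin s.
have dA s : `|s| < T -> is_derive s (1 : R) A (r s * A s).
  move=> sT; have [ra rb] := rel s sT; have ? := dac s sT; have ? := dbc s sT.
  apply: is_derive_eq; rewrite /A ra rb /GRing.scale/=; ring.
have dB s : `|s| < T -> is_derive s (1 : R) B (r s * B s).
  move=> sT; have [ra rb] := rel s sT; have ? := dac s sT; have ? := dbc s sT.
  apply: is_derive_eq; rewrite /B ra rb /GRing.scale/=; ring.
set a0 := a (c 0) in nz *; set b0 := b (c 0) in nz *.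
have A0 : A 0 = a0 by rewrite /A cos0 sin0 mulr0 mulr1 addr0.
have B0 : B 0 = b0 by rewrite /B cos0 sin0 mulr0 mulr1 subr0.
have H1 : B t * a0 - A t * b0 = 0.
  apply: (@eq0_of_small_derivative R (fun s => B s * a0 - A s * b0)
    (fun s => r s * (B s * a0 - A s * b0)) C T 0) => //.
  - move=> s sT; have ? := dA s sT; have ? := dB s sT.
    apply: is_derive_eq; rewrite /GRing.scale/=; ring.
  - by move=> s sT; rewrite normrM ler_wpM2r// rC.
  - by rewrite A0 B0; ring.
have H2 : 0 < A t * a0 + B t * b0.
  apply: (@gt0_of_small_derivative R (fun s => A s * a0 + B s * b0)
    (fun s => r s * (A s * a0 + B s * b0)) C T) => //.
  - move=> s sT; have ? := dA s sT; have ? := dB s sT.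
    apply: is_derive_eq; rewrite /GRing.scale/=; ring.
  - by move=> s sT; rewrite normrM ler_wpM2r// rC.
  - by rewrite A0 B0 -!expr2 lt_def nz addr_ge0 ?sqr_ge0.
have nzp : 0 < a0 ^+ 2 + b0 ^+ 2 by rewrite lt_def nz addr_ge0 ?sqr_ge0.
exists ((A t * a0 + B t * b0) / (a0 ^+ 2 + b0 ^+ 2)); first exact: divr_gt0.
set k := _ / _.
have Ak : A t = k * a0.
  rewrite /k; apply: (mulIf nz); rewrite mulrAC divfK//.
  have -> : A t * (a0 ^+ 2 + b0 ^+ 2) = (A t * a0 + B t * b0) * a0 - (B t * a0 - A t * b0) * b0 by ring.
  by rewrite H1 mul0r subr0.
have Bk : B t = k * b0.
  rewrite /k; apply: (mulIf nz); rewrite mulrAC divfK//.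
  have -> : B t * (a0 ^+ 2 + b0 ^+ 2) = (A t * a0 + B t * b0) * b0 + (B t * a0 - A t * b0) * a0 by ring.
  by rewrite H1 mul0r addr0.
have cs : cos t ^+ 2 + sin t ^+ 2 = 1 by rewrite cos2Dsin2.
split.
  have -> : k * (cos t * a0 - sin t * b0) = A t * cos t - B t * sin t.
    by rewrite Ak Bk; ring.
  have -> : A t * cos t - B t * sin t = a (c t) * (cos t ^+ 2 + sin t ^+ 2).
    by rewrite /A /B; ring.
  by rewrite cs mulr1.
have -> : k * (sin t * a0 + cos t * b0) = A t * sin t + B t * cos t.
  by rewrite Ak Bk; ring.
have -> : A t * sin t + B t * cos t = b (c t) * (cos t ^+ 2 + sin t ^+ 2).
  by rewrite /A /B; ring.
by rewrite cs mulr1.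
Qed.

(** The field, extended homogeneously, is globally Lipschitz; hence its flow
    exists for a time independent of the starting point, the zeros of f
    included, and preserves the sphere. *)
Theorem rotation_flow : exists (T C : R) (Phi : R -> 'rV[R]_n -> 'rV[R]_n),
  [/\ 0 < T,
   forall x t, enorm x = rho -> `|t| < T ->
     enorm (Phi t x) = rho /\ Phi (- t) (Phi t x) = x,
   forall x y s t, enorm x = rho -> enorm y = rho -> `|s| < T -> `|t| < T ->
     `|Phi s x - Phi t y| <= C * (`|x - y| + `|s - t|) &
   forall x t, enorm x = rho -> `|t| < T -> a x ^+ 2 + b x ^+ 2 != 0 ->
     exists2 k, 0 < k &
       a (Phi t x) = k * (cos t * a x - sin t * b x) /\
       b (Phi t x) = k * (sin t * a x + cos t * b x)].
Proof.
have [L L0 fL] := field_lipschitz.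
have fT x : enorm x = rho -> dot (field x) x = 0.
  by move=> /twist_zeta[_]; rewrite /field !dotZl => ->; rewrite !mulr0.
have [Y [K [K0 YK Yf Yt]]] := homogeneous_extension rho0 L0 fL fT.
have [C C0 CP] := field_log_bounded.
(* Chosen for K T <= 1/2 (existence) and C (2 T) <= 1/2 (rotation_along). *)
pose T := (4 * (K + C + 1))^-1.
have KC0 : 0 < K + C + 1 by rewrite ltr_wpDl// addr_ge0.
have T0 : 0 < T by rewrite invr_gt0 mulr_gt0.
have TE : (K + C + 1) * T = 4^-1.
  by rewrite /T; field; rewrite gt_eqF.
have KT : K * T <= 2^-1.
  have : 0 <= (C + 1) * T by rewrite mulr_ge0 ?ltW// ltr_wpDl.
  by move: TE; lra.
have CT : C * (2 * T) <= 2^-1.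
  have : 0 <= (K + 1) * T by rewrite mulr_ge0 ?ltW// ltr_wpDl.
  by move: TE; lra.
have /choice[Phi PhiP] : forall x, exists c : R -> 'rV[R]_n, c 0 = x /\ solves Y T c.
  by move=> x; exact: local_solution K0 T0 YK KT x.
have Phi0 x : Phi x 0 = x by case: (PhiP x).
have sPhi x : solves Y T (Phi x) by case: (PhiP x).
have sphere x t : `|t| < T -> enorm (Phi x t) = enorm x.
  move=> tT; rewrite /enorm -[in RHS](Phi0 x); congr Num.sqrt.
  have tt : - `|t| <= `|t| by have := normr_ge0 t; lra.
  have inT s : - `|t| <= s <= `|t| -> `|s| < T.
    by rewrite -ler_norml => /le_lt_trans; apply.
  apply/eqP; rewrite -subr_eq0 -normr_le0.
  have := @derivable_lipschitz R (fun s => dot (Phi x s) (Phi x s))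
    (fun s => 2 * dot (Y (Phi x s)) (Phi x s)) (- `|t|) `|t| 0.
  move=> /(_ _ _ 0 t) H; apply: le_trans (H _ _ _ _) _; rewrite ?mul0r//.
  - move=> s /inT sT.
    have di i : is_derive s (1 : R) (fun s => Phi x s 0 i * Phi x s 0 i)
        (2 * (Y (Phi x s) 0 i * Phi x s 0 i)).
      have ? := sPhi x s i sT.
      apply: is_derive_eq; rewrite /GRing.scale/=; ring.
    have := is_derive_sum di; rewrite -mulr_sumr; congr is_derive.
    by apply/funext => u; rewrite fct_sumE.
  - by move=> s _; rewrite Yt mulr0 normr0.
  - by rewrite oppr_le0 normr_ge0.
  - by rewrite -ler_norml.
have TT : T / 2 <= T by move: T0; lra.
have KY0 : 0 <= `|Y 0| + K * rho by rewrite addr_ge0// mulr_ge0// ltW.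
(* Half the time, so that t + s stays in the domain for |t|, |s| < T / 2. *)
exists (T / 2), (2 + (`|Y 0| + K * rho)), (fun t x => Phi x t); split.
- by rewrite divr_gt0.
- move=> x t xS tT2.
  have tT : `|t| < T by exact: lt_le_trans TT.
  split; first by rewrite sphere.
  pose c s := Phi x (t + s).
  have sc : solves Y (T / 2) c.
    move=> s i sT; have tsT : `|t + s| < T.
      rewrite (le_lt_trans (ler_normD _ _))//.
      by rewrite (_ : T = T / 2 + T / 2) ?ltrD//; field.
    have dts : is_derive s (1 : R) (fun s => t + s) 1.
      by have := is_deriveD (is_derive_cst t s (1 : R)) (is_derive_id s (1 : R)); rewrite add0r.
    have := @is_derive1_comp R (fun s => Phi x s 0 i) (fun s => t + s) s _ _ (sPhi x (t + s) i tsT) dts.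
    by rewrite mulr1.
  have sP : solves Y (T / 2) (Phi (Phi x t)).
    move=> s i sT; apply: sPhi; exact: lt_le_trans TT.
  have KT2 : K * (T / 2) <= 2^-1.
    by rewrite (le_trans _ KT)// ler_wpM2l.
  have NtT : `|- t| < T / 2 by rewrite normrN.
  have T20 : 0 < T / 2 by rewrite divr_gt0.
  have := solves_dist K0 YK KT2 sP sc NtT.
  rewrite /c Phi0 addr0 !subrr normr0 mulr0 normr_le0 Phi0 subr_eq0.
  by move=> /eqP.
- move=> x y s t xS yS sT2 tT2.
  have sT := lt_le_trans sT2 TT; have tT := lt_le_trans tT2 TT.
  have -> : Phi x s - Phi y t = (Phi x s - Phi y s) + (Phi y s - Phi y t).
    by rewrite subrKA.
  rewrite (le_trans (ler_normD _ _))//.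
  have H1 : `|Phi x s - Phi y s| <= 2 * `|x - y|.
    have := solves_dist K0 YK KT (sPhi x) (sPhi y) sT.
    by rewrite !Phi0.
  have H2 : `|Phi y s - Phi y t| <= (`|Y 0| + K * rho) * `|s - t|.
    apply: norm_le_coord => [|i]; first by rewrite mulr_ge0.
    pose l := Num.max `|s| `|t|.
    have inT u : - l <= u <= l -> `|u| < T.
      by rewrite -ler_norml => /le_lt_trans; apply; rewrite gt_max sT.
    have -> : (Phi y s - Phi y t) 0 i = Phi y s 0 i - Phi y t 0 i by rewrite !mxE.
    apply: (@derivable_lipschitz R (fun u => Phi y u 0 i)
      (fun u => Y (Phi y u) 0 i) (- l) l).
    + by move=> u /inT; exact: sPhi.
    + move=> u /inT uT; rewrite (le_trans (coord_le_norm _ _))//.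
      rewrite -[Y _](subrK (Y 0)) addrC (le_trans (ler_normD _ _))// lerD2l.
      rewrite (le_trans (YK _ _))// subr0 ler_wpM2l//.
      by rewrite (le_trans (norm_le_enorm _))// sphere// yS.
    + by rewrite -ler_norml le_max lexx orbT.
    + by rewrite -ler_norml le_max lexx.
  have H3 : 0 <= (`|Y 0| + K * rho) * `|x - y| + 2 * `|s - t|.
    by rewrite addr_ge0 ?mulr_ge0.
  by rewrite (le_trans (lerD H1 H2))//; move: H3; lra.
- move=> x t xS tT2 nz.
  have tT : `|t| < T by exact: lt_le_trans TT.
  have := rotation_along C0 CT CP Yf (sPhi x).
  move=> /(_ (fun s sT => etrans (sphere x s sT) xS)).
  by rewrite Phi0 => /(_ nz t tT).
Qed.

End RotationFlow.

Section SphereNonzero.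
Variables (R : realType) (n : nat) (a b : 'rV[R]_n -> R).
Variables (da db : 'rV[R]_n -> 'rV[R]_n) (rho : R).
Hypothesis rho0 : 0 < rho.
Hypothesis bdb : gradient_along b db.
Hypothesis transverse : forall x p q lam, enorm x = rho ->
  p ^+ 2 + q ^+ 2 = 1 -> p * b x = q * a x -> p *: db x - q *: da x <> lam *: x.

(** If f vanished on the whole sphere, its imaginary part would have a zero
    derivative along the great circles. *)
Lemma exists_nonzero_on_sphere (x : 'rV[R]_n) : enorm x = rho ->
  exists2 y, enorm y = rho & a y ^+ 2 + b y ^+ 2 != 0.
Proof.
move=> xS; apply: contrapT => noy.
have ab0 y : enorm y = rho -> a y = 0 /\ b y = 0.
  move=> yS; have [/eqP|nz] := eqVneq (a y ^+ 2 + b y ^+ 2) 0.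
    by rewrite paddr_eq0 ?sqr_ge0// !sqrf_eq0 => /andP[/eqP ? /eqP ?].
  by case: noy; exists y.
have [ax bx] := ab0 x xS.
have xx : dot x x = rho ^+ 2 by rewrite -enorm_sqr xS.
have rN0 : rho != 0 by rewrite gt_eqF.
pose ze := rho ^+ 2 *: db x - dot (db x) x *: x.
have ze0 : ze != 0.
  apply/eqP => /eqP; rewrite subr_eq0 => /eqP dbx.
  have := @transverse x 1 0 (dot (db x) x / rho ^+ 2) xS.
  rewrite expr0n/= expr1n addr0 ax bx !mulr0 scale1r scale0r subr0.
  apply=> //; apply: (scalerI (a := rho ^+ 2)); first by rewrite expf_neq0.
  by rewrite dbx scalerA mulrCA divff ?mulr1// expf_neq0.
have zx : dot ze x = 0 by rewrite /ze dotBl !dotZl xx; ring.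
have zz : dot (db x) ze * rho ^+ 2 = dot ze ze.
  by rewrite /ze !(dotBl, dotBr, dotZl, dotZr) xx (dotC x (db x)); ring.
have en : enorm ze != 0 by apply: contra_neq ze0; exact: enorm_eq0.
pose w := (rho / enorm ze) *: ze.
have ww : dot w w = rho ^+ 2.
  by rewrite /w dotZl dotZr -enorm_sqr; field.
have wx : dot w x = 0 by rewrite /w dotZl zx mulr0.
have dw : dot (db x) w * (rho * enorm ze) = dot ze ze.
  by rewrite -zz /w dotZr; field.
clearbody w.
pose c (s : R) := cos s *: x + sin s *: w.
have cS s : enorm (c s) = rho.
  rewrite /enorm (_ : dot (c s) (c s) = rho ^+ 2); last first.
    rewrite /c !(dotDl, dotDr, dotZl, dotZr) ?(dotC x w) wx xx ww.
    by rewrite -[RHS]mul1r -(cos2Dsin2 s); ring.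
  by rewrite sqrtr_sqr ger0_norm// ltW.
have dc i : is_derive (0 : R) (1 : R) (fun s => c s 0 i) (w 0 i).
  have -> : (fun s => c s 0 i) = (fun s => cos s * x 0 i + sin s * w 0 i).
    by apply/funext => s; rewrite !mxE.
  by apply: is_derive_eq; rewrite /GRing.scale/= sin0 cos0; ring.
have := @bdb c 0 w dc.
have -> : (fun s => b (c s)) = cst 0.
  by apply/funext => s; have [] := ab0 (c s) (cS s).
move=> d1; have := derive_val (is_derive := d1).
rewrite derive_cst; have -> : c 0 = x by rewrite /c cos0 sin0 scale1r scale0r addr0.
move=> /esym d0; move: dw; rewrite d0 mul0r => /esym/dot_eq0 zz0.
by rewrite zz0 eqxx in ze0.
Qed.

End SphereNonzero.

(** * Mixed polynomials in real coordinates *)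

Section ComplexParts.
Variable R : realType.
Local Notation C := (complex R).
Implicit Types (x y : C) (k : R).

Lemma ReD x y : Re (x + y) = Re x + Re y. Proof. by case: x y => ? ? []. Qed.
Lemma ImD x y : Im (x + y) = Im x + Im y. Proof. by case: x y => ? ? []. Qed.
Lemma ReN x : Re (- x) = - Re x. Proof. by case: x. Qed.
Lemma ImN x : Im (- x) = - Im x. Proof. by case: x. Qed.
Lemma ReM x y : Re (x * y) = Re x * Re y - Im x * Im y.
Proof. by case: x y => ? ? []. Qed.
Lemma ImM x y : Im (x * y) = Re x * Im y + Im x * Re y.
Proof. by case: x y => ? ? []. Qed.
Lemma ReJ x : Re (Num.conj x) = Re x. Proof. by case: x. Qed.
Lemma ImJ x : Im (Num.conj x) = - Im x. Proof. by case: x. Qed.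

Lemma complex_eqP x y : Re x = Re y -> Im x = Im y -> x = y.
Proof. by case: x y => ? ? [? ?] /= -> ->. Qed.

Lemma conj_real k : Num.conj (k%:C%C) = k%:C%C :> C.
Proof. by apply: complex_eqP => /=; rewrite ?oppr0. Qed.

Definition ReImE := (ReD, ImD, ReN, ImN, ReM, ImM, ReJ, ImJ).

Lemma Re_sum (I : Type) (s : seq I) (F : I -> C) :
  Re (\sum_(i <- s) F i) = \sum_(i <- s) Re (F i).
Proof. by elim/big_rec2 : _ => // i ? ? _ <-; rewrite ReD. Qed.

Lemma Im_sum (I : Type) (s : seq I) (F : I -> C) :
  Im (\sum_(i <- s) F i) = \sum_(i <- s) Im (F i).
Proof. by elim/big_rec2 : _ => // i ? ? _ <-; rewrite ImD. Qed.

Definition complex_derive (h : R -> C) (t : R) (l : C) :=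
  is_derive t (1 : R) (fun s => Re (h s)) (Re l) /\
  is_derive t (1 : R) (fun s => Im (h s)) (Im l).

Lemma complex_deriveD h1 h2 t l1 l2 :
  complex_derive h1 t l1 -> complex_derive h2 t l2 ->
  complex_derive (fun s => h1 s + h2 s) t (l1 + l2).
Proof.
move=> [? ?] [? ?]; rewrite /complex_derive !ReImE.
under eq_fun do rewrite !ReImE.
under [X in _ /\ is_derive _ _ X _]eq_fun do rewrite !ReImE.
by split; apply: is_deriveD.
Qed.

Lemma complex_deriveM h1 h2 t l1 l2 :
  complex_derive h1 t l1 -> complex_derive h2 t l2 ->
  complex_derive (fun s => h1 s * h2 s) t (l1 * h2 t + h1 t * l2).
Proof.
move=> [? ?] [? ?]; rewrite /complex_derive !ReImE.
under eq_fun do rewrite !ReImE.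
under [X in _ /\ is_derive _ _ X _]eq_fun do rewrite !ReImE.
by split; apply: is_derive_eq; rewrite /GRing.scale/=; ring.
Qed.

(** Estimates for values pass through sums and products, but not through single
    monomials; hence an induction along the ring operations. *)
Lemma mpoly_ring_ind (n : nat) (P : mpoly n C -> Prop) :
  (forall c, P (mpolyC n c)) -> (forall i, P (mpolyX C (mnm1 i))) ->
  (forall p q, P p -> P q -> P (p + q)) -> (forall p q, P p -> P q -> P (p * q)) ->
  forall p, P p.
Proof.
move=> PC PX PD PM; have P1 : P 1 by exact: (PC 1).
have PXn m : P (mpolyX C m).
  rewrite mpolyXE_id; elim/big_ind : _ => // i _.
  by elim: (m i) => [|k IH]; rewrite ?expr0// exprS; exact: PM.
apply: mpolyind => [|c m p _ _ Pp]; first by rewrite -(mpolyC0 n); exact: PC.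
by apply: PD => //; rewrite -mul_mpolyC; exact: PM.
Qed.

Lemma meval_derive (n : nat) (w : R -> 'I_n -> C) (dw : 'I_n -> C) t (f : mpoly n C) :
  (forall i, complex_derive (fun s => w s i) t (dw i)) ->
  complex_derive (fun s => meval (w s) f) t (\sum_i meval (w t) (mderiv i f) * dw i).
Proof.
move=> wd; elim/mpoly_ring_ind : f => [c|j|p q pd qd|p q pd qd].
- rewrite big1 => [|i _]; last by rewrite mderivC meval0 mul0r.
  under eq_fun do rewrite mevalC.
  by split; exact: is_derive_cst.
- rewrite (bigD1 j)//= big1 ?addr0 => [|i ij].
    rewrite mderivX mnm1E eqxx scale1r (_ : mnm_sub _ _ = mnm0) ?mevalX; last first.
      by apply/mnmP => k; rewrite mnmBE mnm0E subnn.
    rewrite big1 ?mul1r => [|k _]; last by rewrite mnm0E.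
    by under eq_fun do rewrite mevalXU; exact: wd.
  by rewrite mderivX mnm1E eq_sym (negPf ij) scale0r meval0 mul0r.
- under eq_fun do rewrite mevalD.
  rewrite (eq_bigr (fun i => meval (w t) (mderiv i p) * dw i + meval (w t) (mderiv i q) * dw i)) => [|i _]; last first.
    by rewrite mderivD mevalD mulrDl.
  by rewrite big_split; exact: complex_deriveD.
- under eq_fun do rewrite mevalM.
  rewrite (eq_bigr (fun i => meval (w t) (mderiv i p) * dw i * meval (w t) q +
     meval (w t) p * (meval (w t) (mderiv i q) * dw i))) => [|i _]; last first.
    by rewrite mderivM mevalD !mevalM; ring.
  by rewrite big_split -mulr_suml -mulr_sumr; exact: complex_deriveM.
Qed.

Lemma meval_loc_lipschitz (n m : nat) (w : 'rV[R]_m -> 'I_n -> C) (f : mpoly n C) :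
  (forall i, loc_lipschitz (fun z => Re (w z i)) /\ loc_lipschitz (fun z => Im (w z i))) ->
  loc_lipschitz (fun z => Re (meval (w z) f)) /\
  loc_lipschitz (fun z => Im (meval (w z) f)).
Proof.
move=> wl; elim/mpoly_ring_ind : f => [c|j|p q [p1 p2] [q1 q2]|p q [p1 p2] [q1 q2]].
- split; under eq_fun do rewrite mevalC; exact: loc_lipschitz_cst.
- by split; under eq_fun do rewrite mevalXU; case: (wl j).
- by split; under eq_fun do rewrite mevalD ReImE; exact: loc_lipschitzD.
- split; under eq_fun do rewrite mevalM ReImE.
    by apply: loc_lipschitzB; exact: loc_lipschitzM.
  by apply: loc_lipschitzD; exact: loc_lipschitzM.
Qed.

End ComplexParts.

Section RealCoordinates.
Variable R : realType.
Local Notation C := (complex R).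
Implicit Types (f : mixed_poly R) (z w : CC R * CC R) (x v : 'rV[R]_4).

(** The coordinates are indexed by booleans, false for u and true for v; var and
    cvar are the indices of a coordinate and of its conjugate. *)
Definition var (c : bool) : 'I_4 := if c then idx_v else idx_u.
Definition cvar (c : bool) : 'I_4 := if c then idx_vb else idx_ub.
Definition axis z (c : bool) : C := if c then z.2 else z.1.

Definition point z : 'I_4 -> C :=
  tnth [tuple (z.1 : C); (z.2 : C); Num.conj (z.1 : C); Num.conj (z.2 : C)].

Lemma point_var z c : point z (var c) = axis z c.
Proof. by case: c. Qed.

Lemma point_cvar z c : point z (cvar c) = Num.conj (axis z c).
Proof. by case: c. Qed.

(** The value of f in R[i], rather than in its topological copy. *)
Definition ev f z : C := meval (point z) f.

Lemma mixed_evalE f z : mixed_eval f z = ev f z. Proof. by []. Qed.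

Lemma big_var (V : nmodType) (F : 'I_4 -> V) :
  \sum_i F i = F (var false) + F (cvar false) + (F (var true) + F (cvar true)).
Proof.
rewrite !big_ord_recl big_ord0 addr0 !addrA /=.
congr (_ + _); last by congr F; exact/val_inj.
by rewrite [RHS]addrAC; congr (_ + _ + _); congr F; exact/val_inj.
Qed.

Lemma forall_var (P : 'I_4 -> Prop) : (forall c, P (var c) /\ P (cvar c)) ->
  forall i, P i.
Proof.
move=> Pc i; have [[P0 P2] [P1 P3]] := (Pc false, Pc true).
case: i => -[|[|[|[|//]]]] i4.
- by rewrite (_ : Ordinal _ = var false)//; exact/val_inj.
- by rewrite (_ : Ordinal _ = var true)//; exact/val_inj.
- by rewrite (_ : Ordinal _ = cvar false)//; exact/val_inj.
- by rewrite (_ : Ordinal _ = cvar true)//; exact/val_inj.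
Qed.

Definition toC x : CC R * CC R :=
  (Complex (x 0 0) (x 0 1), Complex (x 0 (inord 2)) (x 0 (inord 3))).

Definition ofC z : 'rV[R]_4 :=
  \row_i tnth [tuple Re z.1; Im z.1; Re z.2; Im z.2] i.

Lemma ofCE z : [/\ ofC z 0 0 = Re z.1, ofC z 0 1 = Im z.1,
  ofC z 0 (inord 2) = Re z.2 & ofC z 0 (inord 3) = Im z.2].
Proof. by split; rewrite mxE /tnth/= ?inordK. Qed.

Lemma ofCK : cancel ofC toC.
Proof.
move=> z; rewrite /toC; have [-> -> -> ->] := ofCE z.
by case: z => -[? ?] [? ?].
Qed.

Lemma sum4 (V : nmodType) (F : 'I_4 -> V) :
  \sum_i F i = F 0 + F 1 + (F (inord 2) + F (inord 3)).
Proof.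
rewrite !big_ord_recl big_ord0 addr0 !addrA /=.
by congr (_ + _ + _ + _); congr F; apply/val_inj; rewrite /= ?inordK.
Qed.

Lemma toCK : cancel toC ofC.
Proof.
move=> x; apply/rowP => i; have [e0 e1 e2 e3] := ofCE (toC x).
have : i = 0 \/ i = 1 \/ i = inord 2 \/ i = inord 3.
  case: i => -[|[|[|[|//]]]] i4; [left|right; left|right; right; left|
    by right; right; right; apply/val_inj; rewrite /= inordK];
    by apply/val_inj; rewrite /= ?inordK.
by move=> [->|[->|[->|->]]].
Qed.

Lemma norm_toC x :
  `|(toC x).1| ^+ 2 + `|(toC x).2| ^+ 2 = (real_complex R (enorm x)) ^+ 2 :> C.
Proof.
have -> : (real_complex R (enorm x)) ^+ 2 = real_complex R (enorm x ^+ 2).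
  by rewrite rmorphXn.
rewrite enorm_sqr /dot sum4 /= -!add_Re2_Im2 -rmorphD/=.
by rewrite -!expr2.
Qed.

Lemma axis_toC_coord x c : loc_lipschitz (fun x => Re (axis (toC x) c)) /\
  loc_lipschitz (fun x => Im (axis (toC x) c)).
Proof. by case: c; split => /=; exact: loc_lipschitz_coord. Qed.

Lemma point_linear v i :
  point (toC v) i = \sum_j (v 0 j)%:C%C * point (toC (delta_mx 0 j)) i.
Proof.
rewrite sum4; elim/forall_var: i => c.
have n2 : (inord 2 : 'I_4) = 2 :> nat by rewrite inordK.
have n3 : (inord 3 : 'I_4) = 3 :> nat by rewrite inordK.
have ee (j k : 'I_4) : (delta_mx 0 j : 'rV[R]_4) 0 k = (k == j :> nat)%:R.
  by rewrite mxE eqxx.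
rewrite !point_var !point_cvar; split; apply: complex_eqP;
  case: c; rewrite !ReImE /= !ee /= ?n2 ?n3 /=; ring.
Qed.

(** The real differential of f at z in the direction w. *)
Definition wirtinger_diff f z w : C := \sum_i meval (point z) (mderiv i f) * point w i.

Lemma wirtinger_diffE f z w : wirtinger_diff f z w =
  ev (mderiv (var false) f) z * axis w false +
  ev (mderiv (cvar false) f) z * Num.conj (axis w false) +
  (ev (mderiv (var true) f) z * axis w true +
   ev (mderiv (cvar true) f) z * Num.conj (axis w true)).
Proof. by rewrite /wirtinger_diff big_var !point_var !point_cvar. Qed.

(** The gradient of Re f or of Im f, according to part. *)
Definition part_grad (part : C -> R) f x : 'rV[R]_4 :=
  \row_j part (wirtinger_diff f (toC x) (toC (delta_mx 0 j))).

Lemma wirtinger_diff_linear f z v :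
  wirtinger_diff f z (toC v) = \sum_j (v 0 j)%:C%C * wirtinger_diff f z (toC (delta_mx 0 j)).
Proof.
rewrite /wirtinger_diff; under eq_bigr do rewrite point_linear mulr_sumr.
rewrite exchange_big/=; apply: eq_bigr => j _; rewrite mulr_sumr.
by apply: eq_bigr => i _; ring.
Qed.

Lemma dot_Re_grad f x v : dot (part_grad (@Re R) f x) v = Re (wirtinger_diff f (toC x) (toC v)).
Proof.
rewrite wirtinger_diff_linear Re_sum; apply: eq_bigr => j _.
by rewrite mxE !ReImE/=; ring.
Qed.

Lemma dot_Im_grad f x v : dot (part_grad (@Im R) f x) v = Im (wirtinger_diff f (toC x) (toC v)).
Proof.
rewrite wirtinger_diff_linear Im_sum; apply: eq_bigr => j _.
by rewrite mxE !ReImE/=; ring.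
Qed.

Lemma point_loc_lipschitz i : loc_lipschitz (fun x => Re (point (toC x) i)) /\
  loc_lipschitz (fun x => Im (point (toC x) i)).
Proof.
elim/forall_var: i => c; have [cr ci] := axis_toC_coord 0 c.
split; split.
- by move: cr; congr loc_lipschitz; apply/funext => x; rewrite point_var.
- by move: ci; congr loc_lipschitz; apply/funext => x; rewrite point_var.
- by move: cr; congr loc_lipschitz; apply/funext => x; rewrite point_cvar ReJ.
- have := loc_lipschitzN ci; congr loc_lipschitz; apply/funext => x.
  by rewrite point_cvar ImJ.
Qed.

Lemma ev_loc_lipschitz f :
  loc_lipschitz (fun x => Re (ev f (toC x))) /\
  loc_lipschitz (fun x => Im (ev f (toC x))).
Proof. exact: meval_loc_lipschitz point_loc_lipschitz. Qed.

Lemma part_grad_loc_lipschitz f j :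
  loc_lipschitz (fun x => part_grad (@Re R) f x 0 j) /\
  loc_lipschitz (fun x => part_grad (@Im R) f x 0 j).
Proof.
split; under eq_fun do rewrite mxE ?Re_sum ?Im_sum; apply: loc_lipschitz_sum => i;
  have [dr di] := meval_loc_lipschitz (mderiv i f) point_loc_lipschitz;
  under eq_fun do rewrite ReImE.
  by apply: loc_lipschitzB; apply: loc_lipschitzM => //; exact: loc_lipschitz_cst.
by apply: loc_lipschitzD; apply: loc_lipschitzM => //; exact: loc_lipschitz_cst.
Qed.

Lemma Re_gradient_along f :
  gradient_along (fun x => Re (ev f (toC x))) (part_grad (@Re R) f) /\
  gradient_along (fun x => Im (ev f (toC x))) (part_grad (@Im R) f).
Proof.
have H (c : R -> 'rV[R]_4) (t : R) v :
    (forall i, is_derive t (1 : R) (fun s => c s 0 i) (v 0 i)) ->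
    complex_derive (fun s => ev f (toC (c s))) t (wirtinger_diff f (toC (c t)) (toC v)).
  move=> cd; apply: meval_derive; apply: forall_var => b; rewrite !point_var !point_cvar.
  have ax : complex_derive (fun s => axis (toC (c s)) b) t (axis (toC v) b).
    by case: b; split; exact: cd.
  have -> : (fun s => point (toC (c s)) (var b)) = (fun s => axis (toC (c s)) b).
    by apply/funext => s; rewrite point_var.
  have -> : (fun s => point (toC (c s)) (cvar b)) = (fun s => Num.conj (axis (toC (c s)) b)).
    by apply/funext => s; rewrite point_cvar.
  split => //; case: ax => a1 a2; rewrite /complex_derive !ReImE.
  under eq_fun do rewrite ReJ.
  under [X in _ /\ is_derive _ _ X _]eq_fun do rewrite ImJ.
  by split => //; exact: is_deriveN.
by split => c t v /H[? ?]; rewrite ?dot_Re_grad ?dot_Im_grad.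
Qed.

(** The point z lies on the hypersurface Im (conj om * f) = 0, and the gradient of
    this function at z, expressed by Wirtinger derivatives, is lam * z: the
    hypersurface is singular at z or tangent to the sphere through z. *)
Definition tangent_at f (om : C) (lam : R) z :=
  [/\ `|om| = 1, Im (Num.conj om * ev f z) = 0 &
    forall c, Num.conj om * ev (mderiv (cvar c) f) z
      - om * Num.conj (ev (mderiv (var c) f) z : C) = 'i%C * lam%:C%C * axis z c].

Lemma transverse_of_tangent f rho x p q lam :
    (forall om z, `|z.1| ^+ 2 + `|z.2| ^+ 2 = (real_complex R rho) ^+ 2 :> C ->
      ~ tangent_at f om lam z) ->
    enorm x = rho -> p ^+ 2 + q ^+ 2 = 1 ->
    p * Im (ev f (toC x)) = q * Re (ev f (toC x)) ->
  p *: part_grad (@Im R) f x - q *: part_grad (@Re R) f x <> lam *: x.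
Proof.
move=> nt xS pq pbqa gx; apply: (nt (Complex p q) (toC x)).
  by rewrite norm_toC xS.
split; first by rewrite normc_def /= pq sqrtr1.
  by rewrite !ReImE /= -/(ev f (toC x)) pbqa; ring.
have H v : Im (Num.conj (Complex p q) * wirtinger_diff f (toC x) (toC v)) = lam * dot x v.
  rewrite -dotZl -gx dotBl !dotZl dot_Im_grad dot_Re_grad !ReImE /=; ring.
pose G b : C := ev (mderiv (cvar b) f) (toC x).
pose F b : C := ev (mderiv (var b) f) (toC x).
have D w : wirtinger_diff f (toC x) w = F false * axis w false + G false * Num.conj (axis w false)
   + (F true * axis w true + G true * Num.conj (axis w true)).
  exact: wirtinger_diffE.
move=> c; rewrite -/(G c) -/(F c); clearbody F G.
pose unit_axis (w0 : C) : CC R * CC R := if c then (0, w0) else (w0, 0).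
have Du (w0 : C) : wirtinger_diff f (toC x) (unit_axis w0) = F c * w0 + G c * Num.conj w0.
  rewrite D /unit_axis; case: c {unit_axis}; rewrite /axis/= rmorph0 !mulr0.
    by rewrite !addr0 add0r.
  by rewrite !addr0.
have E (w0 : C) : Im (Num.conj (Complex p q) * (F c * w0 + G c * Num.conj w0)) =
    lam * (Re (axis (toC x) c) * Re w0 + Im (axis (toC x) c) * Im w0).
  rewrite -Du -(ofCK (unit_axis w0)) H; congr (_ * _); rewrite /dot sum4.
  have [-> -> -> ->] := ofCE (unit_axis w0).
  by rewrite /unit_axis; case: c {Du unit_axis}; rewrite /axis /= !mulr0 ?addr0 ?add0r.
have := E 1; have := E 'i%C; move: (F c) (G c) (axis _ c) => B A y.
rewrite !ReImE /=.
rewrite !(mulr0, mulr1, mul0r, addr0, add0r, subr0, sub0r, opprK, mulN1r, mulrN).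
move=> E1 E2; apply: complex_eqP; rewrite !ReImE /=; lra.
Qed.

End RealCoordinates.

(** * Limits of complex functions along filters *)

Section ComplexLimits.
Variable R : realType.
Local Notation C := (complex R).
Implicit Types x y : C.

(** The norm of R[i] has values in R[i]; the modulus is the same number in R. *)
Definition modulus x : R := Normc.normc x.

Lemma modulusE x : modulus x = Num.sqrt (Re x ^+ 2 + Im x ^+ 2).
Proof. by case: x. Qed.

Lemma norm_modulus x : `|x| = (modulus x)%:C%C.
Proof. by rewrite normc_def modulusE. Qed.

Lemma modulus_ge0 x : 0 <= modulus x.
Proof. by rewrite modulusE sqrtr_ge0. Qed.

Lemma modulusM x y : modulus (x * y) = modulus x * modulus y.
Proof. exact: Normc.normcM. Qed.

Lemma modulus0 : modulus 0 = 0. Proof. exact: Normc.normc0. Qed.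
Lemma modulus1 : modulus 1 = 1. Proof. exact: Normc.normc1. Qed.

Lemma modulus_i : modulus 'i%C = 1.
Proof. by rewrite modulusE /= expr0n/= add0r expr1n sqrtr1. Qed.

Lemma modulusX x k : modulus (x ^+ k) = modulus x ^+ k.
Proof. by elim: k => [|k IH]; rewrite ?expr0 ?modulus1// !exprS modulusM IH. Qed.

Lemma modulusJ x : modulus (Num.conj x) = modulus x.
Proof. by rewrite !modulusE ReJ ImJ sqrrN. Qed.

Lemma modulus_eq0 x : (modulus x == 0) = (x == 0).
Proof.
by apply/eqP/eqP => [/Normc.eq0_normc|->] //; exact: modulus0.
Qed.

Lemma modulus_gt0 x : (0 < modulus x) = (x != 0).
Proof. by rewrite lt_def modulus_eq0 modulus_ge0 andbT. Qed.

Lemma modulusD x y : modulus (x + y) <= modulus x + modulus y.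
Proof. by rewrite -lecR rmorphD/= -!norm_modulus ler_normD. Qed.

Lemma modulus_sum (I : Type) (s : seq I) (F : I -> C) :
  modulus (\sum_(i <- s) F i) <= \sum_(i <- s) modulus (F i).
Proof.
elim/big_rec2 : _ => [|i a b _ ab]; first by rewrite modulus0.
by rewrite (le_trans (modulusD _ _))// lerD2l.
Qed.

Lemma modulus_real (k : R) : modulus k%:C%C = `|k|.
Proof. by rewrite modulusE /= expr0n/= addr0 sqrtr_sqr. Qed.

Lemma modulus_nat k : modulus k%:R = k%:R.
Proof.
have -> : k%:R = (k%:R : R)%:C%C :> C by rewrite rmorph_nat.
by rewrite modulus_real ger0_norm.
Qed.

Lemma modulus_sqr x : modulus x ^+ 2 = Re x ^+ 2 + Im x ^+ 2.
Proof. by rewrite modulusE sqr_sqrtr// addr_ge0 ?sqr_ge0. Qed.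

Lemma norm_Re_le x : `|Re x| <= modulus x.
Proof. by rewrite -sqrtr_sqr modulusE ler_wsqrtr// lerDl sqr_ge0. Qed.

Lemma norm_Im_le x : `|Im x| <= modulus x.
Proof. by rewrite -sqrtr_sqr modulusE ler_wsqrtr// lerDr sqr_ge0. Qed.

Lemma modulus_le_ReIm x : modulus x <= `|Re x| + `|Im x|.
Proof.
have {1}-> : x = (Re x)%:C%C + 'i%C * (Im x)%:C%C.
  by apply: complex_eqP; rewrite !ReImE /=; ring.
rewrite (le_trans (modulusD _ _))// modulusM !modulus_real.
by rewrite modulusE /= expr0n/= add0r expr1n sqrtr1 mul1r.
Qed.

Lemma mul_conj_modulus x : x * Num.conj x = (modulus x ^+ 2)%:C%C.
Proof. by apply: complex_eqP; rewrite modulus_sqr !ReImE /=; ring. Qed.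

Variables (I : Type) (F : set_system I).

Definition tends (h : I -> C) (l : C) :=
  ((fun i => Re (h i)) @ F --> Re l) /\ ((fun i => Im (h i)) @ F --> Im l).

Section Filter.
Context {FF : Filter F}.

Lemma tends_cst l : tends (fun=> l) l.
Proof. by split; exact: cvg_cst. Qed.

Lemma tendsD h1 h2 l1 l2 : tends h1 l1 -> tends h2 l2 ->
  tends (fun i => h1 i + h2 i) (l1 + l2).
Proof.
move=> [? ?] [? ?]; rewrite /tends !ReImE.
under eq_fun do rewrite ReD.
under [X in _ /\ X @ _ --> _]eq_fun do rewrite ImD.
by split; exact: cvgD.
Qed.

Lemma tendsN h l : tends h l -> tends (fun i => - h i) (- l).
Proof.
move=> [? ?]; rewrite /tends !ReImE.
under eq_fun do rewrite ReN.
under [X in _ /\ X @ _ --> _]eq_fun do rewrite ImN.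
by split; exact: cvgN.
Qed.

Lemma tendsB h1 h2 l1 l2 : tends h1 l1 -> tends h2 l2 ->
  tends (fun i => h1 i - h2 i) (l1 - l2).
Proof. by move=> h1l h2l; apply: tendsD => //; exact: tendsN. Qed.

Lemma tendsM h1 h2 l1 l2 : tends h1 l1 -> tends h2 l2 ->
  tends (fun i => h1 i * h2 i) (l1 * l2).
Proof.
move=> [? ?] [? ?]; rewrite /tends !ReImE.
under eq_fun do rewrite ReM.
under [X in _ /\ X @ _ --> _]eq_fun do rewrite ImM.
split; first by apply: cvgB; exact: cvgM.
by apply: cvgD; exact: cvgM.
Qed.

Lemma tendsJ h l : tends h l -> tends (fun i => Num.conj (h i)) (Num.conj l).
Proof.
move=> [? ?]; rewrite /tends !ReImE.
under eq_fun do rewrite ReJ.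
under [X in _ /\ X @ _ --> _]eq_fun do rewrite ImJ.
by split => //; exact: cvgN.
Qed.

Lemma tends_real (h : I -> R) (l : R) : h @ F --> l ->
  tends (fun i => (h i)%:C%C) l%:C%C.
Proof. by move=> hl; split => //=; exact: cvg_cst. Qed.

Lemma tends_sum (J : Type) (s : seq J) (P : pred J) (h : J -> I -> C) (l : J -> C) :
  (forall j, P j -> tends (h j) (l j)) ->
  tends (fun i => \sum_(j <- s | P j) h j i) (\sum_(j <- s | P j) l j).
Proof.
move=> hl; elim: s => [|j s IH].
  by under eq_fun do rewrite big_nil; rewrite big_nil; exact: tends_cst.
under eq_fun do rewrite big_cons; rewrite big_cons.
by case: ifP => Pj //; apply: tendsD => //; exact: hl.
Qed.

Lemma cvg_sum_seq (J : eqType) (s : seq J) (h : J -> I -> R) (l : J -> R) :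
  (forall j, j \in s -> h j @ F --> l j) ->
  (fun i => \sum_(j <- s) h j i) @ F --> \sum_(j <- s) l j.
Proof.
elim: s => [|j s IH] hl.
  by under eq_fun do rewrite big_nil; rewrite big_nil; exact: cvg_cst.
under eq_fun do rewrite big_cons; rewrite big_cons.
apply: cvgD; first by apply: hl; rewrite mem_head.
by apply: IH => k ks; apply: hl; rewrite in_cons ks orbT.
Qed.

Lemma tends_modulus h l : tends h l -> (fun i => modulus (h i)) @ F --> modulus l.
Proof.
move=> [h1 h2]; rewrite modulusE; under eq_fun do rewrite modulusE.
apply: (cvg_comp _ Num.sqrt); last exact: sqrt_continuous.
apply: cvgD; under eq_fun do rewrite expr2; rewrite expr2; exact: cvgM.
Qed.

Lemma tends0_modulus h : (fun i => modulus (h i)) @ F --> (0 : R) -> tends h 0.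
Proof.
move=> h0; have N0 : (fun i => - modulus (h i)) @ F --> (0 : R).
  by rewrite -oppr0; exact: cvgN.
split => /=; apply: (@squeeze_cvgr _ _ _ _ (fun i => - modulus (h i))
    (fun i => modulus (h i))) => //; near=> i; rewrite -ler_norml.
  exact: norm_Re_le.
exact: norm_Im_le.
Unshelve. all: by end_near. Qed.

Lemma tends_meval (n : nat) (w : I -> 'I_n -> C) (l : 'I_n -> C) (f : mpoly n C) :
  (forall k, tends (fun i => w i k) (l k)) ->
  tends (fun i => meval (w i) f) (meval l f).
Proof.
move=> wl; elim/mpoly_ring_ind : f => [c|j|p q pl ql|p q pl ql].
- by under eq_fun do rewrite mevalC; rewrite mevalC; exact: tends_cst.
- by under eq_fun do rewrite mevalXU; rewrite mevalXU; exact: wl.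
- by under eq_fun do rewrite mevalD; rewrite mevalD; exact: tendsD.
- by under eq_fun do rewrite mevalM; rewrite mevalM; exact: tendsM.
Qed.

End Filter.

Lemma tends_unique {FF : ProperFilter F} h l1 l2 : tends h l1 -> tends h l2 -> l1 = l2.
Proof.
move=> [r1 i1] [r2 i2].
by apply: complex_eqP; [apply: cvg_unique r1 r2|apply: cvg_unique i1 i2];
  exact: Rhausdorff.
Qed.

Lemma near_eq_tends {FF : Filter F} h1 h2 l : (\forall i \near F, h1 i = h2 i) ->
  tends h1 l -> tends h2 l.
Proof.
move=> e [r i]; split; [move: r|move: i]; apply: cvg_trans; apply: near_eq_cvg;
  by apply: filterS e => j ->.
Qed.

(** Compactness in the form used below: working along an ultrafilter replaces
    the extraction of subsequences. *)
Lemma ultra_bounded_cvg {UF : UltraFilter F} (h : I -> R) (M : R) :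
  (\forall i \near F, `|h i| <= M) -> exists l : R, h @ F --> l.
Proof.
move=> hM.
have hFM : (h @ F) `[- M, M]%classic.
  by apply: filterS hM => i /=; rewrite in_itv/= ler_norml.
have [l [_ hl]] := @segment_compact R (- M) M (h @ F) _ hFM.
exists l => U Ul; have [//|FnU] := in_ultra_setVsetC (h @^-1` U) UF.
by have [y [/= nUy Uy]] := hl (~` U) U FnU Ul.
Qed.

Lemma ultra_bounded_tends {UF : UltraFilter F} (h : I -> C) (M : R) :
  (\forall i \near F, modulus (h i) <= M) -> exists l, tends h l.
Proof.
move=> hM.
have [|a ha] := @ultra_bounded_cvg _ (fun i => Re (h i)) M.
  by apply: filterS hM => i; apply: le_trans; exact: norm_Re_le.
have [|b hb] := @ultra_bounded_cvg _ (fun i => Im (h i)) M.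
  by apply: filterS hM => i; apply: le_trans; exact: norm_Im_le.
by exists (Complex a b).
Qed.

End ComplexLimits.

(** * Rescaling mixed polynomials *)

Section Scaling.
Variable R : realType.
Local Notation C := (complex R).
Implicit Types (f g : mixed_poly R) (m : multinom 4) (z : CC R * CC R).
Implicit Types (o : option 'I_4) (c : bool).

Lemma real_complexM (a b : R) : (a * b)%:C%C = a%:C%C * b%:C%C.
Proof. by rewrite rmorphM. Qed.

Lemma eq_or_negb (b c : bool) : b = c \/ b = ~~ c.
Proof. by case: b c => [] []; [left|right|right|left]. Qed.

(** The exponent of |u| (c = false) or of |v| (c = true) in a monomial. *)
Definition expo c m := (m (var c) + m (cvar c))%N.

(** The modulus of a monomial at a point whose coordinates have modulus x. *)
Definition wgt (x : bool -> R) m : R :=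
  x false ^+ expo false m * x true ^+ expo true m.

Definition deriv_opt o f : mixed_poly R := if o is Some i then mderiv i f else f.

Definition axis_of (i : 'I_4) : bool := (i == idx_v) || (i == idx_vb).

Lemma axis_of_var c : axis_of (var c) = c. Proof. by case: c. Qed.
Lemma axis_of_cvar c : axis_of (cvar c) = c. Proof. by case: c. Qed.

(** The factor that compensates a derivative under the scaling by x. *)
Definition scale_opt (x : bool -> R) o : R := if o is Some i then x (axis_of i) else 1.

Lemma deriv_opt_linear o f :
  deriv_opt o f = \sum_(m <- msupp f) mcoeff m f *: deriv_opt o (mpolyX C m).
Proof.
case: o => [i|] /=; last exact: mpolyE.
by rewrite {1}[f]mpolyE raddf_sum; apply: eq_bigr => m _; exact: mderivZ.
Qed.

Lemma evZ (k : C) f z : ev (k *: f) z = k * ev f z.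
Proof. exact: mevalZ. Qed.

Lemma ev_sum o f z : ev (deriv_opt o f) z =
  \sum_(m <- msupp f) mcoeff m f * ev (deriv_opt o (mpolyX C m)) z.
Proof.
rewrite {1}deriv_opt_linear /ev raddf_sum; apply: eq_bigr => m _.
exact: mevalZ.
Qed.

Lemma prod_var (G : 'I_4 -> C) :
  \prod_i G i = G (var false) * G (cvar false) * (G (var true) * G (cvar true)).
Proof.
rewrite !big_ord_recl big_ord0 mulr1 !mulrA /=.
congr (_ * _); last by congr G; exact/val_inj.
by rewrite [RHS]mulrAC; congr (_ * _ * _); congr G; exact/val_inj.
Qed.

Lemma ev_mono z m : ev (mpolyX C m) z =
  axis z false ^+ m (var false) * Num.conj (axis z false) ^+ m (cvar false) *
  (axis z true ^+ m (var true) * Num.conj (axis z true) ^+ m (cvar true)).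
Proof.
by rewrite /ev mevalX prod_var !point_var !point_cvar.
Qed.

Lemma modulus_mono z m :
  modulus (ev (mpolyX C m) z) = wgt (fun c => modulus (axis z c)) m.
Proof.
rewrite ev_mono !(modulusM, modulusX, modulusJ) /wgt /expo !exprD.
by rewrite !mulrA.
Qed.

Lemma wgt_split x c m : wgt x m = x c ^+ expo c m * x (~~ c) ^+ expo (~~ c) m.
Proof. by rewrite /wgt; case: c => //=; rewrite mulrC. Qed.

Section Point.
Variables (x : bool -> R) (z al : CC R * CC R).
Hypothesis zal : forall c, axis z c = (x c)%:C%C * axis al c.

Lemma mono_scale m :
  ev (mpolyX C m) z = (wgt x m)%:C%C * ev (mpolyX C m) al.
Proof.
rewrite !ev_mono !zal !(rmorphM, rmorphXn) /wgt /expo !exprD /=.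
by rewrite !conj_real !exprMn; ring.
Qed.

Lemma deriv_mono_scale o m :
  (scale_opt x o)%:C%C * ev (deriv_opt o (mpolyX C m)) z =
  (wgt x m)%:C%C * ev (deriv_opt o (mpolyX C m)) al.
Proof.
case: o => [i|] /=; last by rewrite mul1r mono_scale.
rewrite mderivX !evZ mono_scale.
have [mi0|mi] := posnP (m i); first by rewrite mi0 !mul0r !mulr0.
suff -> : wgt x m = x (axis_of i) * wgt x (mnm_sub m (mnm1 i)).
  by rewrite (real_complexM (x _)) -mulrA; congr (_ * _); exact: mulrCA.
set c := axis_of i.
have e1 : expo c m = (expo c (mnm_sub m (mnm1 i))).+1.
  rewrite /expo !mnmBE !mnm1E; move: mi; rewrite /c {c}.
  elim/forall_var: i => c; rewrite axis_of_var axis_of_cvar; split => mi.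
    rewrite eqxx (_ : (var c == cvar c) = false) ?subn0; last by case: c {mi}.
    by rewrite -addSn subn1 prednK.
  rewrite eqxx (_ : (cvar c == var c) = false) ?subn0; last by case: c {mi}.
  by rewrite -addnS subn1 prednK.
have e2 : expo (~~ c) m = expo (~~ c) (mnm_sub m (mnm1 i)).
  rewrite /expo !mnmBE !mnm1E /c {c mi e1}.
  elim/forall_var: i => c; rewrite axis_of_var axis_of_cvar.
  by split; case: c; rewrite !subn0.
by rewrite !(wgt_split _ c) e1 e2 exprS mulrA.
Qed.

End Point.

(** f_Delta, when D selects the monomials on Delta. *)
Definition select (D : pred (multinom 4)) f : mixed_poly R :=
  \sum_(m <- msupp f | D m) monomial_of f m.

Lemma ev_select (D : pred (multinom 4)) o f z : ev (deriv_opt o (select D f)) z =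
  \sum_(m <- msupp f) ((D m)%:R * mcoeff m f) * ev (deriv_opt o (mpolyX C m)) z.
Proof.
have -> : deriv_opt o (select D f) =
    \sum_(m <- msupp f | D m) mcoeff m f *: deriv_opt o (mpolyX C m).
  case: o => [i|] //=; rewrite raddf_sum; apply: eq_bigr => m _.
  exact: mderivZ.
rewrite /ev raddf_sum/= big_mkcond; apply: eq_bigr => m _.
by case: (D m); rewrite ?mul1r ?mul0r//; exact: mevalZ.
Qed.

Lemma euler_mono c m z :
  axis z c * ev (mderiv (var c) (mpolyX C m)) z +
  Num.conj (axis z c) * ev (mderiv (cvar c) (mpolyX C m)) z =
  (expo c m)%:R * ev (mpolyX C m) z.
Proof.
have H i : point z i * ev (mderiv i (mpolyX C m)) z = (m i)%:R * ev (mpolyX C m) z.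
  rewrite mderivX evZ.
  have [->|mi] := posnP (m i); first by rewrite !mul0r mulr0.
  rewrite mulrCA; congr (_ * _).
  rewrite -[X in X * _](mevalXU (point z) i) -mevalM -mpolyXD; congr (meval _ (mpolyX _ _)).
  apply/mnmP => k; rewrite mnmDE mnmBE mnm1E.
  by case: eqP => [<-|_]; rewrite ?subn0 ?add0n// add1n subn1 prednK.
by rewrite -point_cvar -point_var !H -mulrDl -natrD.
Qed.

Lemma euler_select c (D : pred (multinom 4)) f z :
  axis z c * ev (mderiv (var c) (select D f)) z +
  Num.conj (axis z c) * ev (mderiv (cvar c) (select D f)) z =
  \sum_(m <- msupp f) (expo c m)%:R * ((D m)%:R * mcoeff m f) * ev (mpolyX C m) z.
Proof.
have := ev_select D (Some (var c)) f z; have := ev_select D (Some (cvar c)) f z.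
rewrite /deriv_opt => -> ->; rewrite !mulr_sumr -big_split; apply: eq_bigr => m _ /=.
rewrite -[RHS]mulrA [RHS]mulrCA -euler_mono mulrDr; congr (_ + _); exact: mulrCA.
Qed.

Lemma euler c f z :
  axis z c * ev (mderiv (var c) f) z +
  Num.conj (axis z c) * ev (mderiv (cvar c) f) z =
  \sum_(m <- msupp f) (expo c m)%:R * mcoeff m f * ev (mpolyX C m) z.
Proof.
have {1 2}-> : f = select predT f by rewrite {1}[f]mpolyE.
by rewrite euler_select; apply: eq_bigr => m _; rewrite mul1r.
Qed.

Lemma tends_axis (I : Type) (F : set_system I) {FF : Filter F}
    (al : I -> CC R * CC R) (al0 : CC R * CC R) g :
  (forall c, tends F (fun i => axis (al i) c) (axis al0 c)) ->
  tends F (fun i => ev g (al i)) (ev g al0).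
Proof.
move=> all; apply: tends_meval; apply: forall_var => c.
have -> : (fun i => point (al i) (var c)) = (fun i => axis (al i) c).
  by apply/funext => i; rewrite point_var.
have -> : (fun i => point (al i) (cvar c)) = (fun i => Num.conj (axis (al i) c)).
  by apply/funext => i; rewrite point_cvar.
rewrite point_var point_cvar; split; first exact: all.
exact: tendsJ.
Qed.

(** Under the scaling by x a monomial is multiplied by its weight, and a
    derivative of it by the weight divided by one scale. So if the weights divided
    by sg tend to the indicator of D, only the terms of f_D survive. *)
Lemma scaled_tends (I : Type) (F : set_system I) {FF : Filter F}
    (D : pred (multinom 4)) f (x : I -> bool -> R) (sg : I -> R)
    (z al : I -> CC R * CC R) (al0 : CC R * CC R) o :
  (forall i c, axis (z i) c = (x i c)%:C%C * axis (al i) c) ->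
  (forall c, tends F (fun i => axis (al i) c) (axis al0 c)) ->
  (forall m, m \in msupp f -> (fun i => wgt (x i) m / sg i) @ F --> ((D m)%:R : R)) ->
  tends F (fun i => (scale_opt (x i) o / sg i)%:C%C * ev (deriv_opt o f) (z i))
    (ev (deriv_opt o (select D f)) al0).
Proof.
move=> zal all Kl; rewrite ev_select.
have -> : (fun i => (scale_opt (x i) o / sg i)%:C%C * ev (deriv_opt o f) (z i)) =
   (fun i => \sum_(m <- msupp f) ((wgt (x i) m / sg i)%:C%C * mcoeff m f) *
      ev (deriv_opt o (mpolyX C m)) (al i)).
  apply/funext => i; rewrite ev_sum mulr_sumr; apply: eq_bigr => m _.
  have swap (s g k A w B : C) : s * A = w * B -> (s * g) * (k * A) = (w * g * k) * B.
    move=> H; have -> : (s * g) * (k * A) = g * k * (s * A) by ring.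
    by rewrite H; ring.
  rewrite (real_complexM (scale_opt _ _)) (real_complexM (wgt _ _)); apply: swap.
  exact: deriv_mono_scale.
rewrite big_seq; under eq_fun do rewrite big_seq.
apply: tends_sum => m mf; apply: tendsM; last exact: tends_axis.
apply: tendsM; last exact: tends_cst.
by have := tends_real (Kl m mf); rewrite rmorph_nat; apply.
Qed.

End Scaling.

(** * Limits of rescaled points of tangency *)

Section TangentLimits.
Variable R : realType.
Local Notation C := (complex R).
Implicit Types (f g : mixed_poly R) (m : multinom 4) (c : bool).

(** Up to a factor, the component along coordinate c of the gradient of
    Im (conj om * g). *)
Definition rank_defect g (om : C) (z : CC R * CC R) c : C :=
  Num.conj om * ev (mderiv (cvar c) g) z - om * Num.conj (ev (mderiv (var c) g) z).

(** The differential of g then has its image in the line spanned by om: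
    concretely g_c = om^2 * conj (g_cbar) for both coordinates c. *)
Lemma rank_defect_critical g om z : modulus om = 1 ->
  (forall c, rank_defect g om z c = 0) -> critical_set g z.
Proof.
move=> om1 rd; have oo : om * Num.conj om = 1.
  by rewrite mul_conj_modulus om1 expr1n.
pose p c := ev (mderiv (var c) g) z; pose q c := ev (mderiv (cvar c) g) z.
have pE c : p c = om ^+ 2 * Num.conj (q c).
  have /eqP := rd c; rewrite subr_eq0 => /eqP H.
  have {}H : om * Num.conj (p c) = Num.conj om * q c by rewrite H.
  have : om * Num.conj (om * Num.conj (p c)) = om * Num.conj (Num.conj om * q c) by rewrite H.
  rewrite !rmorphM /= !conjCK mulrA oo mul1r mulrA => ->.
  by rewrite expr2.
have nE c : `|p c| ^+ 2 = `|q c| ^+ 2.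
  rewrite pE !norm_modulus modulusM modulusX om1 expr1n mul1r modulusJ //.
have alg (A B A' B' : C) : A = om ^+ 2 * Num.conj B -> A' = om ^+ 2 * Num.conj B' ->
    A * Num.conj B' - Num.conj B * A' = 0.
  by move=> -> ->; ring.
have e1 := alg _ _ _ _ (pE false) (pE true).
have sub0 (A B : C) : A = B -> A - B = 0 by move=> ->; rewrite subrr.
have e2 c := sub0 _ _ (nE c).
by split; [exact: e1|exact: e2 false|exact: e2 true].
Qed.

Lemma tangent_unit f om lam z : tangent_at f om lam z -> modulus om = 1.
Proof.
by move=> [+ _ _]; rewrite norm_modulus -[1]/(1%:C%C) => /eqP; rewrite (inj_eq (@complexI R)) => /eqP.
Qed.

(** The scalar product of the tangency equation with the radial direction of one
    coordinate is the imaginary part of an Euler sum. *)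
Lemma tangent_euler f om lam z c : tangent_at f om lam z ->
  Im (Num.conj om * (axis z c * ev (mderiv (var c) f) z +
    Num.conj (axis z c) * ev (mderiv (cvar c) f) z)) = lam * modulus (axis z c) ^+ 2.
Proof.
move=> [_ _ /(_ c)]; set A := ev (mderiv (cvar c) f) z.
set B := ev (mderiv (var c) f) z; move: A B (axis z c) => A B w H.
have : Im (Num.conj w * (Num.conj om * A - om * Num.conj B)) = lam * modulus w ^+ 2.
  by rewrite H modulus_sqr !ReImE /=; ring.
by move=> <-; rewrite !ReImE /=; ring.
Qed.

(** In this section the points of tangency are z = x * al, with scales x and with
    al tending to al0; f_D is the rescaled limit of f and is quasi-homogeneous of
    degree d for the weight P. The number nu c is the multiplier lam after
    rescaling, so the rank defect of f_D at al0 is the limit of i * nu c * al_c. *)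
Section Limit.
Variables (I : Type) (F : set_system I).
Context {FF : ProperFilter F}.
Variables (f : mixed_poly R) (D : pred (multinom 4)) (x : I -> bool -> R) (sg : I -> R).
Variables (z al : I -> CC R * CC R) (al0 : CC R * CC R).
Variables (om : I -> C) (om0 : C) (lam : I -> R).
Variables (P : bool -> nat) (d : nat).
Hypothesis tang : forall i, tangent_at f (om i) (lam i) (z i).
Hypothesis sg0 : forall i, 0 < sg i.
Hypothesis zal : forall i c, axis (z i) c = (x i c)%:C%C * axis (al i) c.
Hypothesis all : forall c, tends F (fun i => axis (al i) c) (axis al0 c).
Hypothesis oml : tends F om om0.
Hypothesis Kl : forall m, m \in msupp f ->
  (fun i => wgt (x i) m / sg i) @ F --> ((D m)%:R : R).
Hypothesis P0 : forall c, (0 < P c)%N.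
Hypothesis PD : forall m, m \in msupp f -> D m ->
  (P false * expo false m + P true * expo true m)%N = d.

Let nu c i := lam i * x i c ^+ 2 / sg i.

Let FF' : Filter F := _.

Lemma om0_unit : modulus om0 = 1.
Proof.
have : (fun i => modulus (om i)) @ F --> modulus om0 by exact: tends_modulus.
have -> : (fun i => modulus (om i)) = (fun=> 1).
  by apply/funext => i; exact: tangent_unit (tang i).
move=> H; apply: (@complexI R); apply: (tends_unique (F := F)).
  exact: tends_real H.
exact: tends_cst.
Qed.

Lemma defect_tends c : tends F (fun i => 'i%C * (nu c i)%:C%C * axis (al i) c)
  (rank_defect (select D f) om0 al0 c).
Proof.
have -> : (fun i => 'i%C * (nu c i)%:C%C * axis (al i) c) = (fun i =>
    Num.conj (om i) * ((x i c / sg i)%:C%C * ev (mderiv (cvar c) f) (z i)) -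
    om i * Num.conj ((x i c / sg i)%:C%C * ev (mderiv (var c) f) (z i))).
  apply/funext => i; have [_ _ /(_ c) H] := tang i.
  have -> : nu c i = x i c / sg i * lam i * x i c by rewrite /nu; ring.
  rewrite (real_complexM _ (x i c)) (real_complexM _ (lam i)).
  rewrite (zal i c) in H; move: (x i c / sg i) H => k.
  move: (ev _ _) (ev _ _) => A B H.
  rewrite rmorphM /= conj_real.
  have -> : 'i%C * (k%:C%C * (lam i)%:C%C * (x i c)%:C%C) * axis (al i) c =
    k%:C%C * ('i%C * (lam i)%:C%C * ((x i c)%:C%C * axis (al i) c)) by ring.
  by rewrite -H; ring.
have S o := @scaled_tends R I F FF' D f x sg z al al0 o zal all Kl.
apply: tendsB; apply: tendsM => //; first exact: tendsJ.
  by have := S (Some (cvar c)); rewrite /= axis_of_cvar.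
by apply: tendsJ; have := S (Some (var c)); rewrite /= axis_of_var.
Qed.

(** The sum of the Euler identities of f_D weighted by P is d * f_D, and
    conj om * f is real at the points of tangency. Hence
    P_u nu_u |al_u|^2 + P_v nu_v |al_v|^2 tends to 0. Its two terms have the sign of
    lam, so that each of them tends to 0. *)
Lemma radial_tends0 c :
  (fun i => nu c i * modulus (axis (al i) c) ^+ 2) @ F --> (0 : R).
Proof.
pose E i c := Num.conj (om i) * (axis (z i) c * ev (mderiv (var c) f) (z i) +
    Num.conj (axis (z i) c) * ev (mderiv (cvar c) f) (z i)).
pose E0 c := axis al0 c * ev (mderiv (var c) (select D f)) al0 +
    Num.conj (axis al0 c) * ev (mderiv (cvar c) (select D f)) al0.
have S o := @scaled_tends R I F FF' D f x sg z al al0 o zal all Kl.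
have El b : tends F (fun i => (sg i)^-1%:C%C * E i b) (Num.conj om0 * E0 b).
  have -> : (fun i => (sg i)^-1%:C%C * E i b) = (fun i => Num.conj (om i) *
      (axis (al i) b * ((x i b / sg i)%:C%C * ev (mderiv (var b) f) (z i)) +
       Num.conj (axis (al i) b) * ((x i b / sg i)%:C%C * ev (mderiv (cvar b) f) (z i)))).
    apply/funext => i; rewrite /E zal !(real_complexM (x i b)).
    move: (ev _ _) (ev _ _) (axis _ _) (Num.conj (om i)) => A B w o.
    by rewrite rmorphM /= conj_real; ring.
  apply: tendsM; first exact: tendsJ.
  apply: tendsD; apply: tendsM => //; last 2 first.
  - exact: tendsJ.
  - by have := S (Some (cvar b)); rewrite /= axis_of_cvar.
  - by have := S (Some (var b)); rewrite /= axis_of_var.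
have nuE b i : nu b i * modulus (axis (al i) b) ^+ 2 = Im ((sg i)^-1%:C%C * E i b).
  have := tangent_euler b (tang i); rewrite -/(E i b) zal modulusM modulus_real.
  rewrite exprMn real_normK ?num_real// /nu => H.
  by rewrite ReImE /= mul0r addr0 H; ring.
have E0d : (P false)%:R * E0 false + (P true)%:R * E0 true = d%:R * ev (select D f) al0.
  rewrite /E0 !euler_select; have := ev_select D None f al0; rewrite /deriv_opt => ->.
  rewrite !mulr_sumr -big_split/= big_seq [RHS]big_seq; apply: eq_bigr => m mf.
  have [Dm|] := boolP (D m); last by rewrite !mul0r !mulr0 !mul0r !mulr0 addr0.
  by rewrite -(PD mf Dm) natrD !natrM; ring.
have Gl : tends F (fun i => Num.conj (om i) * ((scale_opt (x i) None / sg i)%:C%C *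
    ev (deriv_opt None f) (z i))) (Num.conj om0 * ev (select D f) al0).
  by apply: tendsM (S None); exact: tendsJ.
move: (ev (select D f) al0) Gl E0d => G Gl E0d.
clearbody E E0; clear S.
pose q b i := nu b i * modulus (axis (al i) b) ^+ 2.
pose T i := (P false)%:R * q false i + (P true)%:R * q true i.
have Tl : T @ F --> (0 : R).
  have ImnM (k : nat) (w : C) : Im (k%:R * w) = k%:R * Im w.
    have -> : k%:R = (k%:R : R)%:C%C :> C by rewrite rmorph_nat.
    by rewrite ImM /= mul0r addr0.
  have H : tends F (fun i => (P false)%:R * ((sg i)^-1%:C%C * E i false) +
      (P true)%:R * ((sg i)^-1%:C%C * E i true))
      ((P false)%:R * (Num.conj om0 * E0 false) + (P true)%:R * (Num.conj om0 * E0 true)).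
    by apply: tendsD; apply: tendsM => //; exact: tends_cst.
  have [_] := H; have -> : (fun i => Im ((P false)%:R * ((sg i)^-1%:C%C * E i false) +
      (P true)%:R * ((sg i)^-1%:C%C * E i true))) = T.
    by apply/funext => i; rewrite ImD !ImnM /T /q !nuE.
  have -> : (P false)%:R * (Num.conj om0 * E0 false) + (P true)%:R * (Num.conj om0 * E0 true)
      = d%:R * (Num.conj om0 * G).
    by rewrite [RHS]mulrCA -E0d; ring.
  rewrite ImnM.
  suff -> : Im (Num.conj om0 * G) = 0 by rewrite mulr0.
  move: Gl => [_].
  have -> : (fun i => Im (Num.conj (om i) * ((scale_opt (x i) None / sg i)%:C%C *
      ev (deriv_opt None f) (z i)))) = (fun=> 0).
    apply/funext => i; have [_ + _] := tang i; rewrite /scale_opt /deriv_opt.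
    by rewrite mulrCA (ImM (_%:C%C)) /= => ->; rewrite mulr0 mul0r addr0.
  by move=> H0; apply: (cvg_unique _ H0 (cvg_cst _)); exact: Rhausdorff.
have bnd i b : `|q b i| <= `|T i|.
  have same a' : q a' i = lam i * ((x i a' * modulus (axis (al i) a')) ^+ 2 / sg i).
    by rewrite /q /nu; ring.
  have pos a' : 0 <= (x i a' * modulus (axis (al i) a')) ^+ 2 / sg i.
    by rewrite divr_ge0 ?sqr_ge0// ltW.
  have P1 a' : 1 <= (P a')%:R :> R by rewrite ler1n.
  have Pge0 a' : 0 <= (P a')%:R :> R by exact: ler0n.
  have -> : T i = lam i * \sum_a' (P a')%:R * ((x i a' * modulus (axis (al i) a')) ^+ 2 / sg i).
    by rewrite /T !same big_bool /=; ring.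
  rewrite same !(normrM (lam i)) ler_wpM2l// (ger0_norm (pos b)).
  rewrite [X in _ <= X]ger0_norm; last first.
    by apply: sumr_ge0 => a' _; rewrite mulr_ge0.
  rewrite (bigD1 b)//=.
  apply: (@le_trans _ _ ((P b)%:R * ((x i b * modulus (axis (al i) b)) ^+ 2 / sg i))).
    by rewrite ler_peMl.
  by rewrite lerDl; apply: sumr_ge0 => a' _; rewrite mulr_ge0.
apply/norm_cvg0P; apply: (@squeeze_cvgr _ _ _ _ (fun=> 0) (fun i => `|T i|)).
- by near=> i; rewrite normr_ge0 bnd.
- exact: cvg_cst.
- exact/norm_cvg0P.
Unshelve. all: by end_near. Qed.

(** The product of the defect with the conjugate of al0_c is the limit of the
    radial term of radial_tends0. *)
Lemma defect_torus c : axis al0 c != 0 -> rank_defect (select D f) om0 al0 c = 0.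
Proof.
move=> ac; apply: (mulIf (x := Num.conj (axis al0 c))).
  by rewrite -modulus_eq0 modulusJ modulus_eq0.
rewrite mul0r; apply: (tends_unique (F := F)).
  by apply: tendsM; [exact: defect_tends|exact: tendsJ (all c)].
have -> : (fun i => 'i%C * (nu c i)%:C%C * axis (al i) c * Num.conj (axis (al i) c)) =
   (fun i => 'i%C * (nu c i * modulus (axis (al i) c) ^+ 2)%:C%C).
  by apply/funext => i; rewrite -mulrA mul_conj_modulus real_complexM; ring.
suff : tends F (fun i => 'i%C * (nu c i * modulus (axis (al i) c) ^+ 2)%:C%C)
    ('i%C * (0 : R)%:C%C) by rewrite mulr0.
apply: tendsM; first exact: tends_cst.
exact: tends_real (radial_tends0 c).
Qed.

(** A limit on the axis, when every monomial contains the coordinate. As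
    Im (conj om * f) = 0, the Euler sum of the coordinate may be weighted by expo - 1
    instead of expo; only monomials of exponent at least two remain, and these are
    too small, by a factor |al_c|, to contribute to the limit. *)
Lemma defect_axis_divisible c : axis al0 c = 0 ->
  (forall m, m \in msupp f -> (0 < expo c m)%N) ->
  (forall i m, 0 <= wgt (x i) m) ->
  rank_defect (select D f) om0 al0 c = 0.
Proof.
move=> ac0 ge1 w0; apply: (tends_unique (F := F)); first exact: defect_tends.
apply: tends0_modulus.
pose r i b := modulus (axis (al i) b).
pose h i := \sum_(m <- msupp f) ((expo c m).-1)%:R * modulus (mcoeff m f) *
  (wgt (x i) m / sg i) * (r i c ^+ (expo c m).-1 * r i (~~ c) ^+ expo (~~ c) m).
have r0 i b : 0 <= r i b by exact: modulus_ge0.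
have h0 i : 0 <= h i.
  have sgi : 0 <= (sg i)^-1 by rewrite invr_ge0 ltW.
  apply: sumr_ge0 => m _; apply: mulr_ge0; last by rewrite mulr_ge0 ?exprn_ge0.
  apply: mulr_ge0; last exact: mulr_ge0.
  by rewrite mulr_ge0 ?modulus_ge0.
have hl : h @ F --> (0 : R).
  have rl b : (fun i => r i b) @ F --> modulus (axis al0 b) by exact: tends_modulus.
  have powl b k : (fun i => r i b ^+ k) @ F --> modulus (axis al0 b) ^+ k.
    apply: (cvg_comp (fun i => r i b) (fun y => y ^+ k)); first exact: rl.
    exact: exprn_continuous.
  have -> : (0 : R) = \sum_(m <- msupp f) 0 by rewrite big1.
  apply: cvg_sum_seq => m mf.
  have -> : (0 : R) = ((expo c m).-1)%:R * modulus (mcoeff m f) * (D m)%:R *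
      (modulus (axis al0 c) ^+ (expo c m).-1 * modulus (axis al0 (~~ c)) ^+ expo (~~ c) m).
    rewrite ac0 modulus0 expr0n; case: (_ .-1) => [|k] /=; first by rewrite !mul0r.
    by rewrite mul0r mulr0.
  apply: cvgM; last by apply: cvgM; exact: powl.
  by apply: cvgM; [exact: cvg_cst|exact: Kl].
apply: (@squeeze_cvgr _ _ _ _ (fun=> 0) h); [|exact: cvg_cst|exact: hl].
near=> i; rewrite modulus_ge0 !modulusM modulus_real -/(r i c).
rewrite modulus_i mul1r; have [->|rc] := eqVneq (r i c) 0; first by rewrite mulr0 h0.
have rp : 0 < r i c by rewrite lt_def rc r0.
rewrite -(ler_pM2r rp) -mulrA -expr2.
have -> : `|nu c i| * r i c ^+ 2 = `|lam i * modulus (axis (z i) c) ^+ 2| / sg i.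
  rewrite zal modulusM modulus_real exprMn real_normK ?num_real//.
  rewrite /nu (normrM (lam i * _)) !(normrM (lam i)) normfV (gtr0_norm (sg0 i)).
  rewrite (ger0_norm (sqr_ge0 (x i c))) (ger0_norm (mulr_ge0 (sqr_ge0 _) (sqr_ge0 _))).
  by rewrite /r; ring.
rewrite -(tangent_euler c (tang i)) ler_pdivrMr//.
have -> : Im (Num.conj (om i) * (axis (z i) c * ev (mderiv (var c) f) (z i) +
    Num.conj (axis (z i) c) * ev (mderiv (cvar c) f) (z i))) =
  Im (Num.conj (om i) * \sum_(m <- msupp f) ((expo c m).-1)%:R * mcoeff m f * ev (mpolyX C m) (z i)).
  have [_ fz _] := tang i; rewrite euler -[LHS]subr0 -[X in _ - X]fz -ImN -ImD -mulrN -mulrDr.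
  have := ev_sum None f (z i); rewrite /deriv_opt => ->; rewrite -sumrN -big_split/=.
  congr (Im (_ * _)); rewrite big_seq [RHS]big_seq; apply: eq_bigr => m /ge1 m1.
  by rewrite -{1}(prednK m1) -natr1; ring.
apply: (le_trans (norm_Im_le _)); rewrite modulusM modulusJ.
rewrite (tangent_unit (tang i)) mul1r (le_trans (modulus_sum _ _))// /h !mulr_suml.
rewrite big_seq [X in _ <= X]big_seq; apply: ler_sum => m mf.
rewrite !modulusM (mono_scale (zal i)) modulusM modulus_mono modulus_real.
rewrite (ger0_norm (w0 i m)) (wgt_split (fun b => modulus (axis (al i) b)) c) /=.
rewrite -/(r i c) -/(r i (~~ c)).
have -> : r i c ^+ expo c m = r i c * r i c ^+ (expo c m).-1.
  by rewrite -exprS prednK// ge1.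
rewrite modulus_nat.
rewrite le_eqVlt; apply/orP; left; apply/eqP; field.
by rewrite gt_eqF.
Unshelve. all: by end_near. Qed.

(** A limit on the axis, when some monomial m0 of the face is free of the
    coordinate. If the face has a monomial linear in the coordinate, then
    P (~~ c) <= P c, the scale of c is the smaller one, and nu c is dominated by
    nu (~~ c), which tends to 0. If it has none, both derivatives of f_D with
    respect to the coordinate vanish on the axis. *)
Lemma defect_axis_free c m0 : axis al0 c = 0 ->
  m0 \in msupp f -> D m0 -> expo c m0 = 0%N ->
  modulus (axis al0 (~~ c)) = 1 ->
  ((P (~~ c) <= P c)%N -> \forall i \near F, `|x i c| <= `|x i (~~ c)|) ->
  rank_defect (select D f) om0 al0 c = 0.
Proof.
move=> ac0 m0f Dm0 e0 a1 xx.
have [[m1 [m1f Dm1 e1]]|no1] := pselect (exists m1, [/\ m1 \in msupp f, D m1 & expo c m1 = 1%N]).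
  (* Compare the P-degrees of m0 and of the linear monomial m1. *)
  have PP : (P (~~ c) <= P c)%N.
    have Pm m : m \in msupp f -> D m -> (P c * expo c m + P (~~ c) * expo (~~ c) m)%N = d.
      by move=> mf Dm; rewrite -(PD mf Dm); case: (c) => //=; exact: addnC.
    have := Pm _ m0f Dm0; have := Pm _ m1f Dm1; rewrite e0 e1 muln1 muln0 add0n => <- H.
    have := P0 c; have := P0 (~~ c); move: H; move: (P c) (P (~~ c)) => p q H q0 p0.
    have : (expo (~~ c) m1 < expo (~~ c) m0)%N.
      by rewrite -(ltn_pmul2l q0) H -[X in (X < _)%N]add0n ltn_add2r.
    by move: H; nia.
  apply: (tends_unique (F := F)); first exact: defect_tends.
  apply: tends0_modulus.
  pose r i b := modulus (axis (al i) b).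
  have rl b : (fun i => r i b) @ F --> modulus (axis al0 b) by exact: tends_modulus.
  have r0 i b : 0 <= r i b by exact: modulus_ge0.
  pose q i := nu (~~ c) i * r i (~~ c) ^+ 2.
  have ql : q @ F --> (0 : R) by exact: radial_tends0.
  have hl : (fun i => 4 * (`|q i| * r i c)) @ F --> (0 : R).
    have -> : (0 : R) = 4 * (0 * modulus (axis al0 c)) by rewrite mul0r mulr0.
    apply: cvgM; first exact: cvg_cst.
    by apply: cvgM => //; exact/norm_cvg0P.
  have rhalf : \forall i \near F, 2^-1 < r i (~~ c).
    apply: (cvgr_gt (modulus (axis al0 (~~ c)))) => //.
    by rewrite a1 invf_lt1// ltr1n.
  apply: (@squeeze_cvgr _ _ _ _ (fun=> 0) (fun i => 4 * (`|q i| * r i c)));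
    [|exact: cvg_cst|exact: hl].
  have xn := xx PP; near=> i; rewrite modulus_ge0 !modulusM modulus_real -/(r i c).
  rewrite modulus_i mul1r mulrA ler_wpM2r//.
  have xi : `|x i c| <= `|x i (~~ c)| by near: i.
  have ri : 2^-1 < r i (~~ c) by near: i.
  have nn b : `|nu b i| = `|lam i| / sg i * `|x i b| ^+ 2.
    by rewrite /nu (normrM (lam i * _)) (normrM (lam i)) normfV (gtr0_norm (sg0 i)) normrX; ring.
  have -> : `|q i| = `|lam i| / sg i * (`|x i (~~ c)| ^+ 2 * r i (~~ c) ^+ 2).
    by rewrite /q (normrM (nu _ _)) nn (ger0_norm (sqr_ge0 (r _ _))) mulrA.
  rewrite nn [X in _ <= X]mulrCA; apply: ler_wpM2l.
    by rewrite divr_ge0// ltW.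
  have x2 : `|x i c| ^+ 2 <= `|x i (~~ c)| ^+ 2 by rewrite ler_sqr ?nnegrE.
  have r2 : 1 <= 4 * r i (~~ c) ^+ 2.
    have : 2^-1 ^+ 2 <= r i (~~ c) ^+ 2 by rewrite ler_sqr ?nnegrE// ltW.
    by rewrite exprVn; lra.
  by apply: (le_trans x2); rewrite mulrCA ler_peMr ?sqr_ge0.
have ev0 j : j = var c \/ j = cvar c -> ev (mderiv j (select D f)) al0 = 0.
  move=> jc; have := ev_select D (Some j) f al0; rewrite /deriv_opt => ->.
  rewrite big_seq big1// => m mf.
  have [Dm|] := boolP (D m); last by rewrite !mul0r.
  rewrite mderivX evZ; have [->|mj] := posnP (m j); first by rewrite mul0r mulr0.
  suff -> : ev (mpolyX C (mnm_sub m (mnm1 j))) al0 = 0 by rewrite !mulr0.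
  apply/eqP; rewrite -modulus_eq0 modulus_mono (wgt_split _ c) ac0 modulus0 expr0n.
  suff : (expo c (mnm_sub m (mnm1 j)) != 0)%N by move=> /negPf ->; rewrite mul0r.
  apply/negP => /eqP E; apply: no1; exists m; split => //; move: E.
  rewrite /expo !mnmBE !mnm1E; case: jc mj => -> mj; rewrite eqxx.
    rewrite (_ : (var c == cvar c) = false) ?subn0; last by case: (c).
    by lia.
  rewrite (_ : (cvar c == var c) = false) ?subn0; last by case: (c).
  by lia.
by rewrite /rank_defect !ev0 ?rmorph0 ?mulr0 ?subrr//; [left|right].
Unshelve. all: by end_near. Qed.

End Limit.
End TangentLimits.

Section ScalingLimits.
Variable R : realType.
Local Notation C := (complex R).
Implicit Types (f g : mixed_poly R) (m : multinom 4) (c : bool) (P : bool -> nat).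

Definition wdeg P m := (P false * expo false m + P true * expo true m)%N.

Lemma wdeg_split P c m : wdeg P m = (P c * expo c m + P (~~ c) * expo (~~ c) m)%N.
Proof. by rewrite /wdeg; case: c => //=; exact: addnC. Qed.

Definition on_face P f m := all (fun m' => wdeg P m <= wdeg P m')%N (msupp f).

Definition moduli (z : CC R * CC R) c : R := modulus (axis z c).

Lemma positive_root (y : R) (p : nat) : 0 < y -> (0 < p)%N ->
  exists2 t, 0 < t & t ^+ p = y.
Proof.
move=> y0 p0; exists (y `^ p%:R^-1); first exact: powR_gt0.
rewrite -powR_mulrn ?powR_ge0// -powRrM mulVf ?powRr1// ?ltW// pnatr_eq0.
by rewrite -lt0n.
Qed.

Lemma select_ext (D D' : pred (multinom 4)) f :
  {in msupp f, D =1 D'} -> select D f = select D' f.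
Proof.
move=> DD; rewrite /select big_seq_cond [RHS]big_seq_cond.
by apply: eq_bigl => m; case: (boolP (m \in msupp f)) => //= /DD ->.
Qed.

Lemma rescale (z : CC R * CC R) (x : bool -> R) : (forall b, 0 < x b) ->
  exists al, forall b, axis z b = (x b)%:C%C * axis al b.
Proof.
move=> x0; exists (axis z false / (x false)%:C%C, axis z true / (x true)%:C%C) => b.
have nz : (x b)%:C%C != 0 :> C by rewrite -modulus_eq0 modulus_real normr_eq0 gt_eqF.
by case: b nz => nz; rewrite mulrC divfK.
Qed.

Section Ultra.
Variables (I : Type) (F : set_system I).
Context {UF : UltraFilter F}.
Variables (f : mixed_poly R) (z : I -> CC R * CC R) (om : I -> C) (lam : I -> R).
Hypothesis tang : forall i, tangent_at f (om i) (lam i) (z i).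

Let FF : Filter F := _.

Lemma om_limit : exists om0, tends F om om0.
Proof.
apply: (@ultra_bounded_tends _ _ _ _ _ 1); near=> i.
by rewrite (tangent_unit (tang i)).
Unshelve. all: by end_near. Qed.

(** The scales are (t^P_u, t^P_v), with t such that the coordinate other than c
    becomes unimodular; the divisor is t^d. The bound M keeps the coordinate c
    bounded, but its limit can be 0. If the smallest exponent of c is attained on
    the face, then its being zero or positive decides between the two arguments
    for limits on an axis. *)
Lemma weighted_limit c P d (M : R) :
    (forall b, (0 < P b)%N) ->
    (exists2 m, m \in msupp f & wdeg P m = d) ->
    (forall m, m \in msupp f -> d <= wdeg P m)%N ->
    (forall i, axis (z i) (~~ c) != 0) ->
    ((fun i => moduli (z i) (~~ c)) @ F --> (0 : R)) ->
    (\forall i \near F, moduli (z i) c ^+ P (~~ c) / moduli (z i) (~~ c) ^+ P c <= M) ->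
  exists al0 : CC R * CC R, [/\ moduli al0 (~~ c) = 1,
    (fun i => moduli (z i) c ^+ P (~~ c) / moduli (z i) (~~ c) ^+ P c) @ F -->
      moduli al0 c ^+ P (~~ c),
    axis al0 c != 0 -> critical_set (select (on_face P f) f) al0 &
    (exists m, [/\ m \in msupp f, on_face P f m &
       forall m', m' \in msupp f -> (expo c m <= expo c m')%N]) ->
      critical_set (select (on_face P f) f) al0].
Proof.
move=> P0 [md mdf mdd] dmin zc zl zM; have [om0 oml] := om_limit.
have /choice[t tP] : forall i, exists t, 0 < t /\ t ^+ P (~~ c) = moduli (z i) (~~ c).
  move=> i; have [|t t0 tp] := @positive_root (moduli (z i) (~~ c)) (P (~~ c)) _ (P0 _).
    by rewrite modulus_gt0.
  by exists t.
have t0 i : 0 < t i by have [] := tP i.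
have tE i : t i ^+ P (~~ c) = moduli (z i) (~~ c) by have [] := tP i.
have tl : t @ F --> (0 : R).
  apply/cvgr0Pnorm_lt => e e0; have ep : 0 < e ^+ P (~~ c) by rewrite exprn_gt0.
  have /cvgr0Pnorm_lt/(_ _ ep) := zl; apply: filterS => i.
  rewrite (gtr0_norm (t0 i)) ger0_norm ?modulus_ge0// -tE.
  by rewrite ltr_pXn2r ?nnegrE// ltW.
pose x i b := t i ^+ P b.
have x0 i b : 0 < x i b by rewrite exprn_gt0.
have /choice[al zal] := fun i => rescale (z i) (x0 i).
have mal i b : moduli (z i) b = x i b * moduli (al i) b.
  by rewrite /moduli zal modulusM modulus_real gtr0_norm.
have alc i : moduli (al i) (~~ c) = 1.
  apply: (mulfI (x := x i (~~ c))); first by rewrite gt_eqF.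
  by rewrite -mal mulr1 -tE.
have ratio i : moduli (z i) c ^+ P (~~ c) / moduli (z i) (~~ c) ^+ P c =
    moduli (al i) c ^+ P (~~ c).
  rewrite mal exprMn -tE /x -!exprM (mulnC (P c)) mulrAC divff ?mul1r//.
  by rewrite gt_eqF// exprn_gt0.
have alM : \forall i \near F, moduli (al i) c <= 1 + `|M|.
  apply: filterS zM => i; rewrite ratio => aM.
  have [a1|a1] := leP (moduli (al i) c) 1; first by rewrite (le_trans a1)// lerDl.
  have : moduli (al i) c <= moduli (al i) c ^+ P (~~ c).
    rewrite -{1}[moduli (al i) c]expr1; apply: ler_weXn2l => //; exact: ltW.
  by move=> /le_trans/(_ aM)/le_trans; apply; rewrite (le_trans (ler_norm M))// lerDr.
have /choice[l lP] : forall b, exists l, tends F (fun i => axis (al i) b) l.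
  move=> b; have [->|->] := eq_or_negb b c.
    exact: ultra_bounded_tends alM.
  apply: (@ultra_bounded_tends _ _ _ _ _ 1); near=> i.
  by have := alc i; rewrite /moduli => ->.
pose al0 : CC R * CC R := (l false, l true).
have all b : tends F (fun i => axis (al i) b) (axis al0 b).
  by have := lP b; case: b.
have modl b : (fun i => moduli (al i) b) @ F --> moduli al0 b.
  exact: tends_modulus (all b).
pose D m := wdeg P m == d.
have DE : {in msupp f, D =1 on_face P f}.
  move=> m mf; apply/eqP/allP => [-> m' m'f|H]; first exact: dmin.
  by apply/eqP; rewrite eqn_leq dmin// andbT -mdd H.
have Kl m : m \in msupp f -> (fun i => wgt (x i) m / t i ^+ d) @ F --> ((D m)%:R : R).
  move=> mf; have -> : (fun i => wgt (x i) m / t i ^+ d) = (fun i => t i ^+ (wdeg P m - d)).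
    apply/funext => i; rewrite /wgt /x -!exprM -exprD -/(wdeg P m).
    by rewrite -{1}(subnK (dmin m mf)) exprD mulfK// gt_eqF// exprn_gt0.
  have -> : (D m)%:R = 0 ^+ (wdeg P m - d) :> R.
    by rewrite expr0n subn_eq0 /D eqn_leq dmin// andbT.
  by apply: (cvg_comp t (fun y => y ^+ _) tl); exact: exprn_continuous.
have sg0 i : 0 < t i ^+ d by rewrite exprn_gt0.
have PD m : m \in msupp f -> D m -> (P false * expo false m + P true * expo true m)%N = d.
  by move=> _ /eqP.
have al1 : moduli al0 (~~ c) = 1.
  have H : (fun i => moduli (al i) (~~ c)) @ F --> moduli al0 (~~ c) by exact: modl.
  apply: (cvg_unique (@Rhausdorff R) H).
  have -> : (fun i => moduli (al i) (~~ c)) = (fun=> 1) by apply/funext.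
  exact: cvg_cst.
have om01 : modulus om0 = 1 by exact: om0_unit tang oml.
have ax1 : axis al0 (~~ c) != 0 by rewrite -modulus_eq0 -/(moduli _ _) al1 oner_eq0.
have torus b : axis al0 b != 0 -> rank_defect (select D f) om0 al0 b = 0.
  exact: (defect_torus tang sg0 zal all oml Kl P0 PD).
rewrite -(select_ext DE); exists al0; split => //.
- under eq_fun do rewrite ratio.
  apply: (cvg_comp (fun i => moduli (al i) c) (fun y => y ^+ _) (modl c)).
  exact: exprn_continuous.
- move=> ac; apply: rank_defect_critical om01 _ => b; apply: torus.
  by have [->|->] := eq_or_negb b c.
- move=> [m0 [m0f Dm0 m0min]]; rewrite -DE// in Dm0.
  apply: rank_defect_critical om01 _ => b.
  have [->|->] := eq_or_negb b c.
    have [ac|ac] := eqVneq (axis al0 c) 0; last exact: torus.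
    have [e0|e0] := posnP (expo c m0).
      apply: (defect_axis_free tang sg0 zal all oml Kl P0 PD ac m0f Dm0 e0) => // PP.
      have /cvgr0Pnorm_lt/(_ _ ltr01) := tl; apply: filterS => i.
      rewrite (gtr0_norm (t0 i)) => t1; rewrite !gtr0_norm//.
      by rewrite /x ler_wiXn2l// ltW.
    apply: (defect_axis_divisible tang sg0 zal all oml Kl ac).
      by move=> m mf; rewrite (leq_trans e0)// m0min.
    by move=> i m; rewrite /wgt mulr_ge0// exprn_ge0// ltW.
  exact: torus.
Unshelve. all: by end_near. Qed.

(** Both coordinates are rescaled to modulus one. A single monomial is
    quasi-homogeneous for every weight, here (1, 1). *)
Lemma vertex_limit m0 : m0 \in msupp f ->
    (forall i b, axis (z i) b != 0) ->
    (forall m, m \in msupp f -> (exists b, expo b m != expo b m0) ->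
      (fun i => wgt (moduli (z i)) m / wgt (moduli (z i)) m0) @ F --> (0 : R)) ->
  exists al0 : CC R * CC R, (forall b, axis al0 b != 0) /\
    critical_set (select (fun m => [forall b, expo b m == expo b m0]) f) al0.
Proof.
move=> m0f z0 zl; have [om0 oml] := om_limit.
pose x i b := moduli (z i) b.
have x0 i b : 0 < x i b by rewrite modulus_gt0.
have /choice[al zal] := fun i => rescale (z i) (x0 i).
have al1 i b : moduli (al i) b = 1.
  apply: (mulfI (x := x i b)); first by rewrite gt_eqF.
  by rewrite mulr1 {2}/x /moduli zal modulusM modulus_real gtr0_norm.
have /choice[l lP] : forall b, exists l, tends F (fun i => axis (al i) b) l.
  move=> b; apply: (@ultra_bounded_tends _ _ _ _ _ 1); near=> i.
  by have := al1 i b; rewrite /moduli => ->.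
pose al0 : CC R * CC R := (l false, l true).
have all b : tends F (fun i => axis (al i) b) (axis al0 b) by have := lP b; case: b.
have al01 b : moduli al0 b = 1.
  have H : (fun i => moduli (al i) b) @ F --> moduli al0 b by exact: tends_modulus (all b).
  apply: (cvg_unique (@Rhausdorff R) H).
  have -> : (fun i => moduli (al i) b) = (fun=> 1) by apply/funext.
  exact: cvg_cst.
have a0 b : axis al0 b != 0 by rewrite -modulus_eq0 -/(moduli _ _) al01 oner_eq0.
pose D m := [forall b, expo b m == expo b m0].
have w0 i m : 0 < wgt (x i) m by rewrite mulr_gt0 ?exprn_gt0.
have Kl m : m \in msupp f -> (fun i => wgt (x i) m / wgt (x i) m0) @ F --> ((D m)%:R : R).
  move=> mf; have [/forallP Dm|] := boolP (D m).
    have -> : (fun i => wgt (x i) m / wgt (x i) m0) = (fun=> 1).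
      apply/funext => i; have -> : wgt (x i) m = wgt (x i) m0.
        by rewrite /wgt (eqP (Dm false)) (eqP (Dm true)).
      by rewrite divff// gt_eqF.
    exact: cvg_cst.
  by rewrite negb_forall => /existsP[b bm]; apply: zl => //; exists b.
pose P (_ : bool) := 1%N.
have PD m : m \in msupp f -> D m ->
    (P false * expo false m + P true * expo true m)%N = wdeg P m0.
  by move=> _ /forallP Dm; rewrite /wdeg (eqP (Dm false)) (eqP (Dm true)).
exists al0; split => //; apply: (rank_defect_critical (om := om0)).
  exact: om0_unit tang oml.
move=> b.
by apply: (@defect_torus R I F _ f D x (fun i => wgt (x i) m0) z al al0 om om0 lam P (wdeg P m0)).
Unshelve. all: by end_near. Qed.

End Ultra.
End ScalingLimits.


(** * Regions without tangency near the origin *)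

Section Coverage.
Variable R : realType.
Local Notation C := (complex R).
Implicit Types (f g : mixed_poly R) (m : multinom 4) (c : bool) (P : bool -> nat).

Lemma near_seq (I : Type) (J : eqType) (F : set_system I) {FF : Filter F} (s : seq J)
    (Q : J -> I -> Prop) :
  (forall j, j \in s -> \forall i \near F, Q j i) ->
  \forall i \near F, forall j, j \in s -> Q j i.
Proof.
elim: s => [|a s IH] H; first exact: nearW.
have Ha := H a (mem_head _ _).
have Hs := IH (fun j js => H j (mem_behead (s := a :: s) js)).
apply: filterS2 Ha Hs => i Qa Qs j; rewrite in_cons => /predU1P[->//|]; exact: Qs.
Qed.

Lemma ultra_max (I : Type) (J : eqType) (F : set_system I) {UF : UltraFilter F}
    (s : seq J) (g : J -> I -> R) : s != [::] ->
  exists2 k, k \in s & \forall i \near F, forall j, j \in s -> g j i <= g k i.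
Proof.
case: s => // a s _; elim: s a => [|b s IH] a.
  exists a; first exact: mem_head.
  by apply: nearW => i j; rewrite inE => /eqP ->.
have [k ks kmax] := IH b.
have [ka|nka] := in_ultra_setVsetC [set i | g a i <= g k i] UF.
  exists k; first by rewrite in_cons ks orbT.
  by apply: filterS2 ka kmax => i /= ai ki j; rewrite in_cons => /predU1P[->//|]; exact: ki.
exists a; first exact: mem_head.
apply: filterS2 nka kmax => i /= ai ki j; rewrite in_cons => /predU1P[->//|/ki ji].
by rewrite (le_trans ji)// ltW// ltNge; apply/negP.
Qed.

(** Otherwise there are tangencies in Q with moduli at most 1 / (n + 1) for every
    n, and any ultrafilter finer than the cofinite filter gives the family
    excluded by the hypothesis. *)
Lemma tangency_accumulation f (Q : CC R * CC R -> Prop) :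
  (forall (F : set_system nat) (UF : UltraFilter F) z om lam,
    (forall i, Q (z i)) -> (forall i, tangent_at f (om i) (lam i) (z i)) ->
    (forall c, (fun i => moduli (z i) c) @ F --> (0 : R)) -> False) ->
  exists2 rho : R, 0 < rho & forall z om lam, Q z -> (forall c, moduli z c <= rho) ->
    ~ tangent_at f om lam z.
Proof.
move=> H; apply: contrapT => nr.
have /choice[w wP] : forall n : nat, exists w : (CC R * CC R) * C * R,
    [/\ Q w.1.1, forall c, moduli w.1.1 c <= harmonic n & tangent_at f w.1.2 w.2 w.1.1].
  move=> n; apply: contrapT => nw; apply: nr; exists (harmonic n : R).
    by rewrite /harmonic /= invr_gt0.
  by move=> z om lam Qz zn tz; apply: nw; exists (z, om, lam).
have [F [UF sub]] := ultraFilterLemma (eventually_filter).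
apply: (H F UF (fun n => (w n).1.1) (fun n => (w n).1.2) (fun n => (w n).2)).
- by move=> n; have [] := wP n.
- by move=> n; have [] := wP n.
move=> c; apply: (@squeeze_cvgr _ _ _ _ (fun=> 0) (harmonic : nat -> R)).
- by apply: nearW => n; rewrite modulus_ge0; have [_ -> _] := wP n.
- exact: cvg_cst.
- by apply: cvg_trans (@cvg_harmonic R) => U; exact: sub.
Qed.

Definition nocrit f (A : CC R * CC R -> Prop) := forall z, A z -> ~ critical_set f z.

(** A cuspidal neighbourhood of the axis z_c = 0. The rescaled limit can lie on
    this axis, where the extreme face function is also without critical
    points. *)
Lemma cuspidal_region f c P :
    (forall b, (0 < P b)%N) ->
    nocrit (select (on_face P f) f) (fun z => axis z (~~ c) != 0) ->
    (exists m, [/\ m \in msupp f, on_face P f m &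
       forall m', m' \in msupp f -> (expo c m <= expo c m')%N]) ->
  exists2 rho : R, 0 < rho & forall z om lam,
    axis z (~~ c) != 0 /\ moduli z c ^+ P (~~ c) <= moduli z (~~ c) ^+ P c ->
    (forall b, moduli z b <= rho) -> ~ tangent_at f om lam z.
Proof.
move=> P0 nc m0P; apply: tangency_accumulation => F UF z om lam zQ tang zl.
have [m0 [m0f m0F m0c]] := m0P.
have dmin m : m \in msupp f -> (wdeg P m0 <= wdeg P m)%N by move=> mf; exact: (allP m0F).
have zc i : axis (z i) (~~ c) != 0 by have [] := zQ i.
have zM : \forall i \near F, moduli (z i) c ^+ P (~~ c) / moduli (z i) (~~ c) ^+ P c <= 1.
  apply: nearW => i; have [z1 z2] := zQ i.
  by rewrite ler_pdivrMr ?mul1r// exprn_gt0// modulus_gt0.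
have [|al0 [al1 _ _ crit]] := weighted_limit tang P0 _ dmin zc (zl (~~ c)) zM.
  by exists m0.
apply: (nc al0) (crit m0P).
by rewrite -modulus_eq0 -/(moduli _ _) al1 oner_eq0.
Qed.

(** The region between the two cuspidal neighbourhoods. For each end c of the
    Newton boundary, P c is the weight of the 1-face at that end and mL c its
    monomial with the smallest exponent of the coordinate c. *)
Section Middle.
Variable f : mixed_poly R.
Hypothesis f0 : msupp f != [::].
Variable P : bool -> bool -> nat.
Hypothesis P0 : forall c b, (0 < P c b)%N.
Variable mL : bool -> multinom 4.
Hypothesis mLf : forall c, mL c \in msupp f.
Hypothesis mLF : forall c, on_face (P c) f (mL c).
Hypothesis mLmin : forall c m, m \in msupp f -> (expo c (mL c) <= expo c m)%N.
Hypothesis mR : forall c, exists m, [/\ m \in msupp f, on_face (P c) f m &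
  expo c m <> expo c (mL c)].
Hypothesis faces : forall Q : bool -> nat, (forall b, (0 < Q b)%N) ->
  (exists m1 m2, [/\ m1 \in msupp f, m2 \in msupp f, on_face Q f m1, on_face Q f m2 &
     exists b, expo b m1 <> expo b m2]) ->
  nocrit (select (on_face Q f) f) (fun z => forall b, axis z b != 0).
Hypothesis vertices : forall m0 (p : bool -> R), m0 \in msupp f -> (forall b, 0 < p b) ->
  (forall m, m \in msupp f -> (exists b, expo b m != expo b m0) ->
     \sum_b p b * (expo b m0)%:R < \sum_b p b * (expo b m)%:R) ->
  (forall b, exists2 m, m \in msupp f & (expo b m < expo b m0)%N) ->
  nocrit (select (fun m => [forall b, expo b m == expo b m0]) f)
    (fun z => forall b, axis z b != 0).

Section Dominated.
Variables (F : set_system nat) (z : nat -> CC R * CC R) (om : nat -> C) (lam : nat -> R).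
Context {UF : UltraFilter F}.
Hypothesis z0 : forall i b, axis (z i) b != 0.
Hypothesis zP : forall i c, moduli (z i) (~~ c) ^+ P c c < moduli (z i) c ^+ P c (~~ c).
Hypothesis tang : forall i, tangent_at f (om i) (lam i) (z i).
Hypothesis zl : forall c, (fun i => moduli (z i) c) @ F --> (0 : R).
Variable ms : multinom 4.
Hypothesis msf : ms \in msupp f.
Hypothesis msmax : \forall i \near F, forall m, m \in msupp f ->
  wgt (moduli (z i)) m <= wgt (moduli (z i)) ms.

Let r0 i b : 0 < moduli (z i) b. Proof. by rewrite modulus_gt0. Qed.

Let w0 i m : 0 < wgt (moduli (z i)) m.
Proof. by rewrite mulr_gt0 ?exprn_gt0. Qed.

Let FF : Filter F := _.

Let nearI (A B : set nat) : F A -> F B -> F (A `&` B).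
Proof. exact: filterI. Qed.

Let near_lt (b : bool) (e : R) : 0 < e -> \forall i \near F, moduli (z i) b < e.
Proof.
move=> e0; have /cvgr0Pnorm_lt/(_ _ e0) := zl b; apply: filterS => i.
by rewrite gtr0_norm.
Qed.

(** A dominating vertex where the exponent of c is minimal would be mL c; but
    outside the cuspidal region at that end another monomial of the same 1-face is
    at least as large. *)
Let strict_vertex_not_extreme :
    (forall m, m \in msupp f -> (exists b, expo b m != expo b ms) ->
      \forall i \near F, wgt (moduli (z i)) m < wgt (moduli (z i)) ms) ->
  forall c, exists2 m, m \in msupp f & (expo c m < expo c ms)%N.
Proof.
move=> strict c; apply: contrapT => nex.
have ge m : m \in msupp f -> (expo c ms <= expo c m)%N.
  by move=> mf; rewrite leqNgt; apply/negP => lt; apply: nex; exists m.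
have eL : expo c (mL c) = expo c ms.
  by apply/eqP; rewrite eqn_leq mLmin// ge.
have eL' : (expo (~~ c) (mL c) <= expo (~~ c) ms)%N.
  have := allP (mLF c) ms msf; rewrite !(wdeg_split _ c) eL leq_add2l.
  by rewrite leq_pmul2l// P0.
have eLE : expo (~~ c) (mL c) = expo (~~ c) ms.
  apply/eqP; apply: contrapT => /negP ne.
  have : exists b, expo b (mL c) != expo b ms by exists (~~ c).
  move=> /(strict _ (mLf c)) st.
  have /filter_ex[i [/= si li]] := nearI st (near_lt (~~ c) ltr01).
  move: si; rewrite !(wgt_split _ c) eL ltr_pM2l ?exprn_gt0// ltNge => /negP; apply.
  by rewrite ler_wiXn2l// ltW.
have [m' [m'f m'F /eqP m'ne]] := mR c.
have ne : exists b, expo b m' != expo b ms by exists c; rewrite -eL.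
have /filter_ex[i si] := strict m' m'f ne.
have := allP m'F _ (mLf c); have := allP (mLF c) _ m'f => w1 w2.
have wE : wdeg (P c) (mL c) = wdeg (P c) m' by apply/eqP; rewrite eqn_leq w1.
rewrite !(wdeg_split _ c) eL eLE in wE.
have ltc : (expo c ms < expo c m')%N by rewrite ltn_neqAle ge// andbT -eL eq_sym.
have lt' : (expo (~~ c) m' < expo (~~ c) ms)%N.
  move: wE (P0 c c) (P0 c (~~ c)) ltc; move: (P c c) (P c (~~ c)) => p q wE p0 q0 ltc.
  rewrite -(ltn_pmul2l q0) -(ltn_add2l (p * expo c ms)) wE ltn_add2r.
  by rewrite ltn_pmul2l.
pose k := (expo c m' - expo c ms)%N; pose l := (expo (~~ c) ms - expo (~~ c) m')%N.
have kl : (P c c * k = P c (~~ c) * l)%N.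
  rewrite /k /l !mulnBr; move: wE; nia.
have k0 : (0 < k)%N by rewrite subn_gt0.
have EU : moduli (z i) c ^+ expo c m' = moduli (z i) c ^+ k * moduli (z i) c ^+ expo c ms.
  by rewrite -exprD subnK// ltnW.
have EV : moduli (z i) (~~ c) ^+ expo (~~ c) ms =
    moduli (z i) (~~ c) ^+ l * moduli (z i) (~~ c) ^+ expo (~~ c) m'.
  by rewrite -exprD subnK// ltnW.
move: si; rewrite !(wgt_split _ c) EU EV -mulrA [X in _ < X]mulrCA.
rewrite ltr_pM2r ?mulr_gt0 ?exprn_gt0// ltNge => /negP; apply.
rewrite -(@ler_pXn2r _ _ (P0 c (~~ c))) ?nnegrE ?exprn_ge0 ?(ltW (r0 _ _))//.
rewrite -!exprM (mulnC l) -kl (mulnC k) !exprM.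
by rewrite ler_pXn2r ?nnegrE ?exprn_ge0 ?(ltW (r0 _ _))// ltW.
Qed.

(** The monomial ms is the largest one along the ultrafilter. If all the others
    are negligible, ms is a vertex: the numbers - ln |z_b| form a weight for which it
    is the strict minimum. Otherwise some ratio m' / ms has a nonzero limit; the
    two exponents then span a 1-face, whose weight gives the rescaling. *)
Lemma dominated_contra : False.
Proof.
pose K m i := wgt (moduli (z i)) m / wgt (moduli (z i)) ms.
have r0' i b : 0 <= moduli (z i) b by exact: ltW.
have Kp m i : 0 < K m i by rewrite divr_gt0.
have K1 m : m \in msupp f -> \forall i \near F, `|K m i| <= 1.
  move=> mf; apply: filterS msmax => i /(_ m mf) H.
  by rewrite gtr0_norm// /K ler_pdivrMr// mul1r.
have [Kall|] := pselect (forall m, m \in msupp f -> (exists b, expo b m != expo b ms) ->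
    K m @ F --> (0 : R)).
  have strict m : m \in msupp f -> (exists b, expo b m != expo b ms) ->
      \forall i \near F, wgt (moduli (z i)) m < wgt (moduli (z i)) ms.
    move=> mf me; have /cvgr0Pnorm_lt/(_ _ ltr01) := Kall m mf me.
    by apply: filterS => i; rewrite gtr0_norm// /K ltr_pdivrMr// mul1r.
  have nex := strict_vertex_not_extreme strict.
  have [al0 [al0nz crit]] := vertex_limit tang msf z0 Kall.
  have strictS : \forall i \near F, forall m, m \in msupp f ->
      (exists b, expo b m != expo b ms) -> wgt (moduli (z i)) m < wgt (moduli (z i)) ms.
    apply: near_seq => m mf; have [me|me] := pselect (exists b, expo b m != expo b ms).
      by apply: filterS (strict m mf me) => i.
    exact: nearW.
  have /filter_ex[i [/= [li1 li2] si]] :=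
    nearI (nearI (near_lt false ltr01) (near_lt true ltr01)) strictS.
  have lib b : moduli (z i) b < 1 by case: b.
  apply: (vertices (p := fun b => - ln (moduli (z i) b)) msf _ _ nex al0nz crit).
    by move=> b; rewrite oppr_gt0 ln_lt0// r0 lib.
  have lnw m : \sum_b - ln (moduli (z i) b) * (expo b m)%:R = - ln (wgt (moduli (z i)) m).
    rewrite big_bool /wgt lnM ?posrE ?exprn_gt0// !lnXn//.
    rewrite -[ln _ *+ expo false m]mulr_natr -[ln _ *+ expo true m]mulr_natr. by rewrite /=; ring.
  move=> m mf me; rewrite !lnw ltrN2 ltr_ln ?posrE//; exact: si.
move=> /existsNP[m' /not_implyP[m'f /not_implyP[[b0 b0ne] nK]]].
have [r Kr] := ultra_bounded_cvg (K1 m' m'f).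
have rN0 : r != 0 by apply/eqP => rE; apply: nK; rewrite -rE.
have m'ms : forall i, K m' i = wgt (moduli (z i)) m' / wgt (moduli (z i)) ms by [].
(* The exponents of m' and ms differ in opposite directions: otherwise the
   ratio would tend to 0 or exceed 1. *)
have notge : ~ forall b, (expo b ms <= expo b m')%N.
  move=> ge; apply: nK.
  have lt0 : (expo b0 ms < expo b0 m')%N by rewrite ltn_neqAle ge eq_sym b0ne.
  apply: (@squeeze_cvgr _ _ _ _ (fun=> 0) (fun i => moduli (z i) b0)); [|exact: cvg_cst|exact: zl].
  have := nearI (near_lt false ltr01) (near_lt true ltr01); apply: filterS => i /= [l1 l2].
  have lib b : moduli (z i) b <= 1 by case: b; exact: ltW.
  rewrite (ltW (Kp m' i))/= /K ler_pdivrMr//.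
  rewrite !(wgt_split _ b0) mulrA -exprS; apply: ler_pM; rewrite ?exprn_ge0//.
    by rewrite ler_wiXn2l.
  by rewrite ler_wiXn2l.
have notle : ~ forall b, (expo b m' <= expo b ms)%N.
  move=> le; have lt0 : (expo b0 m' < expo b0 ms)%N by rewrite ltn_neqAle le b0ne.
  have /filter_ex[i [/= [l1 l2] mi]] :=
    nearI (nearI (near_lt false ltr01) (near_lt true ltr01)) msmax.
  have lib b : moduli (z i) b < 1 by case: b.
  have := mi m' m'f; rewrite leNgt => /negP; apply.
  rewrite !(wgt_split _ b0).
  apply: (@lt_le_trans _ _ (moduli (z i) b0 ^+ expo b0 m' * moduli (z i) (~~ b0) ^+ expo (~~ b0) ms)).
    by rewrite ltr_pM2r ?exprn_gt0// ltr_iXn2l ?lib.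
  by rewrite ler_pM2l ?exprn_gt0// ler_wiXn2l// ltW.
have [c [cgt clt]] : exists c, (expo c ms < expo c m')%N /\ (expo (~~ c) m' < expo (~~ c) ms)%N.
  have /existsNP[b1 /negP] := notge; rewrite -ltnNge => h1.
  have /existsNP[b2 /negP] := notle; rewrite -ltnNge => h2.
  exists b2; split => //; suff -> : ~~ b2 = b1 by [].
  move: h1 h2; case: b1 b2 => [] [] //= h1 h2;
    by have := ltn_trans h1 h2; rewrite ltnn.
(* The normal direction of the segment from ms to m'. *)
pose Q b := if b == c then (expo (~~ c) ms - expo (~~ c) m')%N else (expo c m' - expo c ms)%N.
have Qc : Q c = (expo (~~ c) ms - expo (~~ c) m')%N by rewrite /Q eqxx.
have Qnc : Q (~~ c) = (expo c m' - expo c ms)%N by rewrite /Q; case: (c).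
have Q0 b : (0 < Q b)%N by rewrite /Q; case: ifP => _; rewrite subn_gt0.
have ratio i : moduli (z i) c ^+ Q (~~ c) / moduli (z i) (~~ c) ^+ Q c = K m' i.
  rewrite /K !(wgt_split _ c) Qc Qnc.
  rewrite -[X in _ = _ ^+ X * _ / _](subnK (ltnW cgt)) -[X in _ = _ / (_ * _ ^+ X)](subnK (ltnW clt)).
  by rewrite !exprD; field; rewrite !expf_neq0// gt_eqF.
have ratioM : \forall i \near F, moduli (z i) c ^+ Q (~~ c) / moduli (z i) (~~ c) ^+ Q c <= 1.
  by apply: filterS (K1 m' m'f) => i; rewrite ratio; apply: le_trans; exact: ler_norm.
have QE : wdeg Q ms = wdeg Q m'.
  by rewrite !(wdeg_split _ c) Qc Qnc; move: cgt clt; nia.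
have r_gt0 : 0 < r.
  rewrite lt_def rN0; apply: (cvgr_to_ge Kr); near=> i.
  exact: ltW.
(* A monomial of smaller Q-degree would be larger than ms. *)
have Qmin m : m \in msupp f -> (wdeg Q ms <= wdeg Q m)%N.
  move=> mf; rewrite leqNgt; apply/negP => wlt.
  have low : \forall i \near F, r / 2 < K m' i.
    by apply: (cvgr_gt r) => //; rewrite ltr_pdivrMr// ltr_pMr// ltr1n.
  have small : \forall i \near F, moduli (z i) (~~ c) < (r / 2) ^+ expo c m.
    by apply: near_lt; rewrite exprn_gt0// divr_gt0.
  have /filter_ex[i [/= [[lo sm] [l1 l2]] [up mi]]] :=
    nearI (nearI (nearI low small) (nearI (near_lt false ltr01) (near_lt true ltr01)))
      (nearI (K1 m' m'f) msmax).
  have lib b : moduli (z i) b < 1 by case: b.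
  pose y := moduli (z i) (~~ c); rewrite -/y in sm.
  have y0 : 0 < y by exact: r0.
  pose k := K m' i; rewrite -/k in lo up.
  have k0 : 0 < k by exact: Kp.
  have kle : k <= 1 by rewrite (le_trans (ler_norm _)).
  have xk : moduli (z i) c ^+ Q (~~ c) = k * y ^+ Q c.
    by rewrite /k -ratio divfK// gt_eqF// exprn_gt0.
  have wk m1 : wgt (moduli (z i)) m1 ^+ Q (~~ c) = k ^+ expo c m1 * y ^+ wdeg Q m1.
    rewrite (wgt_split _ c) exprMn -!exprM mulnC exprM xk exprMn -exprM.
    by rewrite -mulrA -exprD (wdeg_split Q c) (mulnC (expo (~~ c) m1)).
  have : wgt (moduli (z i)) m ^+ Q (~~ c) <= wgt (moduli (z i)) ms ^+ Q (~~ c).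
    by rewrite ler_pXn2r ?nnegrE ?(ltW (w0 _ _))// mi.
  rewrite leNgt => /negP; apply; rewrite !wk.
  apply: (@le_lt_trans _ _ (y * y ^+ wdeg Q m)).
    rewrite -exprS -[leRHS]mul1r ler_pM ?exprn_ge0 ?(ltW k0) ?(ltW y0)//.
      by rewrite exprn_ile1// ltW.
    by rewrite ler_wiXn2l// ltW// lib.
  rewrite ltr_pM2r ?exprn_gt0// (lt_le_trans sm)//.
  by rewrite lerXn2r ?nnegrE ?divr_ge0 ?(ltW r_gt0) ?(ltW k0)// ltW.
have [|al0 [al1 al0r crit _]] := weighted_limit tang Q0 _ Qmin (fun i => z0 i (~~ c)) (zl (~~ c)) ratioM.
  by exists ms.
have al0c : axis al0 c != 0.
  rewrite -modulus_eq0 -/(moduli _ _); apply: contra_neq rN0 => a0.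
  have -> : r = moduli al0 c ^+ Q (~~ c).
    apply: (cvg_unique (@Rhausdorff R) Kr).
    by move: al0r; under eq_fun do rewrite ratio.
  by rewrite a0 expr0n; case: (Q (~~ c)) (Q0 (~~ c)).
apply: (faces Q0 _ _ (crit al0c)).
  have msF : on_face Q f ms by apply/allP => m mf; exact: Qmin.
  exists ms, m'; split => //; first by apply/allP => m mf; rewrite -QE Qmin.
  by exists c => e; rewrite e ltnn in cgt.
move=> b; have [->|->] := eq_or_negb b c.
  by [].
by rewrite -modulus_eq0 -/(moduli _ _) al1 oner_eq0.
Unshelve. all: by end_near. Qed.

End Dominated.

Lemma middle_region : exists2 rho : R, 0 < rho & forall z om lam,
  (forall b, axis z b != 0) /\
  (forall c, moduli z (~~ c) ^+ P c c < moduli z c ^+ P c (~~ c)) ->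
  (forall b, moduli z b <= rho) -> ~ tangent_at f om lam z.
Proof.
apply: tangency_accumulation => F UF z om lam zQ tang zl.
have [ms msf msmax] := ultra_max (F := F) (fun m i => wgt (moduli (z i)) m) f0.
apply: (dominated_contra _ _ tang zl msf msmax).
- by move=> i b; have [] := zQ i.
- by move=> i c; have [] := zQ i.
Qed.

End Middle.
End Coverage.

(** * Newton polyhedra and strong inner non-degeneracy *)

Section NewtonPolyhedron.
Variable R : realType.
Local Notation C := (complex R).
Implicit Types (f g : mixed_poly R) (m : multinom 4) (x y : R * R) (p q : R).

Lemma convex_pairP (A : set (R * R)) : convex_set A <->
  forall x y (k : R), 0 <= k <= 1 -> A x -> A y ->
    A (k * x.1 + (1 - k) * y.1, k * x.2 + (1 - k) * y.2).
Proof.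
split=> [cA x y k k01 Ax Ay|H x y k /set_mem Ax /set_mem Ay].
  have /andP[k0 k1] := k01.
  have := cA x y (Itv01 k0 k1) (mem_set Ax) (mem_set Ay).
  by move=> /set_mem.
by apply/mem_set; have := H x y k%:num; rewrite ge0 le1 => /(_ isT Ax Ay).
Qed.

Definition lin p q x : R := p * x.1 + q * x.2.

Lemma polyhedron_sub f (A : set (R * R)) : convex_set A ->
  (forall m y, m \in msupp f -> 0 <= y.1 -> 0 <= y.2 -> A (exp_point R m + y)) ->
  newton_polyhedron f `<=` A.
Proof.
move=> cA H; apply: smallest_sub => // x [m /= mf [y [y1 y2] <-]].
exact: H.
Qed.

Lemma polyhedron_gen f m y : m \in msupp f -> 0 <= y.1 -> 0 <= y.2 ->
  newton_polyhedron f (exp_point R m + y).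
Proof.
move=> mf y1 y2; apply: sub_gen_smallest; exists m => //; exists y => //.
Qed.

Lemma polyhedron_mono f m : m \in msupp f -> newton_polyhedron f (exp_point R m).
Proof. by move=> mf; rewrite -[exp_point R m]addr0; exact: polyhedron_gen. Qed.

Lemma polyhedron_convex f : convex_set (newton_polyhedron f).
Proof.
apply/convex_pairP => x y k k01 Kx Ky A [/= cA gA].
exact: (convex_pairP A).1 cA _ _ _ k01 (Kx A (conj cA gA)) (Ky A (conj cA gA)).
Qed.

Lemma polyhedron_up f x y : newton_polyhedron f x -> 0 <= y.1 -> 0 <= y.2 ->
  newton_polyhedron f (x + y).
Proof.
move=> Kx; suff H : newton_polyhedron f `<=` [set x | forall y, 0 <= y.1 -> 0 <= y.2 ->
    newton_polyhedron f (x + y)] by exact: H.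
apply: polyhedron_sub; last first.
  move=> m y1 mf y10 y11 y2 y20 y21; rewrite -addrA.
  by apply: polyhedron_gen => //=; rewrite addr_ge0.
apply/convex_pairP => {Kx}x {}y k k01 Hx Hy w w1 w2.
have := (convex_pairP _).1 (@polyhedron_convex f) _ _ _ k01 (Hx w w1 w2) (Hy w w1 w2).
congr (newton_polyhedron f _); rewrite [RHS]surjective_pairing /=; congr pair; ring.
Qed.

Section PositiveWeight.
Variables (f : mixed_poly R) (p q mu : R) (mL mR : multinom 4).
Hypotheses (p0 : 0 < p) (q0 : 0 < q).
Hypotheses (mLf : mL \in msupp f) (mRf : mR \in msupp f).
Hypothesis mLmu : lin p q (exp_point R mL) = mu.
Hypothesis mRmu : lin p q (exp_point R mR) = mu.
Hypothesis mumin : forall m, m \in msupp f -> mu <= lin p q (exp_point R m).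
Hypothesis mLR : forall m, m \in msupp f -> lin p q (exp_point R m) = mu ->
  (exp_point R mL).1 <= (exp_point R m).1 <= (exp_point R mR).1.

Definition segment : set (R * R) :=
  [set x | lin p q x = mu /\ (exp_point R mL).1 <= x.1 <= (exp_point R mR).1].

(** An open half-plane together with a segment of its boundary line is convex;
    this one contains the generators of the polyhedron. *)
Lemma polyhedron_weight : newton_polyhedron f `<=` [set x | mu < lin p q x \/ segment x].
Proof.
apply: polyhedron_sub => [|m y mf y1 y2].
  apply/convex_pairP => x y k /andP[k0 k1] Hx Hy.
  have linE : lin p q (k * x.1 + (1 - k) * y.1, k * x.2 + (1 - k) * y.2) =
    k * lin p q x + (1 - k) * lin p q y by rewrite /lin/=; ring.
  have k1' : 0 <= 1 - k by rewrite subr_ge0.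
  have xmu : mu <= lin p q x by case: Hx => [/ltW//|[->]].
  have ymu : mu <= lin p q y by case: Hy => [/ltW//|[->]].
  have muE : mu = k * mu + (1 - k) * mu by ring.
  have [k00|kN0] := eqVneq k 0.
    rewrite k00 subr0 !mul0r !mul1r !add0r -surjective_pairing; exact: Hy.
  have [k11|kN1] := eqVneq k 1.
    rewrite k11 subrr !mul0r !mul1r !addr0 -surjective_pairing; exact: Hx.
  have kp : 0 < k by rewrite lt_def kN0.
  have kp1 : 0 < 1 - k by rewrite lt_def k1' andbT subr_eq0 eq_sym.
  case: Hx => [ltx|[lx /andP[x1 x2]]].
    left; rewrite /= linE [X in X < _]muE ltr_leD// ?ltr_pM2l//.
    by rewrite ler_wpM2l.
  case: Hy => [lty|[ly /andP[y1 y2]]].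
    left; rewrite /= linE [X in X < _]muE ler_ltD// ?ltr_pM2l//.
    by rewrite ler_wpM2l.
  right; split; first by rewrite linE lx ly -muE.
  set aL := (exp_point R mL).1 in x1 y1 *; set aR := (exp_point R mR).1 in x2 y2 *.
  have aLE : aL = k * aL + (1 - k) * aL by ring.
  have aRE : aR = k * aR + (1 - k) * aR by ring.
  by apply/andP; split; [rewrite aLE|rewrite aRE]; rewrite lerD// ler_wpM2l.
have linE : lin p q (exp_point R m + y) = lin p q (exp_point R m) + lin p q y.
  by rewrite /lin /=; ring.
have ly : 0 <= lin p q y by rewrite addr_ge0// mulr_ge0// ltW.
have [lt|] := ltP mu (lin p q (exp_point R m + y)); first by left.
rewrite linE => le; right.
have my : lin p q (exp_point R m) = mu.
  by apply/eqP; rewrite eq_le mumin// andbT (le_trans _ le)// lerDl.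
have y0 : y = 0.
  have : lin p q y = 0 by apply/eqP; rewrite eq_le ly andbT -(lerD2l mu) addr0 -{1}my.
  rewrite /lin => /eqP; rewrite paddr_eq0 ?mulr_ge0 ?(ltW p0) ?(ltW q0)//.
  rewrite !mulf_eq0 (gt_eqF p0) (gt_eqF q0)/= => /andP[/eqP e1 /eqP e2].
  by rewrite [y]surjective_pairing e1 e2.
by rewrite y0 addr0; split => //; exact: mLR.
Qed.

Lemma face_positive x : (newton_polyhedron f x /\
    forall y, newton_polyhedron f y -> lin p q x <= lin p q y) <-> segment x.
Proof.
have KL := polyhedron_mono mLf; have KR := polyhedron_mono mRf.
split=> [[Kx xmin]|[lx /andP[x1 x2]]].
  case: (polyhedron_weight Kx) => // lt; have := xmin _ KL.
  by rewrite mLmu leNgt lt.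
split; last first.
  by move=> y /polyhedron_weight[/ltW|[ly _]]; rewrite lx ?ly.
have := mLmu; have := mRmu; move: KL KR x1 x2.
set eL := exp_point R mL; set eR := exp_point R mR => KL KR x1 x2 eRmu eLmu.
have snd (w w' : R * R) : lin p q w = lin p q w' -> w.1 = w'.1 -> w = w'.
  rewrite /lin => lw w1; rewrite [w]surjective_pairing [w']surjective_pairing w1.
  by congr pair; apply: (mulfI (lt0r_neq0 q0)); apply: (addrI (p * w.1)); rewrite lw w1.
have [aE|aN] := eqVneq eL.1 eR.1.
  suff -> : x = eL by [].
  by apply: snd; rewrite ?lx//; apply/eqP; rewrite eq_le x1 andbT aE.
have aLR : 0 < eR.1 - eL.1 by rewrite subr_gt0 lt_neqAle aN (le_trans x1 x2).
pose k := (eR.1 - x.1) / (eR.1 - eL.1).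
have k01 : 0 <= k <= 1.
  apply/andP; split; first by apply: divr_ge0; [rewrite subr_ge0|exact: ltW].
  by rewrite /k ler_pdivrMr// mul1r lerD2l lerN2.
have k1 : k * eL.1 + (1 - k) * eR.1 = x.1 by rewrite /k; field; rewrite gt_eqF.
have -> : x = (k * eL.1 + (1 - k) * eR.1, k * eL.2 + (1 - k) * eR.2).
  apply: snd => //=; rewrite lx.
  have -> : lin p q (k * eL.1 + (1 - k) * eR.1, k * eL.2 + (1 - k) * eR.2) =
    k * lin p q eL + (1 - k) * lin p q eR by rewrite /lin/=; ring.
  by rewrite eLmu eRmu; ring.
exact: (convex_pairP _).1 (@polyhedron_convex f) _ _ _ k01 KL KR.
Qed.

Lemma segment_face : compact_face f segment.
Proof.
split.
  split; first by exists (exp_point R mL); split => //; rewrite lexx /=; have /andP[] := mLR mLf mLmu.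
  by exists p, q; apply/seteqP; split => x /face_positive.
have -> : segment = (fun a => (a, (mu - p * a) / q)) @` `[(exp_point R mL).1, (exp_point R mR).1].
  apply/seteqP; split=> [x [lx x12]|_ [a aLR <-]].
    exists x.1; first by rewrite /= in_itv.
    rewrite [RHS]surjective_pairing -lx /lin; congr pair.
    by field; rewrite gt_eqF.
  split; last by move: aLR; rewrite /= in_itv.
  by rewrite /lin /=; field; rewrite gt_eqF.
apply: continuous_compact; last exact: segment_compact.
apply: continuous_subspaceT => a; have gc : (mu - p * t) / q @[t --> a] --> (mu - p * a) / q.
  apply: cvgM; last exact: cvg_cst.
  apply: cvgB; first exact: cvg_cst.
  by apply: cvgM; [exact: cvg_cst|exact: cvg_id].
exact: (cvg_pair (@cvg_id _ (nbhs a)) gc).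
Qed.

End PositiveWeight.

Lemma seq_argmin (T : eqType) (s : seq T) (g : T -> R) : s != [::] ->
  exists2 k, k \in s & forall j, j \in s -> g k <= g j.
Proof.
case: s => // a s _; elim: s a => [|b s IH] a.
  by exists a => [|j]; rewrite inE // => /eqP ->.
have [k ks kmin] := IH b; have [ak|ka] := leP (g a) (g k).
  exists a => [|j]; first exact: mem_head.
  by rewrite in_cons => /predU1P[->//|/kmin]; exact: le_trans.
exists k => [|j]; first by rewrite in_cons ks orbT.
by rewrite in_cons => /predU1P[->|/kmin//]; exact: ltW.
Qed.

Lemma positive_face f p q : f != 0 -> 0 < p -> 0 < q ->
  exists mu mL mR, [/\ mL \in msupp f, mR \in msupp f,
    lin p q (exp_point R mL) = mu /\ lin p q (exp_point R mR) = mu,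
    forall m, m \in msupp f -> mu <= lin p q (exp_point R m) &
    forall m, m \in msupp f -> lin p q (exp_point R m) = mu ->
      (exp_point R mL).1 <= (exp_point R m).1 <= (exp_point R mR).1].
Proof.
move=> f0 p0 q0; have s0 : msupp f != [::] by rewrite msupp_eq0.
have [m0 m0f m0min] := seq_argmin (fun m => lin p q (exp_point R m)) s0.
pose s := [seq m <- msupp f | lin p q (exp_point R m) == lin p q (exp_point R m0)].
have ss : s != [::].
  have : m0 \in s by rewrite mem_filter eqxx.
  by apply: contraTneq => ->.
have [mL + mLmin] := seq_argmin (fun m => (exp_point R m).1) ss.
have [mR + mRmax] := seq_argmin (fun m => - (exp_point R m).1) ss.
rewrite !mem_filter => /andP[/eqP mR0 mRf] /andP[/eqP mL0 mLf].
exists (lin p q (exp_point R m0)), mL, mR; split => // m mf mE.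
have ms : m \in s by rewrite mem_filter mE eqxx.
by rewrite mLmin//= -lerN2 mRmax.
Qed.

(** The polyhedron is stable under translation by the quadrant, so a linear form
    with a nonpositive coefficient has an unbounded face. *)
Lemma face_weight_positive f (F : set (R * R)) a b : F !=set0 -> compact F ->
  F = [set x | newton_polyhedron f x /\
     forall y, newton_polyhedron f y -> lin a b x <= lin a b y] -> 0 < a /\ 0 < b.
Proof.
move=> [x0 Fx0] /compact_bounded[M [_ Mb]] FE.
have /= bnd x : F x -> `|x| <= `|M| + 1.
  by move=> Fx; apply: (Mb (`|M| + 1) _ x Fx); rewrite (le_lt_trans (ler_norm M))// ltrDl.
have := Fx0; rewrite FE => -[Kx0 x0min].
have bnd1 x : F x -> `|x.1| <= `|M| + 1.
  by move=> /bnd; apply: le_trans; rewrite /Num.norm/= le_max lexx.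
have bnd2 x : F x -> `|x.2| <= `|M| + 1.
  by move=> /bnd; apply: le_trans; rewrite /Num.norm/= le_max lexx orbT.
pose s := `|M| + 2 + `|x0.1| + `|x0.2|.
have s0 : 0 <= s by rewrite !addr_ge0.
split.
  have K1 : newton_polyhedron f (x0 + (s, 0)) by exact: polyhedron_up.
  rewrite ltNge; apply/negP => a0.
  have F1 : F (x0 + (s, 0)).
    rewrite FE; split => // y /x0min; apply: le_trans.
    by rewrite /lin/= addr0 mulrDr lerD2r gerDl mulr_le0_ge0.
  have := bnd1 _ F1; rewrite /= leNgt => /negP; apply.
  have := ler_norm (- (x0.1)); have := ler_norm (x0.1 + s); rewrite normrN /s.
  have := normr_ge0 x0.2; lra.
have K2 : newton_polyhedron f (x0 + (0, s)) by exact: polyhedron_up.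
rewrite ltNge; apply/negP => b0.
have F2 : F (x0 + (0, s)).
  rewrite FE; split => // y /x0min; apply: le_trans.
  by rewrite /lin/= addr0 mulrDr lerD2l gerDl mulr_le0_ge0.
have := bnd2 _ F2; rewrite /= leNgt => /negP; apply.
have := ler_norm (- (x0.2)); have := ler_norm (x0.2 + s); rewrite normrN /s.
have := normr_ge0 x0.1; lra.
Qed.

Lemma exp_point_eq m m' : exp_point R m = exp_point R m' <->
  forall b, expo b m = expo b m'.
Proof.
split=> [[/eqP e1 /eqP e2] b|e].
  by move: e1 e2; rewrite !eqr_nat => /eqP e1 /eqP e2; case: b.
by rewrite /exp_point /total_exp; congr pair => /=; congr (_%:R); [exact: e false|exact: e true].
Qed.

(** Both end points of a 1-face are exponents of f. *)
Lemma one_face_two_exponents f (F : set (R * R)) : f != 0 -> one_face f F ->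
  exists m1 m2, [/\ m1 \in msupp f, m2 \in msupp f, F (exp_point R m1),
    F (exp_point R m2) & exists b, expo b m1 <> expo b m2].
Proof.
move=> f0 [[[F0 [a [b FE]]] Fc] [x [y [Fx Fy xy]]]].
have [a0 b0] := face_weight_positive F0 Fc FE.
have [mu [mL [mR [mLf mRf [mLmu mRmu] mumin mLR]]]] := positive_face f0 a0 b0.
have FP := face_positive a0 b0 mLf mRf mLmu mRmu mumin mLR.
have FS w : F w <-> segment a b mu mL mR w by rewrite FE; exact: FP.
have LR : (exp_point R mL).1 <= (exp_point R mR).1 by have /andP[] := mLR mL mLf mLmu.
exists mL, mR; split => //.
- by apply/FS; split => //; rewrite lexx.
- by apply/FS; split => //; rewrite lexx andbT.
apply: contrapT => noe; apply: xy.
have eLR : exp_point R mL = exp_point R mR.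
  by apply/exp_point_eq => c; apply: contrapT => ne; apply: noe; exists c.
have /FS[lx /andP[x1 x2]] := Fx; have /FS[ly /andP[y1 y2]] := Fy.
have xE : x.1 = (exp_point R mL).1 by apply/eqP; rewrite eq_le x1 andbT eLR.
have yE : y.1 = (exp_point R mL).1 by apply/eqP; rewrite eq_le y1 andbT eLR.
rewrite [x]surjective_pairing [y]surjective_pairing xE yE; congr pair.
apply: (mulfI (lt0r_neq0 b0)); apply: (addrI (a * x.1)).
by move: lx ly; rewrite /lin xE yE => -> ->.
Qed.

Lemma mcoeff_select (D : pred (multinom 4)) f m :
  mcoeff m (select D f) = if D m then mcoeff m f else 0.
Proof.
rewrite /select raddf_sum /=.
have [mf|mf] := boolP (m \in msupp f); last first.
  rewrite (memN_msupp_eq0 mf) if_same big_seq_cond big1// => k /andP[kf _].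
  rewrite /monomial_of mcoeffZ mcoeffX; case: eqP => [km|]; last by rewrite mulr0.
  by rewrite -km kf in mf.
rewrite big_mkcond (bigD1_seq m)//= ?msupp_uniq// big1 ?addr0 => [|k km].
  by case: (D m) => //; rewrite /monomial_of mcoeffZ mcoeffX eqxx mulr1.
case: (D k) => //; rewrite /monomial_of mcoeffZ mcoeffX.
by rewrite (negPf km) mulr0.
Qed.

Lemma select_inj (D D' : pred (multinom 4)) f : select D f = select D' f ->
  {in msupp f, D =1 D'}.
Proof.
move=> DD m mf; have := congr1 (mcoeff m) DD; rewrite !mcoeff_select.
have nz : mcoeff m f != 0 by rewrite -mcoeff_msupp.
case: (D m) (D' m) => [] [] // /eqP; rewrite ?(negPf nz)//.
by rewrite eq_sym (negPf nz).
Qed.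

Definition weight_of (P : nat * nat) (b : bool) : nat := if b then P.2 else P.1.

Lemma radial_wdeg P m : radial_degree P m = wdeg (weight_of P) m.
Proof. by []. Qed.

Lemma bigminn_attained (T : eqType) (s : seq T) (g : T -> nat) k : k \in s ->
  (forall j, j \in s -> \big[minn/g k]_(i <- s) g i <= g j)%N /\
  exists2 j, j \in s & g j = \big[minn/g k]_(i <- s) g i.
Proof.
move=> ks; split=> [j|].
  elim: s {ks} => // a s IH; rewrite in_cons big_cons => /predU1P[->|js].
    exact: geq_minl.
  by rewrite (leq_trans (geq_minr _ _))// IH.
suff : \big[minn/g k]_(i <- s) g i = g k \/ exists2 j, j \in s & g j = \big[minn/g k]_(i <- s) g i.
  by case=> [->|//]; exists k.
elim: s {ks} => [|a s [IH|[j js IH]]]; first by left; rewrite big_nil.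
- rewrite big_cons IH; case: (leqP (g a) (g k)) => _; last by left.
  by right; exists a; rewrite ?mem_head.
- rewrite big_cons -IH; right; case: (leqP (g a) (g j)) => _.
    by exists a; rewrite ?mem_head.
  by exists j; rewrite ?in_cons ?js ?orbT.
Qed.

Lemma face_functionE P f : f != 0 ->
  face_function P f = select (on_face (weight_of P) f) f.
Proof.
move=> f0; apply: select_ext => m mf; rewrite radial_wdeg.
have [le ex] := bigminn_attained (radial_degree P) (mlead_supp f0).
rewrite -/(min_radial_degree P f) in le ex.
apply/eqP/allP => [-> m' m'f|H]; first by rewrite -radial_wdeg le.
have [m' m'f m'E] := ex; apply/eqP; rewrite eqn_leq le// andbT -m'E.
by rewrite !radial_wdeg H.
Qed.

End NewtonPolyhedron.

Section SindConsequences.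
Variable R : realType.
Local Notation C := (complex R).
Implicit Types (f g : mixed_poly R) (m : multinom 4) (c : bool).

Definition lwdeg (p : bool -> R) m : R := p false * (expo false m)%:R + p true * (expo true m)%:R.

Lemma lwdeg_split p c m : lwdeg p m = p c * (expo c m)%:R + p (~~ c) * (expo (~~ c) m)%:R.
Proof. by rewrite /lwdeg; case: c => //=; exact: addrC. Qed.

Lemma lin_exp_point p m : lin (p false) (p true) (exp_point R m) = lwdeg p m.
Proof. by []. Qed.

Lemma lwdeg_nat (Q : bool -> nat) m : lwdeg (fun b => (Q b)%:R) m = (wdeg Q m)%:R.
Proof. by rewrite /wdeg natrD !natrM. Qed.

Lemma line_direction (a b x x' y y' : nat) : (x' < x)%N -> (y < y')%N ->
  (a * x' + b * y' = a * x + b * y)%N -> (a * (x - x') = b * (y' - y))%N.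
Proof.
move=> /ltnW/(leq_mul (leqnn a)) xx /ltnW/(leq_mul (leqnn b)) yy.
rewrite !mulnBr; lia.
Qed.

(** The neighbouring 1-face at an end point m0 of a face: among the monomials
    beyond m0, take the one seen from m0 under the smallest slope. *)
Lemma side_face f c (p : bool -> R) m0 : (forall b, 0 < p b) ->
    m0 \in msupp f ->
    (forall m, m \in msupp f -> lwdeg p m0 <= lwdeg p m) ->
    (forall m, m \in msupp f -> (expo c m < expo c m0)%N -> lwdeg p m0 < lwdeg p m) ->
    (exists2 m, m \in msupp f & (expo c m < expo c m0)%N) ->
  exists m' (Q : bool -> nat), [/\ m' \in msupp f, forall b, (0 < Q b)%N,
    on_face Q f m0 /\ on_face Q f m',
    (expo c m' < expo c m0)%N /\ (Q c = expo (~~ c) m' - expo (~~ c) m0)%N &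
    (Q (~~ c) = expo c m0 - expo c m')%N /\ p c * (Q (~~ c))%:R < p (~~ c) * (Q c)%:R].
Proof.
move=> p0 m0f m0min strict [m1 m1f m1lt].
pose a m : R := (expo c m)%:R; pose b m : R := (expo (~~ c) m)%:R.
have lE m : lwdeg p m = p c * a m + p (~~ c) * b m by exact: lwdeg_split.
pose s := [seq m <- msupp f | (expo c m < expo c m0)%N].
have s0 : s != [::].
  have : m1 \in s by rewrite mem_filter m1lt.
  by apply: contraTneq => ->.
have [m' + m'min] := seq_argmin (fun m => (b m - b m0) / (a m0 - a m)) s0.
rewrite mem_filter => /andP[m'lt m'f].
have pc := p0 c; have pc' := p0 (~~ c).
have a_lt m : (expo c m < expo c m0)%N -> 0 < a m0 - a m.
  by move=> lt; rewrite subr_gt0 ltr_nat.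
have slope m : m \in msupp f -> (expo c m < expo c m0)%N ->
    p c * (a m0 - a m) < p (~~ c) * (b m - b m0).
  by move=> mf lt; have := strict m mf lt; rewrite !lE; lra.
have sl' := slope m' m'f m'lt; have al' := a_lt m' m'lt.
have bl' : 0 < b m' - b m0.
  by rewrite -(pmulr_rgt0 _ pc') (lt_trans _ sl')// mulr_gt0.
have b'nat : (expo (~~ c) m0 < expo (~~ c) m')%N by move: bl'; rewrite subr_gt0 ltr_nat.
pose Q d := if d == c then (expo (~~ c) m' - expo (~~ c) m0)%N else (expo c m0 - expo c m')%N.
have Qc : Q c = (expo (~~ c) m' - expo (~~ c) m0)%N by rewrite /Q eqxx.
have Qnc : Q (~~ c) = (expo c m0 - expo c m')%N by rewrite /Q; case: (c).
have QcR : (Q c)%:R = b m' - b m0 by rewrite Qc natrB// ltnW.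
have QncR : (Q (~~ c))%:R = a m0 - a m' by rewrite Qnc natrB// ltnW.
have Q0 d : (0 < Q d)%N by rewrite /Q; case: ifP => _; rewrite subn_gt0.
have wR m : (wdeg Q m)%:R = (b m' - b m0) * a m + (a m0 - a m') * b m.
  by rewrite (wdeg_split Q c) natrD !natrM QcR QncR.
have min0 m : m \in msupp f -> (wdeg Q m0 <= wdeg Q m)%N.
  move=> mf; rewrite -(ler_nat R) !wR.
  suff : 0 <= (b m' - b m0) * (a m - a m0) + (a m0 - a m') * (b m - b m0) by lra.
  have [lt|ge] := ltnP (expo c m) (expo c m0).
    have ms : m \in s by rewrite mem_filter lt.
    have := m'min m ms; have am := a_lt m lt.
    rewrite ler_pdivrMr// mulrAC ler_pdivlMr// => H.
    by clear -H; lra.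
  have age : 0 <= a m - a m0 by rewrite subr_ge0 ler_nat.
  have [bge|blt] := leP 0 (b m - b m0).
    by rewrite addr_ge0// mulr_ge0// ltW.
  have := m0min m mf; rewrite !lE => le.
  have H1 : p (~~ c) * (b m0 - b m) <= p c * (a m - a m0) by lra.
  rewrite -(pmulr_rge0 _ pc).
  have H2 : (b m' - b m0) * (p (~~ c) * (b m0 - b m)) <= (b m' - b m0) * (p c * (a m - a m0)).
    by rewrite ler_wpM2l// ltW.
  have H3 : (b m0 - b m) * (p c * (a m0 - a m')) <= (b m0 - b m) * (p (~~ c) * (b m' - b m0)).
    by rewrite ler_wpM2l ?(ltW sl')//; lra.
  move: H2 H3; rewrite (mulrC (b m0 - b m)) => H2 H3.
  have -> : p c * ((b m' - b m0) * (a m - a m0) + (a m0 - a m') * (b m - b m0)) =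
    (b m' - b m0) * (p c * (a m - a m0)) - p c * (a m0 - a m') * (b m0 - b m) by ring.
  rewrite subr_ge0 (le_trans H3)// (le_trans _ H2)//.
  by rewrite le_eqVlt; apply/orP; left; apply/eqP; ring.
have wE : wdeg Q m' = wdeg Q m0.
  by apply/eqP; rewrite -(eqr_nat R) !wR; apply/eqP; ring.
exists m', Q; split => //.
- split; first by apply/allP => m mf; exact: min0.
  by apply/allP => m mf; rewrite wE min0.
- by split => //; rewrite QcR QncR.
Qed.

Lemma weight_one_face f (Q : bool -> nat) m1 m2 : f != 0 -> (forall b, (0 < Q b)%N) ->
  m1 \in msupp f -> m2 \in msupp f -> on_face Q f m1 -> on_face Q f m2 ->
  (exists b, expo b m1 <> expo b m2) ->
  exists2 F, one_face f F & (forall m, m \in msupp f -> on_face Q f m <-> F (exp_point R m)).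
Proof.
move=> f0 Q0 m1f m2f m1F m2F m12.
have p0 : 0 < (Q false)%:R :> R by rewrite ltr0n.
have q0 : 0 < (Q true)%:R :> R by rewrite ltr0n.
have [mu [mL [mR [mLf mRf [mLmu mRmu] mumin mLR]]]] := positive_face f0 p0 q0.
have FE m : m \in msupp f -> on_face Q f m <->
    segment (Q false)%:R (Q true)%:R mu mL mR (exp_point R m).
  move=> mf; split=> [mF|[lm _]].
    have lm : lin (Q false)%:R (Q true)%:R (exp_point R m) = mu.
      apply/eqP; rewrite eq_le mumin// andbT -mLmu.
      have := allP mF mL mLf; rewrite -(ler_nat R) -!lwdeg_nat.
      by [].
    by split => //; exact: mLR.
  apply/allP => m' m'f; rewrite -(ler_nat R) -!lwdeg_nat.
  by have := mumin m' m'f; rewrite -lm.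
exists (segment (Q false)%:R (Q true)%:R mu mL mR) => //; split.
  exact: segment_face.
exists (exp_point R m1), (exp_point R m2); split; [exact/FE|exact/FE|].
by move=> /exp_point_eq e; case: m12 => b; apply.
Qed.

Lemma restrict_to_weight f (Q : bool -> nat) (F : set (R * R)) :
  (forall m, m \in msupp f -> on_face Q f m <-> F (exp_point R m)) ->
  restrict_to f F = select (on_face Q f) f.
Proof.
move=> QF; apply: select_ext => m mf; have := QF m mf; case: (on_face Q f m).
  by move=> [H _]; apply/asboolP; exact: H.
by move=> [_ H]; apply/asboolP => /H.
Qed.

Lemma no_critical_nocrit f (A : set (CC R * CC R)) (B : CC R * CC R -> Prop) :
  (forall z, B z -> A z) -> no_critical_points_in f A -> nocrit f B.
Proof.
move=> BA nc z Bz cz; have : (critical_set f `&` A) z by split => //; exact: BA.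
by rewrite nc.
Qed.

Lemma neq0_torus (z : CC R * CC R) : (forall b, axis z b != 0) -> z.1 <> 0 /\ z.2 <> 0.
Proof.
by move=> az; split => /eqP; [have := az false|have := az true]; move=> /negPf ->.
Qed.

Section Faces.
Variable f : mixed_poly R.
Hypothesis f0 : f != 0.
Hypothesis one_faces : forall D, one_face f D ->
  no_critical_points_in (restrict_to f D) [set z : CC R * CC R | z.1 <> 0 /\ z.2 <> 0].

Lemma faces_nocrit (Q : bool -> nat) : (forall b, (0 < Q b)%N) ->
  (exists m1 m2, [/\ m1 \in msupp f, m2 \in msupp f, on_face Q f m1, on_face Q f m2 &
     exists b, expo b m1 <> expo b m2]) ->
  nocrit (select (on_face Q f) f) (fun z => forall b, axis z b != 0).
Proof.
move=> Q0 [m1 [m2 [m1f m2f m1F m2F m12]]].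
have [F F1 FQ] := weight_one_face f0 Q0 m1f m2f m1F m2F m12.
rewrite -(restrict_to_weight FQ); apply: no_critical_nocrit (one_faces F1).
exact: neq0_torus.
Qed.

Hypothesis non_extreme : forall x, non_extreme_vertex f x ->
  no_critical_points_in (restrict_to f [set x]) [set z : CC R * CC R | z.1 <> 0 /\ z.2 <> 0].

(** A strict minimum that is extremal in no coordinate is a non-extreme vertex:
    side_face provides a 1-face on each side, and if the two coincided their common
    direction would violate one of the two strict slope inequalities. *)
Lemma vertices_nocrit m0 (p : bool -> R) : m0 \in msupp f -> (forall b, 0 < p b) ->
  (forall m, m \in msupp f -> (exists b, expo b m != expo b m0) -> lwdeg p m0 < lwdeg p m) ->
  (forall b, exists2 m, m \in msupp f & (expo b m < expo b m0)%N) ->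
  nocrit (select (fun m => [forall b, expo b m == expo b m0]) f)
    (fun z => forall b, axis z b != 0).
Proof.
move=> m0f p0 strict nex.
have m0min m : m \in msupp f -> lwdeg p m0 <= lwdeg p m.
  move=> mf; have [|ne] := pselect (exists b, expo b m != expo b m0).
    by move=> /(strict m mf)/ltW.
  have eq b : expo b m = expo b m0 by apply/eqP; apply: contrapT => /negP e; apply: ne; exists b.
  by rewrite /lwdeg !eq.
have side c : exists m' (Q : bool -> nat), [/\ m' \in msupp f, forall b, (0 < Q b)%N,
    on_face Q f m0 /\ on_face Q f m',
    (expo c m' < expo c m0)%N /\ (Q c = expo (~~ c) m' - expo (~~ c) m0)%N &
    (Q (~~ c) = expo c m0 - expo c m')%N /\ p c * (Q (~~ c))%:R < p (~~ c) * (Q c)%:R].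
  apply: side_face => // m mf lt; apply: strict => //.
  by exists c; rewrite ltn_eqF.
have [ml [Ql [mlf Ql0 [Qlm0 Qlml] [llt Qlf] [Qlt Qlp]]]] := side false.
have [mr [Qr [mrf Qr0 [Qrm0 Qrmr] [rlt Qrt] [Qrf Qrp]]]] := side true.
rewrite /= in Qlf Qlt Qlp Qrt Qrf Qrp.
have [Fl Fl1 FlQ] : exists2 F, one_face f F &
    (forall m, m \in msupp f -> on_face Ql f m <-> F (exp_point R m)).
  apply: (weight_one_face f0 Ql0 m0f mlf Qlm0 Qlml).
  by exists false => e; rewrite e ltnn in llt.
have [Fr Fr1 FrQ] : exists2 F, one_face f F &
    (forall m, m \in msupp f -> on_face Qr f m <-> F (exp_point R m)).
  apply: (weight_one_face f0 Qr0 m0f mrf Qrm0 Qrmr).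
  by exists true => e; rewrite e ltnn in rlt.
have FlFr : Fl <> Fr.
  move=> FE; have Qrml : on_face Qr f ml by apply/FrQ => //; rewrite -FE; exact/FlQ.
  have wE : wdeg Qr ml = wdeg Qr m0.
    by apply/eqP; rewrite eqn_leq (allP Qrml)// (allP Qrm0).
  have e1 : (Qr true * Ql false = Qr false * Ql true)%N.
    have := Ql0 false; rewrite Qlf Qlt subn_gt0 => H.
    by apply/esym; apply: line_direction llt H wE.
  have : p false * (Ql true)%:R * (p true * (Qr false)%:R) < p true * (Ql false)%:R * (p false * (Qr true)%:R).
    by apply: ltr_pM => //; rewrite mulr_ge0// ltW.
  have -> : p true * (Ql false)%:R * (p false * (Qr true)%:R) = p true * p false * (Qr true * Ql false)%:R.
    by rewrite natrM; ring.
  rewrite e1 natrM; have -> : p false * (Ql true)%:R * (p true * (Qr false)%:R) =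
    p true * p false * ((Qr false)%:R * (Ql true)%:R) by ring.
  by rewrite ltxx.
have vx : vertex f (exp_point R m0).
  have mLR m : m \in msupp f -> lin (p false) (p true) (exp_point R m) = lwdeg p m0 ->
      (exp_point R m0).1 <= (exp_point R m).1 <= (exp_point R m0).1.
    move=> mf lE; suff -> : exp_point R m = exp_point R m0 by rewrite lexx.
    apply/exp_point_eq => b; apply/eqP; apply: contrapT => /negP e.
    by have := strict m mf (ex_intro _ b e); rewrite -lE lin_exp_point ltxx.
  have := segment_face (p0 false) (p0 true) m0f m0f (erefl _) (erefl _) m0min mLR.
  rewrite /vertex; congr compact_face; apply/seteqP; split => [x [lx /andP[x1 x2]]|_ ->]; last first.
    by split; rewrite ?lexx.
  have xE : x.1 = (exp_point R m0).1 by apply/eqP; rewrite eq_le x1 x2.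
  rewrite /= [x]surjective_pairing [RHS]surjective_pairing xE; congr pair.
  apply: (mulfI (lt0r_neq0 (p0 true))); apply: (addrI (p false * x.1)).
  by move: lx; rewrite /lin => ->; rewrite xE.
have -> : select (fun m => [forall b, expo b m == expo b m0]) f = restrict_to f [set exp_point R m0].
  apply: select_ext => m mf; apply/forallP/asboolP => [H|/exp_point_eq H b]; last by rewrite H.
  by apply/exp_point_eq => b; exact/eqP.
apply: no_critical_nocrit (non_extreme _); first exact: neq0_torus.
split => //; exists Fl, Fr; split => //; [exact/FlQ|exact/FrQ].
Qed.

End Faces.

(** Otherwise side_face would give a 1-face beyond that of P, contradicting the
    extremality of the slope of P. *)
Lemma extreme_face f c P : f != 0 -> positive_weight P ->
    (exists2 D, one_face f D & face_function P f = restrict_to f D) ->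
    (forall Q : bool -> nat, (forall b, 0 < Q b)%N ->
      (exists m1 m2, [/\ m1 \in msupp f, m2 \in msupp f, on_face Q f m1, on_face Q f m2 &
       exists b, expo b m1 <> expo b m2]) ->
      exists P' : nat * nat, [/\ positive_weight P',
        face_function P' f = select (on_face Q f) f &
        (weight_of P (~~ c) * weight_of P' c <= weight_of P c * weight_of P' (~~ c))%N]) ->
  exists mL, [/\ mL \in msupp f, on_face (weight_of P) f mL,
    forall m, m \in msupp f -> (expo c mL <= expo c m)%N &
    exists m, [/\ m \in msupp f, on_face (weight_of P) f m & expo c m <> expo c mL]].
Proof.
move=> f0 /andP[P1 P2] [D D1 DE] slopes.
have P0 b : (0 < weight_of P b)%N by case: b.
have [m1 [m2 [m1f m2f Dm1 Dm2 [b m12]]]] := one_face_two_exponents f0 D1.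
have eqD : {in msupp f, on_face (weight_of P) f =1 (fun m => `[< D (exp_point R m) >])}.
  by apply: select_inj; rewrite -face_functionE.
have F1 : on_face (weight_of P) f m1 by rewrite eqD//; apply/asboolP.
have F2 : on_face (weight_of P) f m2 by rewrite eqD//; apply/asboolP.
have w12 : wdeg (weight_of P) m1 = wdeg (weight_of P) m2.
  by apply/eqP; rewrite eqn_leq (allP F1)// (allP F2).
have m12c : expo c m1 <> expo c m2.
  move=> ec; apply: m12; have [->|->] := eq_or_negb b c; first exact: ec.
  apply/eqP; rewrite -(eqn_pmul2l (P0 (~~ c))) -(eqn_add2l (weight_of P c * expo c m1)).
  by rewrite {2}ec -!wdeg_split w12.
pose s := [seq m <- msupp f | on_face (weight_of P) f m].
have s0 : s != [::].
  have : m1 \in s by rewrite mem_filter F1.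
  by apply: contraTneq => ->.
have [mL + mLmin] := seq_argmin (fun m => (expo c m)%:R : R) s0.
rewrite mem_filter => /andP[mLF mLf].
exists mL; split => //; last first.
  have [e1|e1] := eqVneq (expo c m1) (expo c mL); last by exists m1; split => //; exact/eqP.
  by exists m2; split => //; rewrite -e1 => /esym.
move=> m mf; rewrite leqNgt; apply/negP => mlt.
pose p b : R := (weight_of P b)%:R.
have p0 d : 0 < p d by rewrite ltr0n.
have pmin m' : m' \in msupp f -> lwdeg p mL <= lwdeg p m'.
  by move=> m'f; rewrite !lwdeg_nat ler_nat (allP mLF).
have strict m' : m' \in msupp f -> (expo c m' < expo c mL)%N -> lwdeg p mL < lwdeg p m'.
  move=> m'f lt; rewrite lt_neqAle pmin// andbT; apply/negP.
  rewrite !lwdeg_nat eqr_nat => /eqP wE.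
  have m's : m' \in s.
    by rewrite mem_filter m'f andbT; apply/allP => k kf; rewrite -wE (allP mLF).
  by have := mLmin m' m's; rewrite ler_nat leqNgt lt.
have [m' [Q [m'f Q0 [QL Qm'] [m'lt Qc] [Qnc Qp]]]] :=
  side_face p0 mLf pmin strict (ex_intro2 _ _ m mf mlt).
have two : exists m1 m2, [/\ m1 \in msupp f, m2 \in msupp f, on_face Q f m1, on_face Q f m2 &
       exists b, expo b m1 <> expo b m2].
  by exists mL, m'; split => //; exists c => e; rewrite e ltnn in m'lt.
have [P' [/andP[P'1 P'2] P'E sl]] := slopes Q Q0 two.
have eqQ : {in msupp f, on_face (weight_of P') f =1 on_face Q f}.
  by apply: select_inj; rewrite -face_functionE.
have w' : wdeg (weight_of P') m' = wdeg (weight_of P') mL.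
  by apply/eqP; rewrite eqn_leq (allP (_ : on_face _ f m'))// ?eqQ// (allP (_ : on_face _ f mL))// eqQ.
have e1 : (weight_of P' c * Q (~~ c) = weight_of P' (~~ c) * Q c)%N.
  have bgt : (expo (~~ c) mL < expo (~~ c) m')%N by have := Q0 c; rewrite Qc subn_gt0.
  by rewrite Qc Qnc; apply: line_direction m'lt bgt _; rewrite -!wdeg_split.
move: Qp; rewrite /p -!natrM ltr_nat => Qp.
have Qc0 := Q0 c; have Qnc0 := Q0 (~~ c); have Pc0 := P0 c; have Pnc0 := P0 (~~ c).
have P'nc : (0 < weight_of P' (~~ c))%N by case: (c).
move: e1 sl Qp Qc0 Qnc0 Pc0 Pnc0 P'nc.
move: (weight_of P' c) (weight_of P' (~~ c)) (weight_of P c) (weight_of P (~~ c)) (Q c) (Q (~~ c)).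
move=> a b' p1 p2 q1 q2 e1 sl Qp q10 q20 p10 p20 b'0.
have H1 : (p1 * q2 * b' < p2 * q1 * b')%N by rewrite ltn_pmul2r.
have H2 : (p2 * a * q2 <= p1 * b' * q2)%N by rewrite leq_mul2r sl orbT.
suff : (p1 * q2 * b' < p1 * b' * q2)%N by rewrite mulnAC ltnn.
by rewrite (leq_trans H1)// (leq_trans _ H2)// -(mulnA p2 a) e1 -mulnA (mulnC q1).
Qed.

End SindConsequences.

Section NoTangency.
Variable R : realType.
Local Notation C := (complex R).
Implicit Types (f g : mixed_poly R) (m : multinom 4) (c : bool).

Lemma slope_le (P Q : nat * nat) : positive_weight P -> positive_weight Q ->
  slope Q <= slope P -> (P.2 * Q.1 <= P.1 * Q.2)%N.
Proof.
move=> /andP[_ P2] /andP[_ Q2]; rewrite /slope.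
rewrite ler_pdivrMr ?ltr0n// mulrAC ler_pdivlMr ?ltr0n// -!natrM ler_nat.
by rewrite mulnC.
Qed.

Lemma sorted_slopes (P : nat * nat) Ps :
  sorted (fun P Q => slope Q < slope P) (P :: Ps) ->
  forall Q, Q \in P :: Ps -> slope (last P Ps) <= slope Q <= slope P.
Proof.
elim: Ps P => [|P' Ps IH] P /=; first by move=> _ Q; rewrite inE => /eqP ->; rewrite !lexx.
move=> /andP[lt srt] Q; rewrite in_cons => /predU1P[->|QP].
  have /andP[le _] := IH P' srt P' (mem_head _ _).
  by rewrite lexx (le_trans le)// ltW.
by have /andP[-> le] := IH P' srt Q QP; rewrite (le_trans le)// ltW.
Qed.

Lemma weights_cover f Ps (Q : bool -> nat) : f != 0 -> newton_weights f Ps ->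
  (forall b, (0 < Q b)%N) ->
  (exists m1 m2, [/\ m1 \in msupp f, m2 \in msupp f, on_face Q f m1, on_face Q f m2 &
     exists b, expo b m1 <> expo b m2]) ->
  exists2 P, P \in Ps & face_function P f = select (on_face Q f) f.
Proof.
move=> f0 [_ _ cover _] Q0 [m1 [m2 [m1f m2f m1F m2F m12]]].
have [F F1 FQ] := weight_one_face f0 Q0 m1f m2f m1F m2F m12.
by have [P PPs PE] := cover F F1; exists P; rewrite // PE (restrict_to_weight FQ).
Qed.

(** The two cuspidal regions and the middle region cover a punctured
    neighbourhood of the origin. *)
Lemma no_tangency_two_faces f P1 Ps : f != 0 -> newton_weights f (P1 :: Ps) ->
    no_critical_points_in (face_function P1 f) [set z | z.2 <> 0] ->
    no_critical_points_in (face_function (last P1 Ps) f) [set z | z.1 <> 0] ->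
    (forall D, one_face f D ->
      no_critical_points_in (restrict_to f D) [set z | z.1 <> 0 /\ z.2 <> 0]) ->
    (forall x, non_extreme_vertex f x ->
      no_critical_points_in (restrict_to f [set x]) [set z | z.1 <> 0 /\ z.2 <> 0]) ->
  exists2 rho : R, 0 < rho & forall z om lam, z <> (0, 0) ->
    (forall b, moduli z b <= rho) -> ~ tangent_at f om lam z.
Proof.
move=> f0 nw nc1 ncN faces vertices.
have [pos real cover srt] := nw.
pose PN := last P1 Ps; pose P c := weight_of (if c then PN else P1).
have inPs c : (if c then PN else P1) \in P1 :: Ps.
  by case: c; [exact: mem_last|exact: mem_head].
have P0 c b : (0 < P c b)%N.
  by have := allP pos _ (inPs c); rewrite /P => /andP[]; case: b.
have ext c : exists mL, [/\ mL \in msupp f, on_face (P c) f mL,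
    forall m, m \in msupp f -> (expo c mL <= expo c m)%N &
    exists m, [/\ m \in msupp f, on_face (P c) f m & expo c m <> expo c mL]].
  apply: (extreme_face f0 (allP pos _ (inPs c))).
    by have [D [D1 D2]] := real _ (inPs c); exists D.
  move=> Q Q0 two; have [P' P'in P'E] := weights_cover f0 nw Q0 two.
  exists P'; split => //; first exact: (allP pos).
  have /andP[leN le1] := sorted_slopes srt P'in.
  have P'pos := allP pos _ P'in.
  case: c; last exact: slope_le (allP pos _ (mem_head _ _)) P'pos le1.
  by rewrite /= mulnC [leqRHS]mulnC; exact: slope_le P'pos (allP pos _ (mem_last _ _)) leN.
have [mL mLP] := choice ext.
have ncP c : nocrit (select (on_face (P c) f) f) (fun z => axis z (~~ c) != 0).
  rewrite /P -face_functionE//; case: c.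
    by apply: no_critical_nocrit ncN => z /= /eqP.
  by apply: no_critical_nocrit nc1 => z /= /eqP.
have cusp c := cuspidal_region (P0 c) (ncP c)
  (let: And4 h1 h2 h3 _ := mLP c in ex_intro _ (mL c) (And3 h1 h2 h3)).
have s0 : msupp f != [::] by rewrite msupp_eq0.
have [rm rm0 mid] : exists2 rho : R, 0 < rho & forall z om lam,
  (forall b, axis z b != 0) /\
  (forall c, moduli z (~~ c) ^+ P c c < moduli z c ^+ P c (~~ c)) ->
  (forall b, moduli z b <= rho) -> ~ tangent_at f om lam z.
  apply: (@middle_region _ _ s0 P P0 mL); try by move=> c; have [] := mLP c.
  - by move=> Q Q0 two; apply: (faces_nocrit f0 faces Q0 two).
  - move=> m0 p m0f p0 strict; apply: (vertices_nocrit f0 vertices m0f p0).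
    by move=> m mf /(strict m mf); rewrite !big_bool /lwdeg /= addrC [ltRHS]addrC.
have [rf rf0 cuspf] := cusp false; have [rt rt0 cuspt] := cusp true.
exists (Num.min rm (Num.min rf rt)); first by rewrite !lt_min rm0 rf0.
move=> z om lam zN zle.
have lm b : moduli z b <= rm by have := zle b; rewrite !le_min => /and3P[].
have lf b : moduli z b <= rf by have := zle b; rewrite !le_min => /and3P[].
have lt b : moduli z b <= rt by have := zle b; rewrite !le_min => /and3P[].
have zaxes : (axis z false != 0) || (axis z true != 0).
  apply: contraPT zN; rewrite negb_or !negbK => /andP[/eqP e1 /eqP e2].
  by apply; rewrite [z]surjective_pairing; congr pair.
have r0 b : 0 <= moduli z b by exact: modulus_ge0.
have zero b : axis z b = 0 -> moduli z b = 0.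
  by move=> e; rewrite /moduli e; apply/eqP; rewrite modulus_eq0.
have [hf|hf] := boolP ((axis z true != 0) &&
    (moduli z false ^+ P false true <= moduli z true ^+ P false false)).
  by move/andP: hf => hf; apply: (cuspf z om lam).
have [ht|ht] := boolP ((axis z false != 0) &&
    (moduli z true ^+ P true false <= moduli z false ^+ P true true)).
  by move/andP: ht => ht; apply: (cuspt z om lam).
apply: mid lm; move: hf ht; rewrite !negb_and !negbK -!ltNge => hf ht.
have zn b : axis z b != 0.
  case: b; apply/negP => /eqP e.
    move: zaxes; rewrite e eqxx orbF => zf; move: ht; rewrite (negPf zf)/= (zero true e).
    have -> : (0 : R) ^+ P true false = 0 by apply/eqP; rewrite expf_eq0 eqxx P0.
    by rewrite ltNge exprn_ge0.
  move: zaxes; rewrite e eqxx /= => zt; move: hf; rewrite (negPf zt)/= (zero false e).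
  have -> : (0 : R) ^+ P false true = 0 by apply/eqP; rewrite expf_eq0 eqxx P0.
  by rewrite ltNge exprn_ge0.
split => // c.
by move: hf ht; rewrite !(negPf (zn _))/=; case: c.
Qed.

Lemma newton_boundary_sub f F : compact_face f F -> F `<=` newton_boundary f.
Proof. by move=> FF x Fx; exists F. Qed.

(** Otherwise side_face, applied at an end point of the face of the weight (1, 1),
    would give a 1-face. *)
Lemma single_vertex_min f x : f != 0 -> newton_boundary f = [set x] ->
  exists2 m0, m0 \in msupp f & x = exp_point R m0 /\
    (forall c m, m \in msupp f -> (expo c m0 <= expo c m)%N).
Proof.
move=> f0 NB; have p0 := @ltr01 R.
have [mu [mL [mR [mLf mRf [mLmu mRmu] mumin mLR]]]] := positive_face f0 p0 p0.
have Sf := segment_face p0 p0 mLf mRf mLmu mRmu mumin mLR.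
have LR : (exp_point R mL).1 <= (exp_point R mR).1 by have /andP[] := mLR mL mLf mLmu.
have xL : exp_point R mL = x.
  suff : newton_boundary f (exp_point R mL) by rewrite NB.
  by apply: newton_boundary_sub Sf _ _; split; rewrite ?lexx.
have xR : exp_point R mR = x.
  suff : newton_boundary f (exp_point R mR) by rewrite NB.
  by apply: newton_boundary_sub Sf _ _; split; rewrite ?lexx ?andbT.
exists mL => //; split => // c m mf; rewrite leqNgt; apply/negP => lt.
pose p (b : bool) : R := 1.
have pb b : 0 < p b by exact: ltr01.
have min0 k : k \in msupp f -> lwdeg p mL <= lwdeg p k.
  by move=> kf; have := mumin k kf; rewrite -mLmu.
have strict k : k \in msupp f -> (expo c k < expo c mL)%N -> lwdeg p mL < lwdeg p k.
  move=> kf klt; rewrite lt_neqAle min0// andbT; apply/negP => /eqP e.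
  have kmu : lin 1 1 (exp_point R k) = mu by rewrite -mLmu; exact/esym.
  have /andP[k1 k2] := mLR k kf kmu.
  have ek : exp_point R k = exp_point R mL.
    have e1 : (exp_point R k).1 = (exp_point R mL).1.
      by apply/eqP; rewrite eq_le k1 xL -xR k2.
    rewrite [LHS]surjective_pairing [RHS]surjective_pairing e1; congr pair.
    by move: kmu; rewrite -mLmu /lin !mul1r e1 => /addrI.
  by move/exp_point_eq : ek => /(_ c) ek; rewrite ek ltnn in klt.
have [m' [Q [m'f Q0 [QL Qm'] [m'lt _] _]]] :=
  side_face pb mLf min0 strict (ex_intro2 _ _ m mf lt).
have [F [Fc _] FQ] : exists2 F, one_face f F &
    (forall m, m \in msupp f -> on_face Q f m <-> F (exp_point R m)).
  apply: (weight_one_face f0 Q0 mLf m'f QL Qm').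
  by exists c => e; rewrite e ltnn in m'lt.
have : newton_boundary f (exp_point R m').
  by apply: newton_boundary_sub Fc _ _; exact/FQ.
rewrite NB /= -xL => /exp_point_eq /(_ c) e.
by rewrite e ltnn in m'lt.
Qed.

(** With the weight (1, 1) the cuspidal regions are |u| <= |v| and |v| <= |u|. *)
Lemma no_tangency_vertex f x : f != 0 -> newton_boundary f = [set x] ->
    no_critical_points_in (restrict_to f (newton_boundary f)) [set z | z <> (0, 0)] ->
  exists2 rho : R, 0 < rho & forall z om lam, z <> (0, 0) ->
    (forall b, moduli z b <= rho) -> ~ tangent_at f om lam z.
Proof.
move=> f0 NB; rewrite NB => nc.
have [m0 m0f [xE m0min]] := single_vertex_min f0 NB.
pose P (b : bool) := 1%N.
have P0 b : (0 < P b)%N by [].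
have wE m : wdeg P m = (expo false m + expo true m)%N by rewrite /wdeg !mul1n.
have m0F : on_face P f m0 by apply/allP => m mf; rewrite !wE leq_add// m0min.
have selE : restrict_to f [set x] = select (on_face P f) f.
  apply: restrict_to_weight => m mf; rewrite xE; split=> [mF|/exp_point_eq e].
    apply/exp_point_eq => b; apply/eqP; rewrite eqn_leq m0min// andbT.
    have := allP mF m0 m0f; rewrite !wE.
    have := m0min false m mf; have := m0min true m mf.
    case: b; move: (expo _ _) (expo _ _) (expo _ _) (expo _ _) => *; lia.
  by apply/allP => k kf; rewrite wE !e -wE (allP m0F).
have ncP c : nocrit (select (on_face P f) f) (fun z => axis z (~~ c) != 0).
  rewrite -selE; apply: no_critical_nocrit nc => z /= zc zE; move: zc.
  by rewrite zE; case: c; rewrite eqxx.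
have cusp c := cuspidal_region P0 (ncP c)
  (ex_intro _ m0 (And3 m0f m0F (m0min c))).
have [rf rf0 cuspf] := cusp false; have [rt rt0 cuspt] := cusp true.
exists (Num.min rf rt); first by rewrite lt_min rf0.
move=> z om lam zN zle.
have lf b : moduli z b <= rf by have := zle b; rewrite le_min => /andP[].
have lt b : moduli z b <= rt by have := zle b; rewrite le_min => /andP[].
have zero b : moduli z b = 0 -> axis z b = 0.
  by move=> /eqP; rewrite modulus_eq0 => /eqP.
have r0 b : 0 <= moduli z b by exact: modulus_ge0.
have [le|le] := leP (moduli z false) (moduli z true).
  apply: (cuspf z om lam) => //; split => //; apply/negP => /eqP e; apply: zN.
  have mt : moduli z true = 0 by rewrite /moduli e; apply/eqP; rewrite modulus_eq0.
  have mf : moduli z false = 0 by apply/eqP; rewrite eq_le r0 andbT -mt.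
  by rewrite [z]surjective_pairing; congr pair; [exact: (zero false)|exact: (zero true)].
apply: (cuspt z om lam) => //; split; last exact: ltW.
apply/negP => /eqP e; move: le.
suff -> : moduli z false = 0 by rewrite ltNge r0.
by rewrite /moduli e; apply/eqP; rewrite modulus_eq0.
Qed.

(** The geometric content of non-degeneracy: small spheres are nowhere tangent to
    the hypersurfaces on which f has a constant argument modulo pi. *)
Theorem sind_no_tangency f : f != 0 -> sind f ->
  exists2 rho : R, 0 < rho & forall z om lam, z <> (0, 0) ->
    (forall b, moduli z b <= rho) -> ~ tangent_at f om lam z.
Proof.
move=> f0 [[x [NB nc]]|[P1 [Ps [nw nc1 ncN faces vertices]]]].
  exact: no_tangency_vertex NB nc.
exact: no_tangency_two_faces nw nc1 ncN faces vertices.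
Qed.

End NoTangency.

(** * Local triviality *)

Section ComplexTopology.
Variable R : realType.
Local Notation C := (complex R).
Variables (I : Type) (F : set_system I).
Context {FF : Filter F}.

Lemma cvg_subtype (X : topologicalType) (A : set X) (h : I -> A) (a : A) :
  (fun i => set_val (h i)) @ F --> set_val a -> h @ F --> a.
Proof.
move=> hc U [? /= [[W oW <-]]] /= Wa /filterS; apply; apply: hc.
exact: open_nbhs_nbhs.
Qed.

Lemma cvg_complexP (h : I -> CC R) (l : CC R) :
  h @ F --> l <-> tends F (h : I -> C) (l : C).
Proof.
split=> [/cvgrPdist_lt hl|[hr hi]].
  have H e : 0 < e -> \forall i \near F, modulus ((l : C) - h i) < e.
    move=> e0; have e0' : 0 < (e%:C%C : CC R) by rewrite -[0]/(0%:C%C) ltcR.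
    have := hl _ e0'; apply: filterS => i; rewrite /= -ltcR => hi.
    by rewrite -norm_modulus.
  split; apply/cvgrPdist_lt => e /H; apply: filterS => i; apply: le_lt_trans.
    by rewrite -ReN -ReD norm_Re_le.
  by rewrite -ImN -ImD norm_Im_le.
apply/cvgrPdist_lt => e e0.
have [r r0 er] : exists2 r : R, 0 < r & e = r%:C%C :> C.
  exists (Re (e : C)); move: e0; rewrite ltcE /= => /andP[/eqP ei er] => //.
  by apply: complex_eqP => //=; rewrite ei.
have r2 : 0 < r / 2 by rewrite divr_gt0.
have Hr : \forall i \near F, `|Re (l : C) - Re (h i : C)| < r / 2.
  exact: (iffLR (@cvgrPdist_lt _ _ _ _ FF _ _) hr).
have Hi : \forall i \near F, `|Im (l : C) - Im (h i : C)| < r / 2.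
  exact: (iffLR (@cvgrPdist_lt _ _ _ _ FF _ _) hi).
apply: filterS2 Hr Hi => i hri hii; rewrite er.
suff : modulus ((l : C) - h i) < r by rewrite -ltcR -norm_modulus.
rewrite (le_lt_trans (modulus_le_ReIm _))// !ReImE; lra.
Qed.

Lemma cvg_axisP (h : I -> CC R * CC R) (l : CC R * CC R) :
  h @ F --> l <-> forall c, tends F (fun i => axis (h i) c) (axis l c).
Proof.
split=> [hl c|H].
  case: c; apply/cvg_complexP.
    exact: (cvg_comp _ _ hl (@cvg_snd _ _ _ _ _)).
  exact: (cvg_comp _ _ hl (@cvg_fst _ _ _ _ _)).
have h1 := iffRL (@cvg_complexP (fun i => (h i).1) l.1) (H false).
have h2 := iffRL (@cvg_complexP (fun i => (h i).2) l.2) (H true).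
have hE : h = (fun i => ((h i).1, (h i).2)).
  by apply/funext => i; exact: surjective_pairing.
rewrite hE [l]surjective_pairing; exact: cvg_pair h1 h2.
Qed.

Lemma cvg_toC (h : I -> 'rV[R]_4) (l : 'rV[R]_4) : h @ F --> l ->
  (fun i => toC (h i)) @ F --> toC l.
Proof.
by move=> hl; apply/cvg_axisP => -[]; split => /=; exact: cvg_coord.
Qed.

Lemma cvg_ofC (h : I -> CC R * CC R) (l : CC R * CC R) : h @ F --> l ->
  (fun i => ofC (h i)) @ F --> ofC l.
Proof.
move=> /cvg_axisP hl; have [h1r h1i] := hl false; have [h2r h2i] := hl true.
apply: cvg_rV => j; rewrite mxE; under eq_fun do rewrite mxE.
by case: j => -[|[|[|[|//]]]] j4.
Qed.

End ComplexTopology.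

Section Rotations.
Variable R : realType.
Local Notation C := (complex R).

Definition expi (t : R) : C := Complex (cos t) (sin t).

Lemma expiD s t : expi (s + t) = expi s * expi t.
Proof. by apply: complex_eqP; rewrite !ReImE /= ?cosD ?sinD; ring. Qed.

Lemma expi0 : expi 0 = 1.
Proof. by rewrite /expi cos0 sin0. Qed.

Lemma expi_angle (x y : R) : x ^+ 2 + y ^+ 2 = 1 ->
  exists t, cos t = x /\ sin t = y.
Proof.
move=> xy; have x1 : -1 <= x <= 1.
  by apply/andP; split; have := sqr_ge0 y; nra.
have yE : 1 - x ^+ 2 = y ^+ 2 by rewrite -xy; ring.
have cE : cos (acos x) = x by rewrite acosK// in_itv.
have sE : sin (acos x) = `|y| by rewrite sin_acos// yE sqrtr_sqr.
have [y0|y0] := leP 0 y.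
  by exists (acos x); rewrite cE sE ger0_norm.
by exists (- acos x); rewrite cosN sinN cE sE ltr0_norm// opprK.
Qed.

Lemma circleP (w : CC R) : circle w <-> Re (w : C) ^+ 2 + Im (w : C) ^+ 2 = 1.
Proof.
rewrite /circle /= -modulus_sqr; have -> : `|w| = (modulus w)%:C%C :> C.
  exact: norm_modulus.
split=> [/eqP|/eqP]; last first.
  by rewrite sqrf_eq1 => /orP[/eqP->//|/eqP e]; have := modulus_ge0 (w : C); rewrite e oppr_ge0 ler10.
by rewrite -[1]/(1%:C%C) (inj_eq (@complexI R)) => /eqP ->; rewrite expr1n.
Qed.

Let dotw (b w : C) := Re b * Re w + Im b * Im w.
Let crossw (b w : C) := Re b * Im w - Im b * Re w.

Let dot_cross (b w : C) : Re b ^+ 2 + Im b ^+ 2 = 1 -> Re w ^+ 2 + Im w ^+ 2 = 1 ->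
  dotw b w ^+ 2 + crossw b w ^+ 2 = 1.
Proof.
move=> b1 w1; transitivity ((Re b ^+ 2 + Im b ^+ 2) * (Re w ^+ 2 + Im w ^+ 2)).
  by rewrite /dotw /crossw; ring.
by rewrite b1 w1 mulr1.
Qed.

Let rot_dot_cross (b w : C) (t : R) : Re b ^+ 2 + Im b ^+ 2 = 1 ->
  cos t = dotw b w -> sin t = crossw b w -> w = expi t * b.
Proof.
move=> b1 ct st; apply: complex_eqP; rewrite !ReImE /= ct st.
  transitivity ((Re b ^+ 2 + Im b ^+ 2) * Re w); first by rewrite b1 mul1r.
  by rewrite /dotw /crossw; ring.
transitivity ((Re b ^+ 2 + Im b ^+ 2) * Im w); first by rewrite b1 mul1r.
by rewrite /dotw /crossw; ring.
Qed.

Lemma circle_transitive (b w : circle (R := R)) :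
  exists t, set_val w = expi t * (set_val b : C).
Proof.
have b1 := iffLR (circleP _) (set_valP b); have w1 := iffLR (circleP _) (set_valP w).
have [t [ct st]] := expi_angle (dot_cross b1 w1).
by exists t; exact: rot_dot_cross.
Qed.

(** The angle is the arcsine of Im (conj b * w) on the half-circle where
    Re (conj b * w) is positive. *)
Lemma circle_angle (b : circle (R := R)) (T : R) : 0 < T ->
  exists (U : set (circle (R := R))) (theta : circle (R := R) -> R),
    open_nbhs b U /\ forall w, U w ->
    [/\ `|theta w| < T, set_val w = expi (theta w) * (set_val b : C) &
      theta @ nbhs w --> theta w].
Proof.
move=> T0; have b1 := iffLR (circleP _) (set_valP b).
pose c (w : circle (R := R)) := dotw (set_val b) (set_val w).
pose s (w : circle (R := R)) := crossw (set_val b) (set_val w).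
have cs w : c w ^+ 2 + s w ^+ 2 = 1.
  exact: dot_cross b1 (iffLR (circleP _) (set_valP w)).
pose theta w := asin (s w).
have val_tends (w : circle (R := R)) : tends (nbhs w) (fun w => set_val w : C) (set_val w).
  by apply/(cvg_complexP (fun w => set_val w : CC R)); exact: initial_continuous.
have c_cvg w : c @ nbhs w --> c w.
  have [wr wi] := val_tends w.
  by apply: cvgD; apply: cvgM => //; exact: cvg_cst.
have s_cvg w : s @ nbhs w --> s w.
  have [wr wi] := val_tends w.
  by apply: cvgB; apply: cvgM => //; exact: cvg_cst.
have s1 w : 0 < c w -> -1 < s w < 1.
  move=> c0; have : s w ^+ 2 < 1 by rewrite -(cs w) ltrDr exprn_gt0.
  by clear => H; apply/andP; split; nra.
have theta_cvg w : 0 < c w -> theta @ nbhs w --> theta w.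
  by move=> /s1 sw; apply: cvg_comp (s_cvg w) _; exact: continuous_asin.
exists [set w | 0 < c w /\ `|theta w| < T], theta; split; last first.
  move=> w [cw tw]; split => //; last exact: theta_cvg.
  have /andP[sm sM] := s1 w cw.
  have sw : -1 <= s w <= 1 by rewrite !ltW.
  apply: rot_dot_cross => //.
    rewrite cos_asin// -/(c w) -(cs w) addrK sqrtr_sqr ger0_norm//; exact: ltW.
  by rewrite asinK ?in_itv.
split; last first.
  have sb : s b = 0 by rewrite /s /crossw; ring.
  have cb : c b = 1 by rewrite /c /dotw -!expr2.
  have asin0 : asin (0 : R) = 0.
    have := @sinK R 0; rewrite sin0; apply.
    by rewrite in_itv/= oppr_le0 divr_ge0 ?pi_ge0.
  by rewrite /= cb /theta sb asin0 normr0.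
rewrite openE => w [cw tw]; rewrite /interior.
apply: filterS2 (cvgr_gt _ (c_cvg w) _ cw) (cvgr_norm_lt _ (theta_cvg w cw) _ tw).
by move=> w' ? ?; split.
Qed.

End Rotations.

(** A continuous local action over the rotations of the circle trivializes the
    map over a short arc around b: a point is carried to the fibre of b by the
    rotation that undoes the angle of its image. Composing short rotations reaches
    every fibre. *)
Section RotationAction.
Variables (R : realType) (E : topologicalType) (p : E -> circle (R := R)).
Local Notation C := (complex R).
Variables (T : R) (G : R -> E -> E).
Hypothesis T0 : 0 < T.
Hypothesis p_cont : continuous p.
Hypothesis GK : forall t x, `|t| < T -> G (- t) (G t x) = x.
Hypothesis pG : forall t x, `|t| < T -> set_val (p (G t x)) = expi t * (set_val (p x) : C).
Hypothesis G_cont : forall t x, `|t| < T ->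
  (fun q : R * E => G q.1 q.2) @ nbhs (t, x) --> G t x.
Variable x0 : E.

Let pG_iter n t x : `|t| < T ->
  set_val (p (iter n (G t) x)) = expi (n%:R * t) * (set_val (p x) : C).
Proof.
move=> tT; elim: n => [|n IH] /=; first by rewrite mul0r expi0 mul1r.
by rewrite pG// IH mulrA -expiD -{1}[t]mul1r -mulrDl nat1r.
Qed.

Let p_surj b : exists x, p x = b.
Proof.
have [s bE] := circle_transitive (p x0) b.
pose n := (Num.truncn (`|s| / T)).+1.
have n0 : 0 < n%:R :> R by rewrite ltr0n.
have sn : `|s / n%:R| < T.
  rewrite normrM normfV (gtr0_norm n0) ltr_pdivrMr// mulrC -ltr_pdivrMr//.
  exact: truncnS_gt.
exists (iter n (G (s / n%:R)) x0); apply: val_inj.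
rewrite -set_valE pG_iter// bE; congr (expi _ * _).
by rewrite mulrC divfK// gt_eqF.
Qed.

Theorem rotation_action_trivial : locally_trivial_fibration p.
Proof.
split => // b; have [U [theta [Ub UP]]] := circle_angle b T0.
exists U; split => //.
pose F : topologicalType := set_type (p @^-1` [set b]); exists F.
have TN (t : R) : `|t| < T -> `|- t| < T by rewrite normrN.
have expiN t : expi (- t) * expi t = 1 :> C by rewrite -expiD addNr expi0.
have toF (x : p @^-1` U) : G (- theta (p (set_val x))) (set_val x) \in p @^-1` [set b].
  have [tT wE _] := UP _ (set_valP x).
  apply/mem_set/val_inj; rewrite -!set_valE pG ?TN// wE mulrA expiN mul1r//.
have toU (x : p @^-1` U) : p (set_val x) \in U by apply/mem_set; exact: (set_valP x).
pose h (x : p @^-1` U) : (U * F)%type  :=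
  (exist (fun w => w \in U) _ (toU x) : set_type U,
   exist (fun y => y \in p @^-1` [set b]) _ (toF x) : F).
have pF (y : F) : p (set_val y) = b by exact: (set_valP y).
have pg (q : (U * F)%type) : p (G (theta (set_val q.1)) (set_val q.2)) = set_val q.1.
  have [tT wE _] := UP _ (set_valP q.1).
  by apply: val_inj; rewrite -!set_valE pG// pF -wE.
have inU (q : (U * F)%type) : G (theta (set_val q.1)) (set_val q.2) \in p @^-1` U.
  by apply/mem_set; rewrite /preimage /= pg; exact: (set_valP q.1).
pose g (q : (U * F)%type) : p @^-1` U := exist (fun x => x \in p @^-1` U) _ (inU q).
exists h; split => //; split.
  move=> x; have [tT _ tc] := UP _ (set_valP x).
  have vx : set_val @ nbhs x --> set_val x by exact: initial_continuous.
  have px : (fun x => p (set_val x)) @ nbhs x --> p (set_val x).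
    exact: (cvg_comp _ _ vx (@p_cont _)).
  apply: (cvg_pair (F := nbhs x) (G := nbhs (h x).1) (H := nbhs (h x).2)
           (f := fun x => (h x).1) (g := fun x => (h x).2)); apply: cvg_subtype => //.
  have ntx : (fun x => - theta (p (set_val x))) @ nbhs x --> - theta (p (set_val x)).
    by apply: cvgN; exact: (cvg_comp _ _ px tc).
  have := cvg_comp _ _ (cvg_pair ntx vx) (G_cont (TN _ tT)).
  exact.
exists g; split.
- move=> q; have [tT _ tc] := UP _ (set_valP q.1).
  apply: cvg_subtype.
  have v1 : (fun q : (U * F)%type => theta (set_val q.1)) @ nbhs q --> theta (set_val q.1).
    apply: (cvg_comp (fun q : (U * F)%type => set_val q.1) theta) tc.
    have f1 : (fun q : (U * F)%type => q.1) @ nbhs q --> q.1 by exact: cvg_fst.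
    by apply: (cvg_comp _ _ f1); exact: initial_continuous.
  have v2 : (fun q : (U * F)%type => set_val q.2) @ nbhs q --> set_val q.2.
    have f2 : (fun q : (U * F)%type => q.2) @ nbhs q --> q.2 by exact: cvg_snd.
    by apply: (cvg_comp _ _ f2); exact: initial_continuous.
  exact: (cvg_comp _ _ (cvg_pair v1 v2) (G_cont tT)).
- move=> x; apply: val_inj => /=; have [tT _ _] := UP _ (set_valP x).
  by rewrite -{1}[theta _]opprK GK// TN.
- move=> q; have [tT _ _] := UP _ (set_valP q.1).
  rewrite [RHS]surjective_pairing; congr pair; apply: val_inj => /=.
    exact: pg.
  by rewrite -/(set_val _) pg GK.
Qed.

End RotationAction.

Section MilnorFibration.
Variable R : realType.
Local Notation C := (complex R).
Variables (f : mixed_poly R) (rho : R).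
Hypothesis rho0 : 0 < rho.

Lemma sphere3_enorm (z : CC R * CC R) : sphere3 rho z <-> enorm (ofC z) = rho.
Proof.
have zE : `|z.1| ^+ 2 + `|z.2| ^+ 2 = (real_complex R (enorm (ofC z))) ^+ 2 :> C.
  by have := norm_toC (ofC z); rewrite ofCK.
rewrite /sphere3 /= zE; split=> [|->//].
rewrite -!(rmorphXn (real_complex R)) => /complexI /eqP.
by rewrite eqrXn2 ?enorm_ge0 ?(ltW rho0)// => /eqP.
Qed.

Lemma ev_tends (I : Type) (F : set_system I) {FF : Filter F}
    (h : I -> CC R * CC R) (l : CC R * CC R) :
  h @ F --> l -> tends F (fun i => ev f (h i)) (ev f l).
Proof.
by move=> /cvg_axisP; exact: tends_axis.
Qed.

Lemma expi_modulus (t : R) : modulus (expi t) = 1.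
Proof. by rewrite modulusE /= cos2Dsin2 sqrtr1. Qed.

Lemma milnor_mapE (x : sphere3 rho `\` zero_locus f) :
  set_val (milnor_map x) = ev f (set_val x) / `|ev f (set_val x)| :> C.
Proof. by []. Qed.

Lemma milnor_map_continuous : continuous (@milnor_map R f rho).
Proof.
move=> x; have FF : Filter (nbhs x) by exact: nbhs_filter.
apply: (@cvg_subtype _ (nbhs x) FF).
apply: (iffRL (@cvg_complexP _ _ (nbhs x) FF _ _)).
have vx : set_val @ nbhs x --> set_val x by exact: initial_continuous.
have et : tends (nbhs x) (fun y => ev f (set_val y)) (ev f (set_val x)).
  exact: ev_tends.
have x0 : ev f (set_val x) != 0 by apply/eqP; case: (set_valP x).
have mt : (fun y => modulus (ev f (set_val y))) @ nbhs x --> modulus (ev f (set_val x)).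
  exact: tends_modulus.
have m0 : modulus (ev f (set_val x)) != 0 by rewrite modulus_eq0.
have vt : tends (nbhs x) (fun y => ((modulus (ev f (set_val y)))^-1)%:C%C)
    ((modulus (ev f (set_val x)))^-1)%:C%C.
  by apply: tends_real; exact: (cvgV m0 mt).
rewrite milnor_mapE norm_modulus -fmorphV.
apply: near_eq_tends (tendsM et vt); apply: nearW => y.
by rewrite milnor_mapE norm_modulus fmorphV.
Qed.

Hypothesis no_tangency : forall om lam (z : CC R * CC R), sphere3 rho z ->
  ~ tangent_at f om lam z.

(** The flow of rotation_flow, restricted to the complement of the zeros of f,
    is an action over the rotations of the circle. *)
Lemma milnor_fibration : locally_trivial_fibration (@milnor_map R f rho).
Proof.
pose a x := Re (ev f (toC x)); pose b x := Im (ev f (toC x)).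
have [al bl] := ev_loc_lipschitz f.
have dal i := (part_grad_loc_lipschitz f i).1.
have dbl i := (part_grad_loc_lipschitz f i).2.
have [ada bdb] := Re_gradient_along f.
have transverse x p q lam : enorm x = rho -> p ^+ 2 + q ^+ 2 = 1 -> p * b x = q * a x ->
    p *: part_grad (@Im R) f x - q *: part_grad (@Re R) f x <> lam *: x.
  move=> xS pq; apply: transverse_of_tangent xS pq => om z zS.
  exact: no_tangency.
have [T [K [Phi [T0 PhiS Phil Phif]]]] := rotation_flow rho0 al bl dal dbl ada bdb transverse.
have evN0 x : ev f (toC x) != 0 <-> a x ^+ 2 + b x ^+ 2 != 0.
  by rewrite /a /b -modulus_sqr sqrf_eq0 modulus_eq0.
pose E := set_type (sphere3 rho `\` zero_locus f).
have EP (x : E) : enorm (ofC (set_val x)) = rho /\ ev f (set_val x) != 0.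
  by have [/sphere3_enorm xS /eqP xN] := set_valP x.
pose flow t z := toC (Phi t (ofC z)).
have flow_ev t (x : E) : `|t| < T ->
    exists2 k, 0 < k & ev f (flow t (set_val x)) = k%:C%C * expi t * ev f (set_val x).
  move=> tT; have [xS xN] := EP x.
  have xN' : a (ofC (set_val x)) ^+ 2 + b (ofC (set_val x)) ^+ 2 != 0.
    by apply/evN0; rewrite ofCK.
  have [k k0 [ka kb]] := Phif _ t xS tT xN'.
  exists k => //; apply: complex_eqP.
    by rewrite [LHS]ka /a /b ofCK !ReImE /=; ring.
  by rewrite [LHS]kb /a /b ofCK !ReImE /=; ring.
have flow_in t (x : E) : `|t| < T -> flow t (set_val x) \in sphere3 rho `\` zero_locus f.
  move=> tT; have [xS xN] := EP x; apply/mem_set; split.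
    by apply/sphere3_enorm; rewrite toCK; have [] := PhiS _ t xS tT.
  have [k k0 kE] := flow_ev t x tT; rewrite /zero_locus /= mixed_evalE kE; apply/eqP.
  rewrite !mulf_neq0// -modulus_eq0 ?expi_modulus ?oner_eq0//.
  by rewrite modulus_real normr_eq0 gt_eqF.
pose G t (x : E) : E := insubd x (flow t (set_val x)).
have GE t x : `|t| < T -> set_val (G t x) = flow t (set_val x).
  by move=> tT; rewrite set_valE val_insubd flow_in.
have [x0 _] : exists x0 : E, True.
  have [y yS] : exists y : 'rV[R]_4, enorm y = rho.
    exists (rho *: delta_mx 0 0); rewrite enormZ gtr0_norm// /enorm /dot (bigD1 0)//= big1.
      by rewrite mxE eqxx /= mulr1 addr0 sqrtr1 mulr1.
    by move=> i i0; rewrite mxE (negPf i0) andbF mulr0.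
  have [z zS zN] := exists_nonzero_on_sphere rho0 bdb transverse yS.
  have zE : toC z \in sphere3 rho `\` zero_locus f.
    apply/mem_set; split; first by apply/sphere3_enorm; rewrite toCK.
    by apply/eqP; rewrite mixed_evalE; exact/evN0.
  by exists (exist (fun z => z \in sphere3 rho `\` zero_locus f) _ zE).
apply: (rotation_action_trivial T0 (G := G)) => //.
- exact: milnor_map_continuous.
- move=> t x tT; apply: val_inj; have [xS _] := EP x.
  rewrite -set_valE GE ?normrN// GE// /flow toCK.
  by have [_ ->] := PhiS _ t xS tT; rewrite ofCK.
- move=> t x tT; have [k k0 kE] := flow_ev t x tT.
  rewrite !milnor_mapE GE//.
  rewrite kE !norm_modulus !modulusM expi_modulus mulr1 modulus_real gtr0_norm//.
  rewrite rmorphM /=.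
  have kN : k%:C%C != 0 :> C by rewrite -modulus_eq0 modulus_real normr_eq0 gt_eqF.
  have mN : (modulus (ev f (set_val x)))%:C%C != 0 :> C.
    by have [_ xN] := EP x; rewrite -norm_modulus normr_eq0.
  by field; rewrite kN mN.
- move=> t x tT; apply: cvg_subtype; rewrite GE//.
  have : (fun q : R * E => flow q.1 (set_val q.2)) @ nbhs (t, x) --> flow t (set_val x).
    apply: cvg_toC; have [xS _] := EP x.
    have q1 : (fun q : R * E => q.1) @ nbhs (t, x) --> t by exact: cvg_fst.
    have q2 : (fun q : R * E => ofC (set_val q.2)) @ nbhs (t, x) --> ofC (set_val x).
      have f2 : (fun q : R * E => q.2) @ nbhs (t, x) --> x by exact: cvg_snd.
      by apply: cvg_ofC; apply: (cvg_comp _ _ f2); exact: initial_continuous.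
    have small : (fun q : R * E => K * (`|ofC (set_val q.2) - ofC (set_val x)| + `|q.1 - t|))
        @ nbhs (t, x) --> 0.
      rewrite -(mulr0 K) -[X in K * X](addr0 0); apply: cvgM; first exact: cvg_cst.
      apply: cvgD.
        by rewrite -(normr0 'rV[R]_4) -(subrr (ofC (set_val x))); apply: cvg_norm; apply: cvgB => //; exact: cvg_cst.
      by rewrite -(normr0 R) -(subrr t); apply: cvg_norm; apply: cvgB => //; exact: cvg_cst.
    apply/cvgrPdist_lt => e e0.
    near=> q; rewrite distrC.
    have qT : `|q.1| < T by near: q; exact: (cvgr_norm_lt _ q1 _ tT).
    have [qS _] := EP q.2.
    rewrite (le_lt_trans (Phil _ _ _ _ qS xS qT tT))//.
    by near: q; exact: (cvgr_lt _ small _ e0).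
  apply: cvg_trans; apply: near_eq_cvg; near=> q.
  rewrite GE//; near: q.
  by apply: (cvgr_norm_lt _ _ _ tT); exact: cvg_fst.
Unshelve. all: by end_near. Qed.

End MilnorFibration.

Theorem theorem1p4 (R : realType) (f : mixed_poly R) (f_neq0 : f != 0)
    (f00 : mixed_eval f (0, 0) = 0) (f_sind : sind f) :
  strong_milnor_condition f.
Proof.
have [rho0 rho0_gt0 nt] := sind_no_tangency f_neq0 f_sind.
exists rho0; split => // rho rho_gt0 rho_le; apply: milnor_fibration => // om lam z zS.
have zR : modulus (z.1 : complex R) ^+ 2 + modulus (z.2 : complex R) ^+ 2 = rho ^+ 2.
  have : `|z.1| ^+ 2 + `|z.2| ^+ 2 = (real_complex R rho) ^+ 2 :> complex R by exact: zS.
  by rewrite !norm_modulus -!(rmorphXn (real_complex R)) -rmorphD => /complexI.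
apply: nt => [z0|c].
  have [z1 z2] : z.1 = 0 :> complex R /\ z.2 = 0 :> complex R by rewrite z0.
  move: zR; rewrite z1 z2 modulus0 expr0n /= addr0 => /esym/eqP.
  by rewrite sqrf_eq0 gt_eqF.
rewrite (le_trans _ rho_le)// -(@ler_pXn2r _ 2)// ?nnegrE ?modulus_ge0 ?(ltW rho_gt0)// -zR.
by case: c; rewrite /moduli /axis ?lerDl ?lerDr sqr_ge0.
Qed.
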